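(* Let $G\in\{SO(N),U(N),SU(N)\}$, $\beta\in\mathbb R$, and let $s=(l_1,\dots,l_m)$ be a loop sequence of non-null loops such that every vertex at graph distance $\leqslant 1$ from some $l_i$ belongs to $\Lambda$. Then: (i) for $G=SO(N)$, $$(N-1)|s|\phi(s)=N\beta\!\!\sum_{s'\in\mathbb D^-(s)}\!\!\phi(s')-N\beta\!\!\sum_{s'\in\mathbb D^+(s)}\!\!\phi(s')+N\!\!\sum_{s'\in\mathbb S^-(s)}\!\!\phi(s')-N\!\!\sum_{s'\in\mathbb S^+(s)}\!\!\phi(s')+\!\!\sum_{s'\in\mathbb T^-(s)}\!\!\phi(s')-\!\!\sum_{s'\in\mathbb T^+(s)}\!\!\phi(s')+\frac1N\!\!\sum_{s'\in\mathbb M^-(s)}\!\!\phi(s')-\frac1N\!\!\sum_{s'\in\mathbb M^+(s)}\!\!\phi(s');$$ (ii) for $G=SU(N)$, $$\Big(N|s|-\frac{\ell(s)}{N}\Big)\phi(s)=\frac{N\beta}{2}\!\!\sum_{s'\in\mathbb D^-(s)}\!\!\phi(s')-\frac{N\beta}{2}\!\!\sum_{s'\in\mathbb D^+(s)}\!\!\phi(s')+N\!\!\sum_{s'\in\mathbb S^-(s)}\!\!\phi(s')-N\!\!\sum_{s'\in\mathbb S^+(s)}\!\!\phi(s')+\frac{N\beta}{2}\!\!\sum_{s'\in\mathbb E^-(s)}\!\!\phi(s')-\frac{N\beta}{2}\!\!\sum_{s'\in\mathbb E^+(s)}\!\!\phi(s')+\frac1N\!\!\sum_{s'\in\mathbb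 M_U^-(s)}\!\!\phi(s')-\frac1N\!\!\sum_{s'\in\mathbb M_U^+(s)}\!\!\phi(s');$$ (iii) for $G=U(N)$, $$N|s|\phi(s)=\frac{N\beta}{2}\!\!\sum_{s'\in\mathbb D^-(s)}\!\!\phi(s')-\frac{N\beta}{2}\!\!\sum_{s'\in\mathbb D^+(s)}\!\!\phi(s')+N\!\!\sum_{s'\in\mathbb S^-(s)}\!\!\phi(s')-N\!\!\sum_{s'\in\mathbb S^+(s)}\!\!\phi(s')+\frac1N\!\!\sum_{s'\in\mathbb M_U^-(s)}\!\!\phi(s')-\frac1N\!\!\sum_{s'\in\mathbb M_U^+(s)}\!\!\phi(s').$$ All sums are over the indexing data of the multisets (i.e. with multiplicity).
   Context: Lattice. Let $d\ge2$, $N\ge2$, and $\Lambda\subset\mathbb Z^d$ finite. An edge $e$ is a directed nearest-neighbour pair with starting point $u(e)$ and ending point $v(e)$; it is positively oriented if $u(e)$ is lexicographically smaller than $v(e)$. $E^+,E^-$ are the sets of positively/negatively oriented edges, $E=E^+\cup E^-$, $e^{-1}$ is $e$ with reversed orientation, and $E^\pm_\Lambda$ are the edges of $E^\pm$ with both endpoints in $\Lambda$. A path is a sequence $e_1\cdots e_n$ of edges with $v(e_i)=u(e_{i+1})$; it is closed if $v(e_n)=u(e_1)$; for a path $b=e_1\cdots e_k$, $b^{-1}=e_k^{-1}\cdots e_1^{-1}$. A plaquette is a closed path $p=e_1e_2e_3e_4$ of length four going once around the boundary of a unit square. $\mathcal P_\Lambda$ is the set of plaquettes with all vertices in $\Lambda$;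 for an edge $e$ we write $p\succ e$ if $p\in\mathcal P_\Lambda$ and the first edge of $p$ is $e$. $\mathcal P^+_\Lambda\subset\mathcal P_\Lambda$ is the set of $p=e_1e_2e_3e_4$ such that $u(e_1)$ is the lexicographically smallest vertex of $p$ and $v(e_1)$ the second smallest. Loops. Closed paths are cyclically equivalent if one is a cyclic shift of the other; equivalence classes are cycles. A loop is a cycle with no two cyclically consecutive edges of the form $e,e^{-1}$ (no backtrack); for a cycle $c$, $[c]$ is the loop obtained by successively erasing backtracks (possibly the null loop). For a loop $l$ with a chosen representative $e_1\cdots e_n$, the indices $x\in\{1,\dots,n\}$ are locations, $e_x$ is the edge at location $x$, and $|l|=n$. A loop sequence is a finite sequence $s=(l_1,\dots,l_m)$ of loops; $|s|=\sum_i|l_i|$. For $e\in E^+$, $t_i(e)$ is the number of occurrences of $e$ minus the number of occurrences of $e^{-1}$ in $l_i$, $t(e)=\sum_i t_i(e)$, and $\ell(s)=\sum_{e\in E^+}t(e)^2$. Measure and Wilson loops. Let $G\in\{SO(N),U(N),SU(N)\}$ with Haar probability measure $\sigma_N$. For $Q=(Q_e)_{e\in E^+_\Lambda}\in G^{E^+_\Lambda}$ set $Q_e=Q_{e^{-1}}^{-1}$ for $e\in E^-_\Lambda$ and $Q_{e_1\cdots e_n}=Q_{e_1}\cdots Q_{e_n}$. The lattice Yang–Mills measure is $d\mu_{\Lambda,N,\beta}(Q)=Z^{-1}\exp\big(N\beta\,\mathrm{Re}\sum_{p\in\mathcal P^+_\Lambda}\mathrm{Tr}(Q_p)\big)\prod_{e\in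 E^+_\Lambda}d\sigma_N(Q_e)$, $Z$ the normalizing constant, $\mathbf E$ its expectation. For a loop $l=e_1\cdots e_n$ (edges in $E_\Lambda$), $W_l=\mathrm{Tr}(Q_{e_1}\cdots Q_{e_n})$ (independent of representative, and for a cycle $c$ the trace of its product equals $W_{[c]}$); the null loop has $W=N$. For $s=(l_1,\dots,l_m)$, $W_s=\prod_i W_{l_i}$ and $\phi(s)=\mathbf E[W_s]/N^m$. Operations (below, for a loop and a location $x$ we always use the cyclic representative beginning at location $x$; $b,c,d,q$ denote possibly empty paths). Let $l$ be a loop and $x\ne y$ locations of $l$. If $e_y=e_x=e$, write $l=e\,b\,e\,c$ (second $e$ at location $y$): positive splitting gives the pair $([ec],[be])$ and negative twisting gives $[b^{-1}c]$. If $e_y=e_x^{-1}$, write $l=e\,b\,e^{-1}c$: negative splitting gives $([c],[b])$ and positive twisting gives $[e\,b^{-1}e^{-1}c]$. For loops $l,l'$ and locations $x$ in $l$, $y$ in $l'$: if the edges agree, write $l=eb$, $l'=ed$; then $l\oplus_{x,y}l'=[e\,d\,e\,b]$ (positive merger) and $l\ominus_{x,y}l'=[d^{-1}b]$ (negative merger). If $l=eb$, $l'=e^{-1}d$, then $l\oplus_{x,y}l'=[e\,d^{-1}e\,b]$ and $l\ominus_{x,y}l'=[d\,b]$. For a location $x$ in $l$ with $e=e_x$ and a plaquette $p\succ e$, write $p=e\,q$; the positive and negative deformations are $l\oplus_xp=[e\,q\,e\,b]$ and $l\ominus_xp=[q^{-1}b]$ where $l=eb$. Multisets for $s=(l_1,\dots,l_m)$: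 $\mathbb S^+(s)$ (resp. $\mathbb S^-(s)$): for each $i$ and each ordered pair $(x,y)$ of distinct locations of $l_i$ with $e_y=e_x$ (resp. $e_y=e_x^{-1}$), the sequence obtained by replacing $l_i$ with the two loops of the positive (resp. negative) splitting. $\mathbb T^-(s)$ (resp. $\mathbb T^+(s)$): same index sets with $e_y=e_x$ (resp. $e_y=e_x^{-1}$), replacing $l_i$ by its negative (resp. positive) twisting. $\mathbb M^+(s)$ (resp. $\mathbb M^-(s)$): for each ordered pair $i\ne j$, location $x$ of $l_i$, location $y$ of $l_j$ with $e_y\in\{e_x,e_x^{-1}\}$, the sequence obtained by replacing $l_i,l_j$ by the single loop $l_i\oplus_{x,y}l_j$ (resp. $l_i\ominus_{x,y}l_j$); $\mathbb M_U^+(s)\subset\mathbb M^+(s)$ consists of those terms with $e_y=e_x$, and $\mathbb M_U^-(s)\subset\mathbb M^-(s)$ of those with $e_y=e_x^{-1}$. $\mathbb D^\pm(s)$: for each $i$, location $x$ of $l_i$, and $p\succ e_x$, replace $l_i$ by $l_i\oplus_xp$ (for $+$) or $l_i\ominus_xp$ (for $-$). $\mathbb E^-(s)$ (resp. $\mathbb E^+(s)$): for each $i$, location $x$ of $l_i$, and $p\succ e_x$ (resp. $p\succ e_x^{-1}$), the sequence $(l_1,\dots,l_m,p)$. $\phi$ of a resulting sequence with $k$ components is $\mathbf E[W_{s'}]/N^k$. *)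

(* Defs.v *)
From HB Require Import structures.
From mathcomp Require Import all_boot all_order all_algebra.
From mathcomp Require Import all_classical all_reals all_analysis.
From mathcomp Require Import complex.
Set Implicit Arguments. Unset Strict Implicit. Unset Printing Implicit Defensive.
Import Order.TTheory GRing.Theory Num.Theory.
Local Open Scope ring_scope.

Section Lattice.
Variable d : nat.

Definition vtx := {ffun 'I_d -> int}.
Definition edge := (vtx * vtx)%type.
Definition einv (e : edge) : edge := (e.2, e.1).

Definition vadd (u v : vtx) : vtx := [ffun j => u j + v j].
Definition vsub (u v : vtx) : vtx := [ffun j => u j - v j].
Definition vneg (u : vtx) : vtx := [ffun j => - u j].

Definition unitvec (i : 'I_d) (b : bool) : vtx :=
  [ffun j => if j == i then (if b then 1 else -1) else 0].
Definition unitvecs : seq vtx :=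
  [seq unitvec ib.1 ib.2 | ib <- enum {: 'I_d * bool}].

Definition nn (u v : vtx) : bool := vsub v u \in unitvecs.
Definition is_edge (e : edge) : bool := nn e.1 e.2.

Definition lexlt (u v : vtx) : bool :=
  [exists i : 'I_d, [forall j : 'I_d, (j < i)%N ==> (u j == v j)] && (u i < v i)].

Definition positive (e : edge) : bool := lexlt e.1 e.2.

Definition v0 : vtx := [ffun => 0].
Definition e0 : edge := (v0, v0).

Definition pinv (b : seq edge) : seq edge := rev (map einv b).

Variable L : seq vtx.

Definition EplusL : seq edge :=
  [seq e <- [seq (u, v) | u <- undup L, v <- undup L] | is_edge e && positive e].

Definition mkplaq (x a b : vtx) : seq edge :=
  [:: (x, vadd x a); (vadd x a, vadd (vadd x a) b);
      (vadd (vadd x a) b, vadd x b); (vadd x b, x)].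
Definition ortho (a b : vtx) : bool := (b != a) && (b != vneg a).
Definition plaq_in (x a b : vtx) : bool :=
  all (fun w => w \in L) [:: x; vadd x a; vadd (vadd x a) b; vadd x b].

Definition plaquettes : seq (seq edge) :=
  [seq mkplaq t.1.1 t.1.2 t.2 |
     t <- [seq t <- [seq (xa, b) | xa <- [seq (x, a) | x <- undup L, a <- unitvecs], b <- unitvecs]
          | ortho t.1.2 t.2 && plaq_in t.1.1 t.1.2 t.2]].

Definition plaqs_from (e : edge) : seq (seq edge) :=
  [seq p <- plaquettes | head e0 p == e].

Definition pverts (p : seq edge) : seq vtx := map fst p.
Definition Pcond (p : seq edge) : bool :=
  let u := (head e0 p).1 in let v := (head e0 p).2 in
  all (fun w => (w == u) || lexlt u w) (pverts p) &&
  all (fun w => [|| w == u, w == v | lexlt v w]) (pverts p).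
Definition Pplus : seq (seq edge) := [seq p <- plaquettes | Pcond p].

End Lattice.

Section Loops.
Variable d : nat.
Local Notation edge := (edge d).
Local Notation e0 := (e0 d).

Definition enth (l : seq edge) (x : nat) : edge := nth e0 l x.

Definition closedp (l : seq edge) : bool :=
  all (fun i => (enth l i).2 == (enth l ((i + 1) %% size l)).1) (iota 0 (size l)).
Definition nobt (l : seq edge) : bool :=
  all (fun i => enth l ((i + 1) %% size l) != einv (enth l i)) (iota 0 (size l)).
(* l is a (representative of a) non-null loop *)
Definition is_loop (l : seq edge) : bool :=
  [&& l != [::], all (@is_edge d) l, closedp l & nobt l].

(* [c] : successive erasure of backtracks (free reduction, then cyclic reduction) *)
Definition push (e : edge) (acc : seq edge) : seq edge :=
  if acc is e' :: acc' then (if e' == einv e then acc' else e :: acc) else [:: e].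
Definition freered (s : seq edge) : seq edge := foldr push [::] s.
Fixpoint cycred (fuel : nat) (s : seq edge) : seq edge :=
  match fuel with
  | 0 => s
  | f.+1 => if s is e :: s' then
              (if (s' != [::]) && (last e s' == einv e)
               then cycred f (behead (belast e s')) else s)
            else s
  end.
Definition red (c : seq edge) : seq edge := cycred (size c) (freered c).

(* for locations x != y of l, writing rot x l = e b e' c with e' at location y *)
Definition segb (l : seq edge) (x y : nat) : seq edge :=
  let k := ((y + size l - x) %% size l)%N in take k.-1 (behead (rot x l)).
Definition segc (l : seq edge) (x y : nat) : seq edge :=
  let k := ((y + size l - x) %% size l)%N in drop k.+1 (rot x l).

(* e_y = e_x = e,  l = e b e c *)
Definition pos_split (l : seq edge) x y : seq (seq edge) :=
  let e := enth l x in [:: red (e :: segc l x y); red (segb l x y ++ [:: e])].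
Definition neg_twist (l : seq edge) x y : seq edge :=
  red (pinv (segb l x y) ++ segc l x y).
(* e_y = e_x^{-1},  l = e b e^{-1} c *)
Definition neg_split (l : seq edge) x y : seq (seq edge) :=
  [:: red (segc l x y); red (segb l x y)].
Definition pos_twist (l : seq edge) x y : seq edge :=
  let e := enth l x in red (e :: pinv (segb l x y) ++ einv e :: segc l x y).

(* mergers: l = e b, l' = e d or e^{-1} d *)
Definition merge_pos (l l' : seq edge) x y : seq edge :=
  let e := enth l x in let b := behead (rot x l) in let dd := behead (rot y l') in
  if enth l' y == e then red (e :: dd ++ e :: b) else red (e :: pinv dd ++ e :: b).
Definition merge_neg (l l' : seq edge) x y : seq edge :=
  let e := enth l x in let b := behead (rot x l) in let dd := behead (rot y l') in
  if enth l' y == e then red (pinv dd ++ b) else red (dd ++ b).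

(* deformations: p = e q, l = e b *)
Definition def_pos (l : seq edge) x (p : seq edge) : seq edge :=
  let e := enth l x in red (e :: behead p ++ e :: behead (rot x l)).
Definition def_neg (l : seq edge) x (p : seq edge) : seq edge :=
  red (pinv (behead p) ++ behead (rot x l)).

Definition lnth (s : seq (seq edge)) i : seq edge := nth [::] s i.
Definition replace1 (s : seq (seq edge)) i (ls : seq (seq edge)) :=
  take i s ++ ls ++ drop i.+1 s.
Definition remove2 (s : seq (seq edge)) i j :=
  [seq lnth s k | k <- iota 0 (size s) & (k != i) && (k != j)].

Definition same (ex ey : edge) : bool := ey == ex.
Definition opp (ex ey : edge) : bool := ey == einv ex.
Definition sameopp (ex ey : edge) : bool := (ey == ex) || (ey == einv ex).

Definition locpairs (P : edge -> edge -> bool) (l : seq edge) : seq (nat * nat) :=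
  [seq xy <- [seq (x, y) | x <- iota 0 (size l), y <- iota 0 (size l)]
   | (xy.1 != xy.2) && P (enth l xy.1) (enth l xy.2)].

Definition split_set P (op : seq edge -> nat -> nat -> seq (seq edge))
    (s : seq (seq edge)) : seq (seq (seq edge)) :=
  flatten [seq [seq replace1 s i (op (lnth s i) xy.1 xy.2)
               | xy <- locpairs P (lnth s i)] | i <- iota 0 (size s)].
Definition twist_set P (op : seq edge -> nat -> nat -> seq edge)
    (s : seq (seq edge)) : seq (seq (seq edge)) :=
  flatten [seq [seq replace1 s i [:: op (lnth s i) xy.1 xy.2]
               | xy <- locpairs P (lnth s i)] | i <- iota 0 (size s)].

Definition Splus s := split_set same pos_split s.
Definition Sminus s := split_set opp neg_split s.
Definition Tminus s := twist_set same neg_twist s.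
Definition Tplus s := twist_set opp pos_twist s.

Definition locpairs2 (P : edge -> edge -> bool) (l l' : seq edge) :=
  [seq xy <- [seq (x, y) | x <- iota 0 (size l), y <- iota 0 (size l')]
   | P (enth l xy.1) (enth l' xy.2)].
Definition ijpairs (s : seq (seq edge)) : seq (nat * nat) :=
  [seq ij <- [seq (i, j) | i <- iota 0 (size s), j <- iota 0 (size s)] | ij.1 != ij.2].

Definition merge_set P (op : seq edge -> seq edge -> nat -> nat -> seq edge)
    (s : seq (seq edge)) : seq (seq (seq edge)) :=
  flatten [seq [seq op (lnth s ij.1) (lnth s ij.2) xy.1 xy.2 :: remove2 s ij.1 ij.2
               | xy <- locpairs2 P (lnth s ij.1) (lnth s ij.2)] | ij <- ijpairs s].

Definition Mplus s := merge_set sameopp merge_pos s.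
Definition Mminus s := merge_set sameopp merge_neg s.
Definition MUplus s := merge_set same merge_pos s.
Definition MUminus s := merge_set opp merge_neg s.

Definition slen (s : seq (seq edge)) : nat := size (flatten s).
Definition tcount (s : seq (seq edge)) (e : edge) : int :=
  (count_mem e (flatten s))%:Z - (count_mem (einv e) (flatten s))%:Z.
Definition ell (s : seq (seq edge)) : int :=
  \sum_(e <- undup [seq (if positive e then e else einv e) | e <- flatten s])
     tcount s e ^+ 2.

End Loops.

Section LambdaOps.
Variables (d : nat) (L : seq (vtx d)).
Local Notation edge := (edge d).

Definition Dplus (s : seq (seq edge)) : seq (seq (seq edge)) :=
  flatten [seq flatten [seq [seq replace1 s i [:: def_pos (lnth s i) x p]
                            | p <- plaqs_from L (enth (lnth s i) x)]
                       | x <- iota 0 (size (lnth s i))] | i <- iota 0 (size s)].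
Definition Dminus (s : seq (seq edge)) : seq (seq (seq edge)) :=
  flatten [seq flatten [seq [seq replace1 s i [:: def_neg (lnth s i) x p]
                            | p <- plaqs_from L (enth (lnth s i) x)]
                       | x <- iota 0 (size (lnth s i))] | i <- iota 0 (size s)].
Definition Eminus (s : seq (seq edge)) : seq (seq (seq edge)) :=
  flatten [seq flatten [seq [seq rcons s p
                            | p <- plaqs_from L (enth (lnth s i) x)]
                       | x <- iota 0 (size (lnth s i))] | i <- iota 0 (size s)].
Definition Eplus (s : seq (seq edge)) : seq (seq (seq edge)) :=
  flatten [seq flatten [seq [seq rcons s p
                            | p <- plaqs_from L (einv (enth (lnth s i) x))]
                       | x <- iota 0 (size (lnth s i))] | i <- iota 0 (size s)].

Definition nbhd_in (s : seq (seq edge)) : Prop :=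
  forall l, l \in s -> forall e, e \in l ->
    e.1 \in L /\ forall a, a \in unitvecs d -> vadd e.1 a \in L.

End LambdaOps.

Inductive gkind := SO | U | SU.

Section YM.
Variable R : realType.
Local Notation C := R[i].
Variable N : nat.
Local Notation mat := 'M[C]_N.

Definition conjmx (M : mat) : mat := map_mx Num.conj M.
Definition adjmx (M : mat) : mat := (conjmx M)^T.

Definition inG (k : gkind) (M : mat) : bool :=
  match k with
  | SO => [&& conjmx M == M, M^T *m M == 1%:M & \det M == 1]
  | U => adjmx M *m M == 1%:M
  | SU => (adjmx M *m M == 1%:M) && (\det M == 1)
  end.

Definition cont_on (Gp : pred mat) (f : mat -> C) : Prop :=
  forall M, Gp M -> forall eps : R, 0 < eps ->
    exists2 del : R, 0 < del &
      forall M', Gp M' -> (forall i j, `|M' i j - M i j| < (del%:C)%C) ->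
        `|f M' - f M| < (eps%:C)%C.

(* I is integration against the (normalized) Haar probability measure of G,
   characterized as a normalized positive left-invariant linear functional on
   the functions that are continuous on G (Riesz + uniqueness of Haar measure) *)
Definition is_haar (Gp : pred mat) (I : (mat -> C) -> C) : Prop :=
  [/\ (forall f g (c : C), cont_on Gp f -> cont_on Gp g ->
         I (fun M => f M + c * g M) = I f + c * I g),
      (forall f, cont_on Gp f -> (forall M, Gp M -> 0 <= f M) -> 0 <= I f),
      I (fun _ => 1) = 1 &
      (forall f g, cont_on Gp f -> Gp g -> I (fun M => f (g *m M)) = I f)].

Variable d : nat.
Local Notation edge := (edge d).

Definition Qe (Q : edge -> mat) (e : edge) : mat :=
  if positive e then Q e else invmx (Q (einv e)).
Definition pathmx (Q : edge -> mat) (l : seq edge) : mat :=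
  foldr (fun e M => Qe Q e *m M) 1%:M l.
Definition Wl (Q : edge -> mat) (l : seq edge) : C := \tr (pathmx Q l).
Definition Ws (Q : edge -> mat) (s : seq (seq edge)) : C := \prod_(l <- s) Wl Q l.

Fixpoint intg (I : (mat -> C) -> C) (es : seq edge) (f : (edge -> mat) -> C)
    (Q : edge -> mat) : C :=
  match es with
  | [::] => f Q
  | e :: es' => I (fun M => intg I es' f (fun e' => if e' == e then M else Q e'))
  end.

Variables (L : seq (vtx d)) (beta : R) (I : (mat -> C) -> C).

Definition Q0 : edge -> mat := fun _ => 1%:M.

Definition weight (Q : edge -> mat) : C :=
  ((expR (N%:R * beta * \sum_(p <- Pplus L) complex.Re (\tr (pathmx Q p))))%:C)%C.

Definition YMexp (F : (edge -> mat) -> C) : C :=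
  intg I (EplusL L) (fun Q => F Q * weight Q) Q0 / intg I (EplusL L) weight Q0.

Definition phi (s : seq (seq edge)) : C := YMexp (fun Q => Ws Q s) / N%:R ^+ size s.

Definition sumphi (ss : seq (seq (seq edge))) : C := \sum_(s' <- ss) phi s'.

End YM.

(* Main.v *)
(** Integrating by parts twice in every edge variable: for a left-invariant vector field X
    acting on the edge f, the integral of D_X (D_Y W_s * exp S) vanishes, because left
    translation of the f-coordinate along a curve in the group tangent to X preserves the
    iterated Haar integral. The integrand is complex linear in X, so X may range over the
    complexified Lie algebra gl_N, sl_N or so_N. Summing over a basis (E_ij, respectively
    E_ij - delta_ij/N or E_ij - E_ji) paired with its dual, the completeness relations turn
    every pair of occurrences of f, f^-1 in the loops, or in a loop and a plaquette, into
    products of traces of the words that define splittings, twistings, mergers, deformations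
    and expansions; summing over f gives the loop equation. Writing kappa = 1/N for SU(N) and
    0 otherwise, and o = 1 for SO(N) and 0 otherwise, the three groups are treated at once. *)

Require Import Defs.
From HB Require Import structures.
From mathcomp Require Import all_boot all_order all_algebra.
From mathcomp Require Import all_classical all_reals all_analysis.
From mathcomp Require Import complex ring lra zify.
Set Implicit Arguments. Unset Strict Implicit. Unset Printing Implicit Defensive.
Import Order.TTheory GRing.Theory Num.Theory.
Local Open Scope ring_scope.
Local Notation pinv := Defs.pinv.

(** * Matrix groups *)

Section GroupFacts.
Variables (R : realType) (N : nat).
Local Notation C := R[i].
Local Notation mat := 'M[C]_N.
Implicit Types (M P : mat) (k : gkind).

(** The group integral is known only through linearity, positivity, normalization and left
    invariance on continuous functions: neither a density nor a Fubini theorem nor differentiation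
    under the integral is at hand. The iterated integral is therefore controlled on bounded
    Lipschitz functions of the whole configuration, a class that each partial integration preserves
    at the cost of a factor 2, and a derivative is a first-order expansion whose remainder is O(t^2)
    uniformly in the configuration. Invariance under translation by [g t] then bounds the integral
    of the derivative by a constant times t for every small t, so it vanishes. Matrix exponentials
    are avoided: rational curves, built from reflections and Cayley transforms, already span the
    tangent spaces. Of the two directions only X has to come from a curve; Y is a fixed matrix in an
    explicit formula. The term in kappa weighs every ordered pair of locations by its relative
    orientation, and counting these signs gives the sum of the squares t(e)^2, hence ell(s)/N. *)

Lemma adjmxM M P : adjmx (M *m P) = adjmx P *m adjmx M.
Proof. by rewrite /adjmx /Defs.conjmx map_mxM trmx_mul. Qed.

Lemma adjmxK M : adjmx (adjmx M) = M.
Proof. by apply/matrixP => i j; rewrite !mxE conjCK. Qed.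

Lemma adjmx1 : adjmx (1%:M : mat) = 1%:M.
Proof. by rewrite /adjmx /Defs.conjmx map_mx1 trmx1. Qed.

Lemma adjmxD M P : adjmx (M + P) = adjmx M + adjmx P.
Proof. by apply/matrixP => i j; rewrite !mxE rmorphD. Qed.

Lemma adjmxZ (a : C) M : adjmx (a *: M) = a^* *: adjmx M.
Proof. by apply/matrixP => i j; rewrite !mxE rmorphM. Qed.

Lemma inG_adjK k M : inG k M -> adjmx M *m M = 1%:M.
Proof.
case: k => /=; last by case/andP=> /eqP.
- by case/and3P => /eqP h /eqP <- _; rewrite /adjmx h.
- by move/eqP.
Qed.

Lemma inG_invmx k M : inG k M -> invmx M = adjmx M.
Proof.
move=> /inG_adjK h; have [_ uM] := mulmx1_unit h.
by rewrite -[RHS]mulmx1 -(mulmxV uM) mulmxA h mul1mx.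
Qed.

Lemma inG1 k : inG k (1%:M : mat).
Proof.
case: k => /=; rewrite ?adjmx1 ?mul1mx ?det1 ?eqxx //.
by rewrite /Defs.conjmx map_mx1 trmx1 mul1mx !eqxx.
Qed.

Lemma inG_mul k M P : inG k M -> inG k P -> inG k (M *m P).
Proof.
have tri (A B A' B' : mat) : A' *m A = 1%:M -> B' *m B = 1%:M ->
    B' *m A' *m (A *m B) = 1%:M.
  by move=> h h'; rewrite mulmxA -(mulmxA B') h mulmx1.
case: k => /=.
- move=> /and3P[/eqP a /eqP b /eqP c] /and3P[/eqP a' /eqP b' /eqP c'].
  by rewrite /Defs.conjmx map_mxM -!/(Defs.conjmx _) a a' eqxx trmx_mul tri // eqxx
    det_mulmx c c' mulr1 eqxx.
- by move=> /eqP a /eqP b; rewrite adjmxM tri.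
- move=> /andP[/eqP a /eqP b] /andP[/eqP a' /eqP b'].
  by rewrite adjmxM tri // det_mulmx b b' mulr1 !eqxx.
Qed.

(** The columns are unit vectors. Group-valued configurations thus form a bounded domain, on which
    products of Lipschitz functions stay Lipschitz. *)
Lemma inG_entry k M i j : inG k M -> `|M i j| <= 1.
Proof.
move=> /inG_adjK /matrixP /(_ j j); rewrite !mxE eqxx => h.
rewrite -(ler_pXn2r (n := 2)) ?nnegrE // expr1n -[X in _ <= X]h.
rewrite (bigD1 i) //= !mxE normCKC lerDl sumr_ge0 // => l _.
by rewrite !mxE -normCKC exprn_ge0.
Qed.

End GroupFacts.

(** * Lipschitz functions of configurations and iterated Haar integrals *)

Section Lipschitz.
Variables (R : realType) (N d : nat) (k : gkind).
Local Notation C := R[i].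
Local Notation mat := 'M[C]_N.
Local Notation edge := (edge d).
Local Notation config := (edge -> mat).
Implicit Types (Q : config) (F : config -> C).

Definition gval Q := forall e, inG k (Q e).
Definition upd Q (e : edge) (M : mat) : config := fun e' => if e' == e then M else Q e'.
Definition close (del : C) Q Q' := forall e i j, `|Q' e i j - Q e i j| <= del.
(** One constant serves as sup bound and as Lipschitz constant for the entrywise sup distance over
    all edges. Integrating out one edge preserves this class by a direct estimate, where mere
    continuity would call for a compactness argument. *)
Definition lip_with (K : C) F := (forall Q, gval Q -> `|F Q| <= K) /\
  forall Q Q' del, gval Q -> gval Q' -> 0 <= del -> close del Q Q' ->
    `|F Q' - F Q| <= K * del.
Definition lip F := exists K, lip_with K F.

Lemma gval_upd Q e M : gval Q -> inG k M -> gval (upd Q e M).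
Proof. by move=> gQ gM e'; rewrite /upd; case: eqP. Qed.

Lemma gval_Q0 : gval (Q0 R N (d := d)).
Proof. by move=> e; apply: inG1. Qed.

Lemma lip_ext F F' : (forall Q, gval Q -> F Q = F' Q) -> lip F -> lip F'.
Proof.
move=> h [K [b l]]; exists K; split=> [Q gQ|Q Q' del gQ gQ' d0 c].
  by rewrite -h ?b.
by rewrite -!h ?l.
Qed.

Lemma lip_with_ge0 K F : lip_with K F -> 0 <= K.
Proof. by case=> b _; apply: le_trans (b _ gval_Q0). Qed.

Lemma lip_cst (c : C) : lip (fun=> c).
Proof.
exists `|c|; split=> // Q Q' del _ _ d0 _.
by rewrite subrr normr0 mulr_ge0.
Qed.

Lemma lip_lin (c : C) F F' : lip F -> lip F' -> lip (fun Q => F Q + c * F' Q).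
Proof.
move=> [K [b l]] [K' [b' l']]; exists (K + `|c| * K'); split=> [Q gQ|Q Q' del gQ gQ' d0 cl].
  by apply: le_trans (ler_normD _ _) _; rewrite normrM lerD ?b // ler_wpM2l ?b'.
rewrite opprD addrACA -mulrBr mulrDl -mulrA; apply: le_trans (ler_normD _ _) _.
by rewrite normrM lerD ?l // ler_wpM2l ?l'.
Qed.

Lemma lipD F F' : lip F -> lip F' -> lip (fun Q => F Q + F' Q).
Proof.
by move=> l l'; apply: lip_ext (lip_lin 1 l l') => Q _; rewrite mul1r.
Qed.

Lemma lipM F F' : lip F -> lip F' -> lip (fun Q => F Q * F' Q).
Proof.
move=> [K l] [K' l']; have K0 := lip_with_ge0 l; have K'0 := lip_with_ge0 l'.
case: l l' => b l [b' l'].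
exists (K * K' + K * K'); split=> [Q gQ|Q Q' del gQ gQ' d0 cl].
  rewrite normrM; apply: le_trans (_ : K * K' <= _); first by rewrite ler_pM ?b ?b'.
  by rewrite lerDl mulr_ge0.
have -> : F Q' * F' Q' - F Q * F' Q =
   F Q' * (F' Q' - F' Q) + (F Q' - F Q) * F' Q by ring.
apply: le_trans (ler_normD _ _) _; rewrite !normrM mulrDl lerD //.
  by rewrite -mulrA ler_pM ?b ?l'.
by rewrite mulrAC ler_pM ?b' ?l.
Qed.

Lemma lip_sum (T : Type) (r : seq T) (P : pred T) (F : T -> config -> C) :
  (forall a, lip (F a)) -> lip (fun Q => \sum_(a <- r | P a) F a Q).
Proof.
move=> l; elim: r => [|a r ih].
  by apply: lip_ext (lip_cst 0) => Q _; rewrite big_nil.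
case Pa: (P a); last by apply: lip_ext ih => Q _; rewrite big_cons Pa.
by apply: lip_ext (lipD (l a) ih) => Q _; rewrite big_cons Pa.
Qed.

Lemma lip_prod (T : Type) (r : seq T) (P : pred T) (F : T -> config -> C) :
  (forall a, lip (F a)) -> lip (fun Q => \prod_(a <- r | P a) F a Q).
Proof.
move=> l; elim: r => [|a r ih].
  by apply: lip_ext (lip_cst 1) => Q _; rewrite big_nil.
case Pa: (P a); last by apply: lip_ext ih => Q _; rewrite big_cons Pa.
by apply: lip_ext (lipM (l a) ih) => Q _; rewrite big_cons Pa.
Qed.

Lemma lip_conj F : lip F -> lip (fun Q => (F Q)^*).
Proof.
move=> [K [b l]]; exists K; split=> [Q gQ|Q Q' del gQ gQ' d0 cl].
  by rewrite norm_conjC b.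
by rewrite -rmorphB norm_conjC l.
Qed.

Lemma lip_entry e i j : lip (fun Q => Q e i j).
Proof.
exists 1; split=> [Q gQ|Q Q' del gQ gQ' d0 cl]; last by rewrite mul1r cl.
exact: inG_entry (gQ e).
Qed.

Lemma lip_upd Q e F : gval Q -> lip F -> cont_on (inG k) (fun M => F (upd Q e M)).
Proof.
move=> gQ [K l] M gM eps eps0; have K0 := lip_with_ge0 l.
have [_ {}l] := l.
have Kr : K = ((complex.Re K)%:C)%C by rewrite RRe_real // ger0_real.
have K0' : 0 <= complex.Re K by rewrite -((lecR 0)) -Kr.
(* The summand 1 covers K = 0 and makes the final inequality strict. *)
exists (eps / (1 + complex.Re K)); first by rewrite divr_gt0 // ltr_wpDr.
move=> M' gM' cl.
have e0 : 0 <= ((eps / (1 + complex.Re K))%:C)%C.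
  by rewrite (lecR 0) divr_ge0 ?addr_ge0 // ltW.
apply: le_lt_trans (l _ _ _ _ _ e0 _) _.
- exact: gval_upd.
- exact: gval_upd.
- move=> e' i j; rewrite /upd; case: eqP => _; first by rewrite ltW.
  by rewrite subrr normr0.
rewrite Kr -rmorphM /= ltcR mulrCA -[X in _ < X]mulr1 ltr_pM2l // ltr_pdivrMr ?mul1r ?ltrDr //.
by rewrite ltr_wpDr.
Qed.

(** * Estimates for iterated Haar integrals *)

Variable I : (mat -> C) -> C.
Hypothesis hI : is_haar (inG k) I.

(** Homogeneity is available only inside the combined rule for F + c G, so c is written as 1 + (c -
    1) * 1. *)
Lemma haar_cst (c : C) : I (fun=> c) = c.
Proof.
have [lin _ one _] := hI.
have c1 : cont_on (inG k) ((fun=> 1) : mat -> C).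
  by move=> M _ eps eps0; exists 1 => // M' _ _; rewrite subrr normr0 (ltcR 0).
have := lin _ _ (c - 1) c1 c1; rewrite one.
have -> : (fun _ : mat => 1 + (c - 1) * 1) = fun=> c by apply/funext => ?; ring.
by move=> ->; ring.
Qed.

Lemma haar_lin (c : C) F F' Q e : gval Q -> lip F -> lip F' ->
  I (fun M => F (upd Q e M) + c * F' (upd Q e M)) =
  I (fun M => F (upd Q e M)) + c * I (fun M => F' (upd Q e M)).
Proof. by move=> gQ l l'; have [lin _ _ _] := hI; apply: lin; apply: lip_upd. Qed.

(** Positivity applied to K + F and K - F. The integral is real as the difference of the nonnegative
    number K + I F and K. *)
Lemma haar_real F K Q e : gval Q -> lip F ->
  (forall M, inG k M -> F (upd Q e M) \is Num.real) ->
  (forall M, inG k M -> `|F (upd Q e M)| <= K) -> `|I (fun M => F (upd Q e M))| <= K.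
Proof.
move=> gQ l re b; have [_ pos _ _] := hI.
have K0 : 0 <= K by apply: le_trans (b _ (inG1 _ _ _)).
have half (c : C) : c \is Num.real -> `|c| = 1 -> 
    0 <= K + c * I (fun M => F (upd Q e M)).
  move=> cr c1; rewrite -[X in X + _](haar_cst K) -(haar_lin _ _ gQ (lip_cst K) l).
  apply: pos; first exact: lip_upd gQ (lip_lin c (lip_cst K) l).
  move=> M gM; rewrite -lerBlDl sub0r.
  have : `|c * F (upd Q e M)| <= K by rewrite normrM c1 mul1r b.
  by rewrite real_ler_norml ?rpredM ?re // => /andP[].
have h1 := half 1 (rpred1 _) (normr1 _).
have h2 := half (-1) (rpredN1 _) (normrN1 _).
have re' : I (fun M => F (upd Q e M)) \is Num.real.
  have := ger0_real h1; rewrite mul1r => h.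
  by rewrite -[I _](addKr K) rpredD // rpredN ger0_real.
rewrite real_ler_norml //; apply/andP; split.
  by rewrite -subr_ge0 opprK addrC -[I _]mul1r.
by rewrite -subr_ge0 -mulN1r.
Qed.

(** Real and imaginary parts are integrated separately, each with bound K. The resulting factor 2 is
    harmless because finitely many edges are integrated. *)
Lemma haar_bound F K Q e : gval Q -> lip F ->
  (forall M, inG k M -> `|F (upd Q e M)| <= K) ->
  `|I (fun M => F (upd Q e M))| <= 2 * K.
Proof.
move=> gQ l b.
pose u (Q : config) := 2^-1 * F Q + 2^-1 * (F Q)^*.
pose v (Q : config) := - (2^-1 * 'i) * F Q + (2^-1 * 'i) * (F Q)^*.
have l2 c := lipM (lip_cst c) l; have l3 c := lipM (lip_cst c) (lip_conj l).
have lu : lip u by apply: lipD.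
have lv : lip v by apply: lipD.
have i2 : 'i * 'i = -1 :> C by rewrite -expr2 sqrCi.
have h2 : 2^-1 + 2^-1 = 1 :> C.
  by rewrite -[RHS](@mulVf C 2) ?pnatr_eq0 // mulr_natr mulr2n.
have FE Q' : F Q' = u Q' + 'i * v Q'.
  rewrite /u /v.
  transitivity (F Q' * (2^-1 + 2^-1 * (- ('i * 'i))) +
    (F Q')^* * (2^-1 + 2^-1 * ('i * 'i))); last by ring.
  by rewrite i2 opprK mulr1 h2 mulrN1 subrr mulr0 mulr1 addr0.
have h2c : (2^-1 : C)^* = 2^-1 by rewrite fmorphV rmorph_nat.
have n2 : `|2^-1 : C| = 2^-1 by rewrite ger0_norm ?invr_ge0 ?ler0n.
have n2i : `|2^-1 * 'i : C| = 2^-1 by rewrite normrM normCi n2 mulr1.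
have bd (a c : C) Q' : `|a| = 2^-1 -> `|c| = 2^-1 -> `|F Q'| <= K ->
   `|a * F Q' + c * (F Q')^*| <= K.
  move=> a2 c2 FK; apply: le_trans (ler_normD _ _) _.
  by rewrite !normrM norm_conjC a2 c2 -mulrDl h2 mul1r.
have -> : (fun M => F (upd Q e M)) = fun M => u (upd Q e M) + 'i * v (upd Q e M).
  by apply/funext => M.
rewrite haar_lin //; apply: le_trans (ler_normD _ _) _.
rewrite normrM normCi mul1r mulr_natl mulr2n lerD //.
  apply: haar_real => // M gM; last by rewrite bd ?b.
  by apply/CrealP; rewrite /u rmorphD !rmorphM /= conjCK h2c addrC.
apply: haar_real => // M gM; last by rewrite bd ?b // normrN.
apply/CrealP; rewrite /v rmorphD !rmorphM rmorphN !rmorphM /= conjCK h2c conjCi.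
by rewrite addrC !mulrN !mulNr opprK.
Qed.

Lemma intgE e es F Q : intg I (e :: es) F Q = I (fun M => intg I es F (upd Q e M)).
Proof. by []. Qed.

Lemma upd_same Q e M : upd Q e M e = M.
Proof. by rewrite /upd eqxx. Qed.

(** Turns a one-edge slice into a function of a whole configuration, so that slices over different
    base configurations can be subtracted inside one Haar integral. *)
Lemma lip_slice Q e F : gval Q -> lip F -> lip (fun P => F (upd Q e (P e))).
Proof.
move=> gQ [K [b l]]; exists K; split=> [P gP|P P' del gP gP' d0 cl].
  by rewrite b //; apply: gval_upd.
apply: l => //; try exact: gval_upd.
by move=> e' i j; rewrite /upd; case: eqP => _; rewrite ?cl ?subrr ?normr0.
Qed.

Lemma haarB_bound F K Q Q' e : gval Q -> gval Q' -> lip F ->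
  (forall M, inG k M -> `|F (upd Q' e M) - F (upd Q e M)| <= K) ->
  `|I (fun M => F (upd Q' e M)) - I (fun M => F (upd Q e M))| <= 2 * K.
Proof.
move=> gQ gQ' l b; have lQ := lip_slice e gQ l; have lQ' := lip_slice e gQ' l.
have := haar_bound (e := e) (K := K) gval_Q0 (lip_lin (-1) lQ' lQ).
rewrite (haar_lin (-1) e gval_Q0 lQ' lQ) mulN1r.
have E P : (fun M => F (upd P e (upd (Q0 R N (d := d)) e M e))) = fun M => F (upd P e M).
  by apply/funext => M; rewrite upd_same.
by rewrite !E; apply=> M gM; rewrite upd_same mulN1r b.
Qed.

(** [I] acts on functions of all matrices; linearity and positivity make it blind to values off the
    group, as the bound with constant 0 for the difference shows. *)
Lemma haar_eq F F' Q e : gval Q -> lip F -> lip F' ->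
  (forall M, inG k M -> F (upd Q e M) = F' (upd Q e M)) ->
  I (fun M => F (upd Q e M)) = I (fun M => F' (upd Q e M)).
Proof.
move=> gQ l l' h; have lB := lip_lin (-1) l l'.
have := haar_bound (e := e) (K := 0) gQ lB; rewrite haar_lin // mulr0.
rewrite normr_le0 mulN1r subr_eq0 => h'; apply/eqP; apply: h' => M gM.
by rewrite h // mulN1r subrr normr0.
Qed.

(** The constant doubles with each integrated edge; the Lipschitz estimate compares two slices
    through [haarB_bound]. *)
Lemma intg_lip es F : lip F -> lip (intg I es F).
Proof.
elim: es => [//|e es ih] l; have lI := ih l; have [K [b lp]] := lI.
exists (2 * K); split=> [Q gQ|Q Q' del gQ gQ' d0 cl].
  by rewrite intgE; apply: haar_bound => // M gM; rewrite b //; apply: gval_upd.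
rewrite !intgE -mulrA; apply: haarB_bound => // M gM.
apply: lp => //; try exact: gval_upd.
by move=> e' i j; rewrite /upd; case: eqP => _; rewrite ?cl ?subrr ?normr0.
Qed.

Lemma intg_eq es F F' Q : gval Q -> lip F -> (forall P, gval P -> F P = F' P) ->
  intg I es F Q = intg I es F' Q.
Proof.
move=> gQ l h; have l' := lip_ext h l.
elim: es Q gQ => [|e es ih] Q gQ; first exact: h.
rewrite !intgE; apply: haar_eq => //; try exact: intg_lip.
by move=> M gM; apply: ih; apply: gval_upd.
Qed.

Lemma intg_lin es c F F' Q : gval Q -> lip F -> lip F' ->
  intg I es (fun P => F P + c * F' P) Q = intg I es F Q + c * intg I es F' Q.
Proof.
move=> gQ l l'; elim: es Q gQ => [//|e es ih] Q gQ; rewrite !intgE.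
rewrite -(haar_lin _ _ gQ (intg_lip es l) (intg_lip es l')).
apply: (@haar_eq _ (fun P => intg I es F P + c * intg I es F' P)) => //.
  exact/intg_lip/lip_lin.
  by apply: lip_lin; apply: intg_lip.
by move=> M gM; apply: ih; apply: gval_upd.
Qed.

Lemma intg_bound es F K Q : gval Q -> lip F -> (forall P, gval P -> `|F P| <= K) ->
  `|intg I es F Q| <= 2 ^+ size es * K.
Proof.
move=> gQ l b; elim: es Q gQ => [|e es ih] Q gQ; first by rewrite mul1r b.
rewrite intgE exprS -mulrA; apply: haar_bound => //; first exact: intg_lip.
by move=> M gM; apply: ih; apply: gval_upd.
Qed.

Definition lmulq (f : edge) (g : mat) Q := upd Q f (g *m Q f).

Lemma gval_lmulq f g Q : inG k g -> gval Q -> gval (lmulq f g Q).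
Proof. by move=> gg gQ; apply: gval_upd => //; apply: inG_mul. Qed.

Lemma lip_lmulq f g F : inG k g -> lip F -> lip (fun Q => F (lmulq f g Q)).
Proof.
move=> gg [K [b l]].
have n0 : 1 <= 1 + N%:R :> C by rewrite lerDl ler0n.
have K0 : 0 <= K by apply: (@lip_with_ge0 K F); split.
(* An entry of g times a difference of matrices is a sum of N terms, each at most del by
   [inG_entry]; the extra 1 serves the sup bound and the other edges. *)
exists (K * (1 + N%:R)); split=> [Q gQ|Q Q' del gQ gQ' d0 cl].
  by apply: le_trans (b _ (gval_lmulq f gg gQ)) _; rewrite ler_peMr.
rewrite -mulrA; apply: l; try exact: gval_lmulq; first by rewrite mulr_ge0 ?addr_ge0.
move=> e i j; rewrite /lmulq /upd; case: eqP => _; last first.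
  by apply: le_trans (cl _ _ _) _; rewrite ler_peMl.
rewrite !mxE -sumrB; apply: le_trans (ler_norm_sum _ _ _) _.
apply: le_trans (_ : \sum_(i < N) del <= _).
  apply: ler_sum => h _; rewrite -mulrBr normrM -[X in _ <= X]mul1r.
  by rewrite ler_pM // (inG_entry _ _ gg).
by rewrite sumr_const card_ord -[del *+ N]mulr_natl mulrDl lerDr mul1r.
Qed.

(** If f occurs repeatedly in es, the innermost integration overwrites the outer ones, so the
    induction descends to the last occurrence. There the translation commutes with the integrations
    over the later, different edges, and left invariance of [I] applies. *)
Lemma intg_lmulq es f g F Q : inG k g -> lip F -> gval Q -> f \in es ->
  intg I es (fun P => F (lmulq f g P)) Q = intg I es F Q.
Proof.
move=> gg l; have l' := lip_lmulq f gg l; elim: es Q => [//|e es ih] Q gQ.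
have [fes _|fNes] := boolP (f \in es).
  rewrite !intgE; apply: haar_eq => //; try exact: intg_lip.
  by move=> M gM; apply: ih => //; apply: gval_upd.
rewrite inE (negPf fNes) orbF => /eqP ?; subst f.
have comm es' P : e \notin es' -> gval P ->
    intg I es' (fun P => F (lmulq e g P)) P = intg I es' F (lmulq e g P).
  elim: es' P => [//|e' es' ih'] P; rewrite inE negb_or => /andP[ee' ees'] gP.
  rewrite !intgE.
  have E M : upd (lmulq e g P) e' M = lmulq e g (upd P e' M).
    apply/funext => x; rewrite /lmulq /upd (negPf ee').
    by case: eqP => [->|//]; rewrite eq_sym (negPf ee').
  transitivity (I (fun M => intg I es' F (lmulq e g (upd P e' M)))).
    apply: (@haar_eq _ (fun P => intg I es' F (lmulq e g P))) => //.
    - exact: intg_lip.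
    - exact/lip_lmulq/intg_lip.
    - by move=> M gM; rewrite ih' //; apply: gval_upd.
  by congr I; apply/funext => M; rewrite E.
have [_ _ _ inv] := hI.
rewrite !intgE -[RHS](inv _ g (lip_upd _ gQ (intg_lip es l)) gg).
transitivity (I (fun M => intg I es F (lmulq e g (upd Q e M)))).
  apply: (@haar_eq _ (fun P => intg I es F (lmulq e g P))) => //.
  - exact: intg_lip.
  - exact/lip_lmulq/intg_lip.
  - by move=> M gM; rewrite comm //; apply: gval_upd.
congr I; apply/funext => M; congr (intg I es F _); apply/funext => x.
by rewrite /lmulq /upd; case: eqP => // _; rewrite eqxx.
Qed.

End Lipschitz.

(** * First-order expansions *)

Section Expansion.
Variables (R : realType) (T : Type) (D : T -> Prop).
Local Notation C := R[i].
Implicit Types (h : C -> T -> C) (A B : T -> C).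

(* h t x = A x + t B x + O(t^2) for 0 < t <= 1, uniformly over x in D *)
Definition uexp h A B := exists2 K : C, 0 <= K & forall x, D x ->
  [/\ `|A x| <= K, `|B x| <= K &
      forall t, 0 < t -> t <= 1 -> `|h t x - A x - t * B x| <= K * t ^+ 2].

Lemma uexp_ext h h' A A' B B' :
  (forall t x, D x -> 0 < t -> t <= 1 -> h t x = h' t x) ->
  (forall x, D x -> A x = A' x) -> (forall x, D x -> B x = B' x) ->
  uexp h A B -> uexp h' A' B'.
Proof.
move=> eh eA eB [K K0 H]; exists K => // x Dx; have [a b c] := H x Dx.
by split=> [||t t0 t1]; rewrite -?eA -?eB -?eh // c.
Qed.

Lemma uexp_const A K : (forall x, D x -> `|A x| <= K) -> uexp (fun=> A) A (fun=> 0).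
Proof.
move=> b; exists `|K| => // x Dx; split=> [||t t0 t1].
- by apply: le_trans (b x Dx) _; rewrite real_ler_norm // ger0_real // (le_trans _ (b x Dx)).
- by rewrite normr0.
- by rewrite mulr0 subr0 subrr normr0 mulr_ge0 // exprn_ge0 // ltW.
Qed.

Lemma uexp_lin (c : C) h h' A A' B B' : uexp h A B -> uexp h' A' B' ->
  uexp (fun t x => h t x + c * h' t x) (fun x => A x + c * A' x) (fun x => B x + c * B' x).
Proof.
move=> [K K0 H] [K' K'0 H']; exists (K + `|c| * K'); first by rewrite addr_ge0 ?mulr_ge0.
move=> x Dx; have [a b r] := H x Dx; have [a' b' r'] := H' x Dx.
have tri (u v L L' : C) : `|u| <= L -> `|v| <= L' -> `|u + c * v| <= L + `|c| * L'.
  move=> hu hv; apply: le_trans (ler_normD _ _) _.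
  by rewrite normrM lerD // ler_wpM2l.
split=> [||t t0 t1]; [exact: tri|exact: tri|].
have -> : h t x + c * h' t x - (A x + c * A' x) - t * (B x + c * B' x) =
  (h t x - A x - t * B x) + c * (h' t x - A' x - t * B' x) by ring.
by rewrite mulrDl -mulrA tri ?r ?r'.
Qed.

Lemma uexpD h h' A A' B B' : uexp h A B -> uexp h' A' B' ->
  uexp (fun t x => h t x + h' t x) (fun x => A x + A' x) (fun x => B x + B' x).
Proof.
move=> u u'; apply: uexp_ext (uexp_lin 1 u u') => *; by rewrite mul1r.
Qed.

Lemma uexpM h h' A A' B B' : uexp h A B -> uexp h' A' B' ->
  uexp (fun t x => h t x * h' t x) (fun x => A x * A' x)
       (fun x => B x * A' x + A x * B' x).
Proof.
(* 6 = 3 + 1 + 1 + 1: the remainder of the first factor meets [h'], which is at most 3 K' for t <=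
   1, and three further terms are at most K K' t^2 each. *)
move=> [K K0 H] [K' K'0 H']; exists (6 * (K * K')); first by rewrite !mulr_ge0.
move=> x Dx; have [a b r] := H x Dx; have [a' b' r'] := H' x Dx.
have KK : 0 <= K * K' by rewrite mulr_ge0.
have p (u v : C) : `|u| <= K -> `|v| <= K' -> `|u * v| <= K * K'.
  by move=> hu hv; rewrite normrM ler_pM.
split=> [||t t0 t1].
- by apply: le_trans (p _ _ a a') _; rewrite ler_peMl // (ler_nat _ 1).
- apply: le_trans (ler_normD _ _) _.
  apply: le_trans (lerD (p _ _ b a') (p _ _ a b')) _.
  have -> : K * K' + K * K' = 2 * (K * K') by ring.
  by rewrite ler_wpM2r // ler_nat.
have [t0' t2] : 0 <= t /\ 0 <= t ^+ 2 by split; [|apply: exprn_ge0]; exact: ltW.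
have t21 : t ^+ 2 <= 1 by rewrite exprn_ile1.
have nt : `|t| = t by rewrite ger0_norm.
have hh' : `|h' t x| <= 3 * K'.
  have -> : h' t x = A' x + t * B' x + (h' t x - A' x - t * B' x) by ring.
  apply: le_trans (ler_normD _ _) _; apply: le_trans (lerD (ler_normD _ _) (r' t t0 t1)) _.
  have -> : 3 * K' = K' + K' + K' by ring.
  rewrite !lerD //; first by rewrite normrM nt -[X in _ <= X]mul1r ler_pM.
  by rewrite ler_piMr.
have -> : h t x * h' t x - A x * A' x - t * (B x * A' x + A x * B' x) =
  (h t x - A x - t * B x) * h' t x + (A x * (h' t x - A' x - t * B' x)
   + (t * (B x * (h' t x - A' x - t * B' x)) + t ^+ 2 * (B x * B' x))) by ring.
have -> : 6 * (K * K') * t ^+ 2 = (K * t ^+ 2) * (3 * K') + (K * (K' * t ^+ 2)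
   + (K * (K' * t ^+ 2) + t ^+ 2 * (K * K'))) by ring.
apply: le_trans (ler_normD _ _) _; apply: lerD; last first.
  apply: le_trans (ler_normD _ _) _; apply: lerD; last first.
    apply: le_trans (ler_normD _ _) _; apply: lerD.
    - rewrite !normrM nt -[X in _ <= X]mul1r ler_pM ?mulr_ge0 //.
      by rewrite ler_pM // r'.
    - by rewrite normrM (ger0_norm t2) ler_wpM2l // p.
  by rewrite normrM ler_pM // r'.
by rewrite normrM ler_pM // r.
Qed.

Lemma uexp_sum (I : Type) (r : seq I) (P : pred I) (h : I -> C -> T -> C)
    (A B : I -> T -> C) :
  (forall a, uexp (h a) (A a) (B a)) ->
  uexp (fun t x => \sum_(a <- r | P a) h a t x) (fun x => \sum_(a <- r | P a) A a x)
       (fun x => \sum_(a <- r | P a) B a x).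
Proof.
move=> u; elim: r => [|a r ih].
  apply: uexp_ext (uexp_const (A := fun=> 0) (K := 0) _) => *; rewrite ?big_nil //.
  by rewrite normr0.
case Pa: (P a); last by apply: uexp_ext ih => *; rewrite big_cons Pa.
by apply: uexp_ext (uexpD (u a) ih) => *; rewrite big_cons Pa.
Qed.

Definition uexpm m n (h : C -> T -> 'M[C]_(m, n))
    (A B : T -> 'M[C]_(m, n)) :=
  forall i j, uexp (fun t x => h t x i j) (fun x => A x i j) (fun x => B x i j).

Lemma uexpm_ext m n (h h' : C -> T -> 'M[C]_(m, n))
    (A A' B B' : T -> 'M[C]_(m, n)) :
  (forall t x, D x -> 0 < t -> t <= 1 -> h t x = h' t x) ->
  (forall x, D x -> A x = A' x) -> (forall x, D x -> B x = B' x) ->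
  uexpm h A B -> uexpm h' A' B'.
Proof.
move=> eh eA eB u i j.
by apply: uexp_ext (u i j) => *; rewrite ?eh ?eA ?eB.
Qed.

Lemma uexpmM m n p (h : C -> T -> 'M[C]_(m, n)) (h' : C -> T -> 'M[C]_(n, p))
    (A B : T -> 'M[C]_(m, n)) (A' B' : T -> 'M[C]_(n, p)) :
  uexpm h A B -> uexpm h' A' B' ->
  uexpm (fun t x => h t x *m h' t x) (fun x => A x *m A' x)
        (fun x => B x *m A' x + A x *m B' x).
Proof.
move=> u u' i j.
apply: uexp_ext (uexp_sum (index_enum _) xpredT (fun l => uexpM (u i l) (u' l j))).
- by move=> *; rewrite mxE.
- by move=> *; rewrite mxE.
- by move=> *; rewrite !mxE -big_split.
Qed.

Lemma uexp_conj h A B : uexp h A B ->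
  uexp (fun t x => (h t x)^*) (fun x => (A x)^*) (fun x => (B x)^*).
Proof.
move=> [K K0 H]; exists K => // x Dx; have [a b r] := H x Dx.
split=> [||t t0 t1]; rewrite ?norm_conjC //.
have /CrealP tr := gtr0_real t0.
have <- : (h t x - A x - t * B x)^* = (h t x)^* - (A x)^* - t * (B x)^*.
  by rewrite !rmorphB rmorphM /= tr.
by rewrite norm_conjC r.
Qed.

End Expansion.

(** * Quadratic estimates for the exponential *)

Section RealExp.
Variable R : realType.
Implicit Types x y K : R.

(** Convexity: the exponential lies above its tangent at y. Used at both end points, this inequality
    yields the two estimates that follow. *)
Lemma expR_diff_le x y : expR y - expR x <= (y - x) * expR y.
Proof.
have := expR_ge1Dx (x - y); rewrite expRD expRN => h.
have y0 := expR_gt0 y.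
have : expR y * (1 + (x - y)) <= expR x.
  apply: le_trans (_ : expR y * (expR x / expR y) <= _); first by rewrite ler_pM2l.
  by rewrite mulrCA divff ?mulr1 // gt_eqF.
by nra.
Qed.

Lemma expR_lipschitz K x y : `|x| <= K -> `|y| <= K ->
  `|expR y - expR x| <= `|y - x| * expR K.
Proof.
move=> xK yK.
have half u v : `|v| <= K -> expR v - expR u <= `|v - u| * expR K.
  move=> vK; apply: le_trans (expR_diff_le _ _) _.
  apply: le_trans (_ : `|v - u| * expR v <= _).
    by rewrite ler_wpM2r ?ler_norm // expR_ge0.
  by rewrite ler_wpM2l // ler_expR (le_trans (ler_norm _)).
by rewrite ler_norml half // andbT lerNl opprB -[`|y - x|]distrC half.
Qed.

(** The tangent at x makes the remainder nonnegative; the tangent at y bounds it by (y - x)(e^y -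
    e^x), which is quadratic by the Lipschitz estimate. *)
Lemma expR_second K x y : `|x| <= K -> `|y| <= K ->
  `|expR y - expR x - (y - x) * expR x| <= `|y - x| ^+ 2 * expR K.
Proof.
move=> xK yK; have h1 := expR_diff_le x y; have h2 := expR_diff_le y x.
rewrite ger0_norm; last by nra.
apply: le_trans (_ : `|y - x| * `|expR y - expR x| <= _).
  by rewrite -normrM; apply: le_trans _ (ler_norm _); nra.
by rewrite expr2 -mulrA ler_wpM2l // expR_lipschitz.
Qed.

Local Notation C := R[i].
(** The action is handled as a complex-valued function; at its values, which are real, this is the
    exponential. *)
Definition expRe (z : C) : C := ((expR (complex.Re z))%:C)%C.

Lemma normc_realc x : `|(x%:C)%C : C| = (`|x|%:C)%C.
Proof. by rewrite normc_def /= expr0n addr0 sqrtr_sqr. Qed.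

Lemma expRe_lipschitz (K z w : C) : z \is Num.real -> w \is Num.real ->
  `|z| <= K -> `|w| <= K -> `|expRe w - expRe z| <= `|w - z| * expRe K.
Proof.
move=> /complex_realP[x ->] /complex_realP[y ->] xK.
have /complex_realP[L LE] : K \is Num.real by rewrite ger0_real // (le_trans _ xK).
move: xK; rewrite LE /expRe /= -!rmorphB !normc_realc !lecR -rmorphM lecR.
exact: expR_lipschitz.
Qed.

Lemma expRe_second (K z w : C) : z \is Num.real -> w \is Num.real ->
  `|z| <= K -> `|w| <= K ->
  `|expRe w - expRe z - (w - z) * expRe z| <= `|w - z| ^+ 2 * expRe K.
Proof.
move=> /complex_realP[x ->] /complex_realP[y ->] xK.
have /complex_realP[L LE] : K \is Num.real by rewrite ger0_real // (le_trans _ xK).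
move: xK; rewrite LE /expRe /= -!rmorphB -rmorphM -rmorphB !normc_realc !lecR.
rewrite -rmorphXn -rmorphM lecR.
exact: expR_second.
Qed.

Lemma expRe_ge0 z : 0 <= expRe z.
Proof. by rewrite (lecR 0) expR_ge0. Qed.

Lemma expRe_le (K z : C) : z \is Num.real -> `|z| <= K -> expRe z <= expRe K.
Proof.
move=> /complex_realP[x ->] xK.
have /complex_realP[L LE] : K \is Num.real by rewrite ger0_real // (le_trans _ xK).
by move: xK; rewrite LE /expRe normc_realc !lecR /= ler_expR; apply: le_trans (ler_norm _).
Qed.

End RealExp.

(** * Derivatives along left translations of one edge *)

Section EdgeMatrices.
Variables (R : realType) (N d : nat) (k : gkind).
Local Notation C := R[i].
Local Notation mat := 'M[C]_N.
Local Notation edge := (edge d).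
Local Notation config := (edge -> mat).
Implicit Types (Q : config) (F : config -> C) (f e : edge) (X Y : mat).

Lemma einvK : involutive (@einv d).
Proof. by case. Qed.

Lemma lexlt_asym (u v : vtx d) : lexlt u v -> ~~ lexlt v u.
Proof.
move=> /existsP[i /andP[/forallP eqi lti]]; apply/negP => /existsP[j /andP[/forallP eqj ltj]].
case: (ltngtP i j) => [ij|ji|/val_inj ij].
- by have := eqj i; rewrite ij /= => /eqP h; rewrite h ltxx in lti.
- by have := eqi j; rewrite ji /= => /eqP h; rewrite h ltxx in ltj.
- by subst j; have := lt_trans lti ltj; rewrite ltxx.
Qed.

Lemma positive_einv e : positive e -> ~~ positive (einv e).
Proof. exact: lexlt_asym. Qed.

Lemma lexlt_total (u v : vtx d) : u != v -> lexlt u v || lexlt v u.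
Proof.
move=> uv; have [i0 hi0] : exists i, u i != v i.
  apply/existsP; rewrite -negb_forall; apply: contra uv => /forallP h.
  by apply/eqP/ffunP => i; apply/eqP.
(* The least coordinate at which u and v differ decides. *)
case: (@arg_minnP _ i0 (fun i => u i != v i) (fun i => nat_of_ord i) hi0) => i hi mini.
have eqi (j : 'I_d) : (j < i)%N ==> (u j == v j).
  by apply/implyP => ji; apply: contraLR ji => /mini; rewrite -leqNgt.
case/orP: (le_total (u i) (v i)) => ui.
  apply/orP; left; apply/existsP; exists i; rewrite lt_neqAle hi ui !andbT.
  by apply/forallP.
apply/orP; right; apply/existsP; exists i; rewrite lt_neqAle eq_sym hi ui !andbT.
by apply/forallP => j; rewrite eq_sym.
Qed.

Lemma Qe_inG Q e : gval k Q -> adjmx (Qe Q e) *m Qe Q e = 1%:M.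
Proof.
move=> gQ; rewrite /Qe; case: ifP => _; first exact: inG_adjK (gQ e).
rewrite (inG_invmx (gQ _)) adjmxK; apply: mulmx1C; exact: inG_adjK (gQ _).
Qed.

Lemma Qe_adjK Q e : gval k Q -> Qe Q e *m adjmx (Qe Q e) = 1%:M.
Proof. by move=> gQ; apply: mulmx1C; apply: Qe_inG. Qed.

Lemma Qe_einv Q e : gval k Q -> e.1 != e.2 -> Qe Q (einv e) = adjmx (Qe Q e).
Proof.
move=> gQ ne; rewrite /Qe einvK; case: ifPn => pe'.
  have := positive_einv pe'; rewrite einvK => /negPf ->.
  by rewrite (inG_invmx (gQ _)) adjmxK.
have -> : positive e by have := lexlt_total ne; rewrite -[lexlt e.2 e.1]/(positive (einv e)) (negPf pe') orbF.
by rewrite (inG_invmx (gQ _)).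
Qed.

(** Derivative at t = 0 of [Qe] when [Q f] becomes g_t Q f with velocity X. The reversed edge
    carries the inverse, hence the minus sign and X on the right. *)
Definition dQe f X Q e : mat :=
  if e == f then X *m Qe Q e else if e == einv f then - (Qe Q e *m X) else 0.
(** Derivative in direction X of [dQe f Y]: X ends up next to the edge matrix and Y outside, and the
    two minus signs of the reversed edge cancel. *)
Definition d2Qe f Y X Q e : mat :=
  if e == f then Y *m (X *m Qe Q e)
  else if e == einv f then Qe Q e *m X *m Y else 0.

(** The expansion around the identity replaces the conditions g(0) = 1 and g'(0) = X. It does not
    depend on the configuration, hence the quantification over [T] and [D]. *)
Definition curve (g : C -> mat) X := [/\ forall t, 0 < t -> t <= 1 -> inG k (g t),
  adjmx X = - X & forall T D, @uexpm R T D N N (fun t _ => g t) (fun=> 1%:M) (fun=> X)].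

Variables (f : edge) (g : C -> mat) (X : mat).
Hypothesis pf : positive f.
Hypothesis gX : curve g X.

(** Derivative along the translation of f, bundled with the regularity that allows both functions to
    be integrated. *)
Definition dif F F' := [/\ lip k F, lip k F' &
  uexp (gval k) (fun t Q => F (lmulq f (g t) Q)) F F'].
Definition difm m n (F F' : config -> 'M[C]_(m, n)) :=
  forall i j, dif (fun Q => F Q i j) (fun Q => F' Q i j).

Lemma dif_ext F1 F2 F1' F2' : (forall Q, gval k Q -> F1 Q = F2 Q) ->
  (forall Q, gval k Q -> F1' Q = F2' Q) -> dif F1 F1' -> dif F2 F2'.
Proof.
move=> e e' [l l' u]; have [gG _ _] := gX; split.
- exact: lip_ext l.
- exact: lip_ext l'.
- apply: uexp_ext u => // t Q gQ t0 t1; apply: e; apply: gval_lmulq => //; exact: gG.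
Qed.

Lemma dif_cst (c : C) : dif (fun=> c) (fun=> 0).
Proof. by split; [exact: lip_cst|exact: lip_cst|apply: (uexp_const (K := `|c|))]. Qed.

Lemma difD F G F' G' : dif F F' -> dif G G' ->
  dif (fun Q => F Q + G Q) (fun Q => F' Q + G' Q).
Proof.
by move=> [a b c] [a' b' c']; split; [exact: lipD|exact: lipD|exact: uexpD].
Qed.

Lemma difM F G F' G' : dif F F' -> dif G G' ->
  dif (fun Q => F Q * G Q) (fun Q => F' Q * G Q + F Q * G' Q).
Proof.
move=> [a b c] [a' b' c']; split; [exact: lipM| |exact: uexpM].
by apply: lipD; apply: lipM.
Qed.

Lemma dif_sum (T : Type) (r : seq T) (P : pred T) (F F' : T -> config -> C) :
  (forall a, dif (F a) (F' a)) ->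
  dif (fun Q => \sum_(a <- r | P a) F a Q) (fun Q => \sum_(a <- r | P a) F' a Q).
Proof.
by move=> h; split; [apply: lip_sum|apply: lip_sum|apply: uexp_sum] => a; have [] := h a.
Qed.

(** The Leibniz rule; with r duplicate-free, [b != a] removes exactly one factor. *)
Lemma dif_prod (T : eqType) (r : seq T) (P : pred T) (F F' : T -> config -> C) :
  uniq r -> (forall a, dif (F a) (F' a)) ->
  dif (fun Q => \prod_(a <- r | P a) F a Q)
      (fun Q => \sum_(a <- r | P a) F' a Q * \prod_(b <- r | P b && (b != a)) F b Q).
Proof.
move=> ur h; elim: r ur => [_|a r ih /= /andP[ar ur]].
  by apply: dif_ext (dif_cst 1) => Q _; rewrite big_nil.
have sub Q b : b \in r -> \prod_(c <- a :: r | P c && (c != b)) F c Q =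
    (if P a then F a Q else 1) * \prod_(c <- r | P c && (c != b)) F c Q.
  move=> br; rewrite big_cons; have -> : a != b by apply: contraNneq ar => ->.
  by rewrite andbT; case: ifP; rewrite ?mul1r.
have subs Q : \sum_(b <- r | P b) F' b Q * \prod_(c <- a :: r | P c && (c != b)) F c Q =
   (if P a then F a Q else 1) *
   \sum_(b <- r | P b) F' b Q * \prod_(c <- r | P c && (c != b)) F c Q.
  rewrite mulr_sumr big_seq_cond [RHS]big_seq_cond; apply: eq_bigr => b /andP[br _].
  by rewrite sub // mulrCA.
case Pa: (P a) in subs; last first.
  by apply: dif_ext (ih ur) => Q _; rewrite big_cons Pa // subs mul1r.
apply: dif_ext (difM (h a) (ih ur)) => Q _; rewrite big_cons Pa // subs.
congr (_ * _ + _); rewrite big_cons Pa eqxx /= big_seq_cond [RHS]big_seq_cond.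
apply: eq_bigl => b; case br: (b \in r) => //=; case: (P b) => //=.
by apply/esym; apply: contraTneq br => ->.
Qed.

Lemma difm_cst m n (A : 'M[C]_(m, n)) : difm (fun=> A) (fun=> 0).
Proof. by move=> i j; apply: dif_ext (dif_cst (A i j)) => Q _; rewrite ?mxE. Qed.

Lemma difmM m n p (F F' : config -> 'M[C]_(m, n)) (G G' : config -> 'M[C]_(n, p)) :
  difm F F' -> difm G G' ->
  difm (fun Q => F Q *m G Q) (fun Q => F' Q *m G Q + F Q *m G' Q).
Proof.
move=> a b i j.
apply: dif_ext (dif_sum (index_enum _) xpredT (fun l => difM (a i l) (b l j))) => Q _.
  by rewrite mxE.
by rewrite !mxE -big_split.
Qed.

Lemma difmN m n (F F' : config -> 'M[C]_(m, n)) : difm F F' ->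
  difm (fun Q => - F Q) (fun Q => - F' Q).
Proof.
move=> a i j; apply: dif_ext (difM (dif_cst (-1)) (a i j)) => Q _; rewrite !mxE; ring.
Qed.

Lemma dif_tr n (F F' : config -> 'M[C]_n) : difm F F' ->
  dif (fun Q => \tr (F Q)) (fun Q => \tr (F' Q)).
Proof. by move=> a; apply: dif_sum => i; apply: a. Qed.

Lemma lip_Qe e i j : lip k (fun Q => Qe Q e i j).
Proof.
rewrite /Qe; case: (positive e); first exact: lip_entry.
apply: lip_ext (lip_conj (@lip_entry R N d k (einv e) j i)) => Q gQ.
by rewrite (inG_invmx (gQ _)) !mxE.
Qed.

Lemma lip_mulmx m n p (F : config -> 'M[C]_(m, n)) (G : config -> 'M[C]_(n, p)) :
  (forall i j, lip k (fun Q => F Q i j)) -> (forall i j, lip k (fun Q => G Q i j)) ->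
  forall i j, lip k (fun Q => (F Q *m G Q) i j).
Proof.
move=> a b i j; apply: lip_ext (lip_sum (index_enum _) xpredT (fun l => lipM (a i l) (b l j))).
by move=> Q _; rewrite mxE.
Qed.

Lemma lip_dQe Y e i j : lip k (fun Q => dQe f Y Q e i j).
Proof.
rewrite /dQe; case: (e == f); last case: (e == einv f); last 1 first.
- by apply: lip_ext (lip_cst _ _ k 0) => Q _; rewrite mxE.
- apply: (lip_mulmx (F := fun=> Y) (G := fun Q => Qe Q e)) => a b; last exact: lip_Qe.
  exact: lip_cst.
- apply: lip_ext (lipM (lip_cst _ _ k (-1)) (lip_mulmx (lip_Qe e) (fun a b => lip_cst _ _ k (Y a b)) i j)).
  by move=> Q _; rewrite [in RHS]mxE mulN1r.
Qed.

Lemma difm_Qe e : difm (fun Q => Qe Q e) (fun Q => dQe f X Q e).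
Proof.
have [gG aX uX] := gX.
suff u : uexpm (gval k) (fun t Q => Qe (lmulq f (g t) Q) e) (fun Q => Qe Q e)
   (fun Q => dQe f X Q e).
  by move=> i j; split; [exact: lip_Qe|exact: lip_dQe|exact: u].
have cst e' : uexpm (gval k) (fun _ (Q : config) => Q e') (fun Q => Q e') (fun=> 0).
  move=> i j; apply: uexp_ext (uexp_const (D := gval k) (A := fun Q : config => Q e' i j) (K := 1) _) => //.
    by move=> Q _; rewrite mxE.
  by move=> Q gQ; exact: inG_entry (gQ e').
have fNinv : (einv f == f) = false.
  by apply/negP => /eqP h; have := positive_einv pf; rewrite h pf.
have key : uexpm (gval k) (fun t (Q : config) => lmulq f (g t) Q f) (fun Q => Q f)
    (fun Q => X *m Q f).
  apply: uexpm_ext (uexpmM (uX _ _) (cst f)) => *.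
  - by rewrite /lmulq /upd eqxx.
  - by rewrite mul1mx.
  - by rewrite mulmx0 addr0.
rewrite /Qe /dQe /Qe; case: (e =P f) => [->|ef].
  by rewrite pf; apply: key.
have [pe|pe] := boolP (positive e).
  have -> : (e == einv f) = false.
    by apply/negP => /eqP h; move: pe; rewrite h (negPf (positive_einv pf)).
  by apply: uexpm_ext (cst e) => // t Q *; rewrite /lmulq /upd; case: eqP.
case: (e =P einv f) => [->|ef'].
  (* On the group the inverse is the adjoint, so the expansion of the reversed edge is the conjugate
     of that of f, and no inverse has to be expanded. Its velocity is the adjoint of X Q, which
     equals minus the adjoint of Q times X. *)
  rewrite einvK => i j; apply: uexp_ext (uexp_conj (key j i)).
  - move=> t Q gQ t0 t1; rewrite (inG_invmx (k := k)) ?mxE //.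
    by apply: gval_lmulq => //; apply: gG.
  - by move=> Q gQ; rewrite (inG_invmx (gQ _)) !mxE.
  - move=> Q gQ; rewrite (inG_invmx (gQ _)) -mulmxN -aX -adjmxM.
    by rewrite /adjmx /Defs.conjmx [in RHS]mxE [in RHS]mxE.
move=> i j; apply: uexp_ext (uexp_conj (cst (einv e) j i)).
- move=> t Q gQ t0 t1; rewrite (inG_invmx (k := k)) ?mxE //; last first.
    by apply: gval_lmulq => //; apply: gG.
  by rewrite /lmulq /upd; case: eqP => // h; case: ef'; rewrite -h einvK.
- by move=> Q gQ; rewrite (inG_invmx (gQ _)) !mxE.
- by move=> Q gQ; rewrite !mxE conjC0.
Qed.

(** Y is an arbitrary matrix here; only X is tied to the group by a curve. *)
Lemma difm_dQe Y e : difm (fun Q => dQe f Y Q e) (fun Q => d2Qe f Y X Q e).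
Proof.
have D := difm_Qe e; rewrite /dQe /d2Qe /=.
have fNinv : (einv f == f) = false.
  by apply/negP => /eqP h; have := positive_einv pf; rewrite h pf.
case: (e =P f) => [ef|_].
  move=> i j; apply: dif_ext (difmM (difm_cst Y) D i j) => // Q _.
  by rewrite mul0mx add0r /dQe ef eqxx.
case: (e =P einv f) => [ef|_]; last exact: difm_cst.
move=> i j; apply: dif_ext (difmN (difmM D (difm_cst Y)) i j) => // Q _.
by rewrite mulmx0 addr0 /dQe ef fNinv eqxx mulNmx opprK.
Qed.

Lemma dif_expRe S S' : dif S S' -> (forall Q, gval k Q -> S Q \is Num.real) ->
  dif (fun Q => expRe (S Q)) (fun Q => S' Q * expRe (S Q)).
Proof.
move=> [[K [bS lS]] lS' [L L0 uS]] re; have [gG _ _] := gX.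
have K0 : 0 <= K by apply: le_trans (bS _ (@gval_Q0 _ _ _ _)).
have lE : lip k (fun Q => expRe (S Q)).
  exists ((1 + K) * expRe K); split=> [Q gQ|Q Q' del gQ gQ' d0 cl].
    rewrite ger0_norm ?expRe_ge0 //.
    apply: le_trans (expRe_le (re Q gQ) (bS Q gQ)) _.
    by rewrite ler_peMl ?expRe_ge0 // lerDl.
  apply: le_trans (expRe_lipschitz (re Q gQ) (re Q' gQ') (bS Q gQ) (bS Q' gQ')) _.
  rewrite mulrAC ler_wpM2r ?expRe_ge0 //; apply: le_trans (lS _ _ _ gQ gQ' d0 cl) _.
  by rewrite ler_wpM2r // lerDr.
split=> //; first exact: lipM.
have eK0 := expRe_ge0 K.
(* 1 serves the value and L the derivative. In the remainder, L comes from the expansion of S, and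
   (2 L)^2 from the quadratic error of the exponential, as S moves by at most 2 L t. *)
exists ((1 + L + (L + (2 * L) ^+ 2)) * expRe K).
  by rewrite mulr_ge0 // !addr_ge0 // exprn_ge0 ?mulr_ge0.
move=> Q gQ; have [a b r] := uS Q gQ.
have eS : `|expRe (S Q)| <= expRe K.
  by rewrite ger0_norm ?expRe_ge0 //; apply: expRe_le (re Q gQ) (bS Q gQ).
have L2 : 0 <= (2 * L) ^+ 2 by rewrite exprn_ge0 ?mulr_ge0.
split=> [||t t0 t1].
- by apply: le_trans eS _; rewrite ler_peMl // -addrA lerDl !addr_ge0.
- rewrite normrM ler_pM //; apply: le_trans b _.
  by rewrite -addrA addrCA lerDl !addr_ge0.
have gQ' : gval k (lmulq f (g t) Q) by apply: gval_lmulq => //; apply: gG.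
set S1 := S (lmulq f (g t) Q); have r1 := r t t0 t1.
have nt : `|t| = t by rewrite gtr0_norm.
have t0' := ltW t0.
have dS : `|S1 - S Q| <= 2 * L * t.
  have -> : S1 - S Q = t * S' Q + (S1 - S Q - t * S' Q) by ring.
  apply: le_trans (ler_normD _ _) _; rewrite -mulrA mulr_natl mulr2n.
  apply: lerD; first by rewrite normrM nt mulrC ler_wpM2r.
  apply: le_trans r1 _; rewrite expr2 mulrA ler_piMr // ?mulr_ge0 //.
have -> : expRe S1 - expRe (S Q) - t * (S' Q * expRe (S Q)) =
  (expRe S1 - expRe (S Q) - (S1 - S Q) * expRe (S Q)) +
  (S1 - S Q - t * S' Q) * expRe (S Q) by ring.
apply: le_trans (ler_normD _ _) _.
apply: le_trans (_ : (2 * L) ^+ 2 * t ^+ 2 * expRe K + L * t ^+ 2 * expRe K <= _).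
  apply: lerD; last by rewrite normrM ler_pM.
  apply: le_trans (expRe_second (re Q gQ) (re _ gQ') (bS Q gQ) (bS _ gQ')) _.
  by rewrite ler_wpM2r // -exprMn ler_pXn2r // nnegrE ?mulr_ge0.
rewrite -!mulrDl mulrAC ler_wpM2r ?exprn_ge0 // ler_wpM2r //.
by rewrite [_ + L]addrC lerDr addr_ge0.
Qed.

Variable I : (mat -> C) -> C.
Hypothesis hI : is_haar (inG k) I.

(** Translation invariance cancels the zeroth-order term of the expansion, so t times the integral
    of F' is O(t^2). Dividing by t bounds that integral by c t for every t in (0, 1]. *)
Lemma intg_dif es F F' Q : dif F F' -> f \in es -> gval k Q -> intg I es F' Q = 0.
Proof.
move=> [l l' [K K0 u]] fes gQ; have [gG _ _] := gX.
pose c := 2 ^+ size es * K; have c0 : 0 <= c by rewrite mulr_ge0 ?exprn_ge0.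
have bd t : 0 < t -> t <= 1 -> `|intg I es F' Q| <= c * t.
  move=> t0 t1; have gt := gG t t0 t1; have lt := lip_lmulq f gt l.
  have l2 := lip_lin (-1) lt l.
  have l3 := lip_lin (- t) l2 l'.
  have := intg_bound hI es gQ l3 (K := K * t ^+ 2).
  rewrite (intg_lin hI _ _ gQ l2 l') (intg_lin hI _ _ gQ lt l).
  rewrite (intg_lmulq hI gt l gQ fes) mulN1r subrr add0r mulNr normrN normrM gtr0_norm //.
  have -> : 2 ^+ size es * (K * t ^+ 2) = t * (c * t) by rewrite /c; ring.
  rewrite ler_pM2l //; apply=> P gP; have [_ _ r] := u P gP.
  by rewrite mulN1r mulNr r.
apply/eqP/negP => /negP h0; have a0 : 0 < `|intg I es F' Q| by rewrite normr_gt0.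
(* This t satisfies t <= 1, also when c = 0, and c t < a, against the bound. *)
set a := `|_| in bd a0; pose t := a / (2 * (c + a)).
have ca : 0 < c + a by rewrite ltr_wpDl.
have t0 : 0 < t by rewrite divr_gt0 // mulr_gt0.
have := bd t t0; rewrite ler_pdivrMr ?mulr_gt0 // mul1r => /(_ _).
have aca : a <= c + a by rewrite lerDr.
have h2 : a <= 2 * (c + a) by rewrite (le_trans aca) // ler_peMl ?ltW // ltr1n.
move=> /(_ h2); rewrite mulrA ler_pdivlMr ?mulr_gt0 // mulrC ler_pM2r //.
have cr : c \is Num.real by rewrite ger0_real.
have ar : 2 * (c + a) \is Num.real by rewrite ger0_real // ltW // mulr_gt0.
apply/negP; rewrite -real_ltNge //.
by rewrite mulr_natl mulr2n -addrA ltrDl addr_gt0.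
Qed.

End EdgeMatrices.

(** * Complexified tangent spaces *)

Section Tangents.
Variables (R : realType) (N : nat).
Local Notation C := R[i].
Local Notation mat := 'M[C]_N.
Implicit Types (X Y : mat) (k : gkind) (t : C).

Lemma curve_SU_U (g : C -> mat) X : curve SU g X -> curve U g X.
Proof. by move=> [gG aX uX]; split=> // t t0 t1; have /andP[] := gG t t0 t1. Qed.

Lemma uexp_id T D : @uexp R T D (fun t _ => t) (fun=> 0) (fun=> 1).
Proof.
exists 1 => // x _; rewrite normr0 normr1; split=> // t t0 t1.
by rewrite subr0 mulr1 subrr normr0 mul1r exprn_ge0 // ltW.
Qed.

Lemma uexp_cst T D (c : C) : @uexp R T D (fun _ _ => c) (fun=> c) (fun=> 0).
Proof. exact: (uexp_const (K := `|c|)). Qed.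

Lemma pos_1t2 t : 0 < t -> 0 < 1 + t ^+ 2.
Proof. by move=> t0; rewrite ltr_wpDr // exprn_ge0 // ltW. Qed.

(** There is no first-order term: this normalization of projections and phases leaves tangents
    unchanged. *)
Lemma uexp_inv1t2 T D : @uexp R T D (fun t _ => (1 + t ^+ 2)^-1) (fun=> 1) (fun=> 0).
Proof.
exists 1 => // x _; rewrite normr0 normr1; split=> // t t0 t1.
have p := pos_1t2 t0; have t2 : 0 <= t ^+ 2 by rewrite exprn_ge0 // ltW.
rewrite mulr0 subr0 mul1r.
have -> : (1 + t ^+ 2)^-1 - 1 = - (t ^+ 2 / (1 + t ^+ 2)) by field; rewrite gt_eqF.
have q0 : 0 <= t ^+ 2 / (1 + t ^+ 2) by rewrite divr_ge0 // ltW.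
by rewrite normrN ger0_norm // ler_pdivrMr // ler_peMr // lerDl.
Qed.

Lemma conj_pos t : 0 < t -> t^* = t.
Proof. by move=> /gtr0_real /CrealP. Qed.

(** * Rotations of a coordinate plane *)

Section Rotation.
Variables (i j : 'I_N) (w : C).
Hypotheses (ij : i != j) (w1 : w * w^* = 1).

Let E a b : mat := delta_mx a b.
Let S : mat := w^* *: E i j + w *: E j i.
(** Orthogonal projection onto the line of e_i + t w e_j. [refl] is the reflection in the orthogonal
    hyperplane and [refl0] its value at t = 0; all entries are rational in t. *)
Let prj t : mat := (1 + t ^+ 2)^-1 *: (E i i + (t *: S + (t * t) *: E j j)).
Let refl t : mat := 1%:M - 2 *: prj t.
Let refl0 : mat := 1%:M - 2 *: E i i.

Lemma delta_adj a b : adjmx (E a b) = E b a.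
Proof. by apply/matrixP => x y; rewrite !mxE andbC rmorph_nat. Qed.

Lemma adj_S : adjmx S = S.
Proof. by rewrite /S adjmxD !adjmxZ !delta_adj conjCK addrC. Qed.

Lemma prj_adj t : 0 < t -> adjmx (prj t) = prj t.
Proof.
move=> t0; rewrite /prj adjmxZ !adjmxD !adjmxZ adj_S !delta_adj rmorphM /= (conj_pos t0).
by rewrite conj_pos // invr_gt0 pos_1t2.
Qed.

Lemma delta_mulE a b c e : E a b *m E c e = if b == c then E a e else 0.
Proof. by rewrite mul_delta_mx_cond; case: eqP; rewrite ?mulr1n ?mulr0n. Qed.

Lemma prj_idem t : 0 < t -> prj t *m prj t = prj t.
Proof.
move=> t0; have p := pos_1t2 t0; have pn : 1 + t ^+ 2 != 0 by rewrite gt_eqF.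
rewrite /prj -scalemxAl -scalemxAr scalerA /S.
have ji : (j == i) = false by rewrite eq_sym (negPf ij).
set M := E i i + _; suff -> : M *m M = (1 + t ^+ 2) *: M.
  by rewrite scalerA; congr (_ *: _); field.
rewrite /M !(mulmxDl, mulmxDr, =^~scalemxAl, =^~scalemxAr, scalerDr, scalerA) !delta_mulE !eqxx (negPf ij) ji.
rewrite !scaler0 !addr0 !add0r; apply/matrixP => a b; rewrite !mxE.
move: (_ && _)%:R (_ && _)%:R (_ && _)%:R (_ && _)%:R => x1 x2 x3 x4.
have h1 : w^* * w = 1 by rewrite mulrC.
by ring: h1.
Qed.

Lemma refl_adj t : 0 < t -> adjmx (refl t) = refl t.
Proof.
by move=> t0; rewrite /refl -scaleNr adjmxD adjmxZ adjmx1 prj_adj // rmorphN rmorph_nat.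
Qed.

Lemma refl_invol t : 0 < t -> refl t *m refl t = 1%:M.
Proof.
move=> t0; rewrite /refl mulmxBl !mulmxBr !mul1mx mulmx1 -scalemxAl -scalemxAr prj_idem //.
by apply/matrixP => a b; rewrite !mxE; ring.
Qed.

Lemma refl0_adj : adjmx refl0 = refl0.
Proof. by rewrite /refl0 -scaleNr adjmxD adjmxZ adjmx1 delta_adj rmorphN rmorph_nat. Qed.

Lemma refl0_invol : refl0 *m refl0 = 1%:M.
Proof.
rewrite /refl0 mulmxBl !mulmxBr !mul1mx mulmx1 -scalemxAl -scalemxAr delta_mulE eqxx.
by apply/matrixP => a b; rewrite !mxE; ring.
Qed.

(** Squaring the product of the two reflections gives determinant 1 from involutivity alone, without
    the determinant of a reflection. It also doubles the velocity, so -4 appears where one product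
    would give -2. *)
Let rot t : mat := (refl t *m refl0) *m (refl t *m refl0).

Lemma rot_unitary t : 0 < t -> adjmx (rot t) *m rot t = 1%:M.
Proof.
move=> t0; have h : adjmx (refl t *m refl0) *m (refl t *m refl0) = 1%:M.
  rewrite adjmxM refl_adj // refl0_adj mulmxA -(mulmxA refl0) refl_invol //.
  by rewrite mulmx1 refl0_invol.
by rewrite /rot adjmxM mulmxA -(mulmxA (adjmx _)) h mulmx1 h.
Qed.

Lemma rot_det t : 0 < t -> \det (rot t) = 1.
Proof.
move=> t0; rewrite /rot !det_mulmx mulrACA -!det_mulmx refl_invol // refl0_invol.
by rewrite mulmx1 det1.
Qed.

Lemma rot_tangent T D : @uexpm R T D N N (fun t _ => rot t) (fun=> 1%:M)
  (fun=> (- 4) *: (w^* *: E i j - w *: E j i)).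
Proof.
have ur : @uexpm R T D N N (fun t _ => refl t) (fun=> refl0) (fun=> (- 2) *: S).
  move=> a b.
  have c x := @uexp_cst T D x; have id := @uexp_id T D.
  apply: uexp_ext (uexp_lin (-2) (c (1%:M a b)) (uexpM (@uexp_inv1t2 T D)
    (uexpD (c (E i i a b)) (uexpD (uexpM id (c (S a b)))
       (uexpM (uexpM id id) (c (E j j a b))))))) => *; rewrite !mxE; ring.
have u0 : @uexpm R T D N N (fun _ _ => refl0) (fun=> refl0) (fun=> 0).
  by move=> a b; apply: uexp_ext (@uexp_cst T D (refl0 a b)) => *; rewrite ?mxE.
have u1 := uexpmM ur u0.
apply: uexpm_ext (uexpmM u1 u1) => //.
  by move=> *; rewrite refl0_invol mulmx1.
move=> _ _; rewrite refl0_invol !(mulmx1, mul1mx, mulmx0, addr0).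
rewrite /refl0 mulmxBr mulmx1 /S -scalemxAr -scalemxAl mulmxDl -!scalemxAl !delta_mulE.
have ji : (j == i) = false by rewrite eq_sym (negPf ij).
by rewrite eqxx ji; apply/matrixP => a b; rewrite !mxE; ring.
Qed.

Lemma rot_curve_SU : curve SU rot ((- 4) *: (w^* *: E i j - w *: E j i)).
Proof.
split; last exact: rot_tangent.
  by move=> t t0 _; apply/andP; rewrite rot_unitary // rot_det.
rewrite adjmxZ -scaleNr adjmxD !adjmxZ !delta_adj rmorphN rmorph_nat conjCK rmorphN.
by apply/matrixP => a b; rewrite !mxE; ring.
Qed.

Lemma rot_curve_SO : w = 1 -> curve SO rot ((- 4) *: (w^* *: E i j - w *: E j i)).
Proof.
move=> we; have [gG aX uX] := rot_curve_SU; split=> // t t0 t1.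
have /andP[/eqP un /eqP de] := gG t t0 t1.
have cE a b : Defs.conjmx (E a b) = E a b.
  by apply/matrixP => x y; rewrite !mxE rmorph_nat.
have c1 : Defs.conjmx (1%:M : mat) = 1%:M by rewrite /Defs.conjmx map_mx1.
have cD (A B : mat) : Defs.conjmx (A + B) = Defs.conjmx A + Defs.conjmx B.
  by rewrite /Defs.conjmx map_mxD.
have cM (A B : mat) : Defs.conjmx (A *m B) = Defs.conjmx A *m Defs.conjmx B.
  by rewrite /Defs.conjmx map_mxM.
have cZ a (A : mat) : Defs.conjmx (a *: A) = a^* *: Defs.conjmx A.
  by apply/matrixP => x y; rewrite !mxE rmorphM.
have cS : Defs.conjmx S = S by rewrite /S cD !cZ !cE we !rmorph1.
have cp : Defs.conjmx (prj t) = prj t.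
  rewrite /prj cZ !cD !cZ !cE cS (conj_pos t0) rmorphM /= (conj_pos t0) conj_pos //.
  by rewrite invr_gt0 pos_1t2.
have crefl (A : mat) : Defs.conjmx A = A -> Defs.conjmx (1%:M - 2 *: A) = 1%:M - 2 *: A.
  by move=> h; rewrite /Defs.conjmx map_mxB -!/(Defs.conjmx _) cZ c1 h rmorph_nat.
have cr : Defs.conjmx (rot t) = rot t.
  by rewrite /rot !cM /refl /refl0 !crefl // cE.
by apply/and3P; rewrite cr de -(etrans (congr1 _ cr) (erefl (rot t)^T)) un !eqxx.
Qed.

End Rotation.

(** * Diagonal phases *)

Section Phases.
Variables (i j : 'I_N) (b : bool).
Hypothesis ij : i != j.

(** The Cayley transform (1 + i t) / (1 - i t), a rational parametrization of the unit circle with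
    velocity 2 i at t = 0. *)
Let z t : C := (1 + 'i * t) * (1 + 'i * t) * (1 + t ^+ 2)^-1.
(** With [b] the conjugate phase at j restores determinant 1, as SU(N) demands; without it the curve
    stays in U(N). *)
Let c t l : C := if l == i then z t else if (l == j) && b then (z t)^* else 1.
Let ph t : mat := diag_mx (\row_l c t l).

Lemma z_unit t : 0 < t -> z t * (z t)^* = 1.
Proof.
move=> t0; have p := pos_1t2 t0; have pn : 1 + t ^+ 2 != 0 by rewrite gt_eqF.
have ii : 'i * 'i = -1 :> C by rewrite -expr2 sqrCi.
rewrite /z !rmorphM /= rmorphD rmorphM rmorph1 /= conjCi (conj_pos t0) (conj_pos (t := _^-1)) ?invr_gt0 //.
have -> : (1 + 'i * t) * (1 + 'i * t) * (1 + t ^+ 2)^-1 *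
  ((1 + - 'i * t) * (1 + - 'i * t) * (1 + t ^+ 2)^-1) = 
  ((1 - 'i * 'i * t ^+ 2) / (1 + t ^+ 2)) ^+ 2 by ring.
by rewrite ii mulN1r opprK divff // expr1n.
Qed.

Lemma c_unit t l : 0 < t -> c t l * (c t l)^* = 1.
Proof.
move=> t0; rewrite /c; case: ifP => _; first exact: z_unit.
by case: ifP => _; rewrite ?conjCK ?rmorph1 ?mulr1 // mulrC z_unit.
Qed.

Lemma ph_unitary t : 0 < t -> adjmx (ph t) *m ph t = 1%:M.
Proof.
move=> t0; have -> : adjmx (ph t) = diag_mx (\row_l (c t l)^*).
  apply/matrixP => x y; rewrite !mxE eq_sym.
  by case: eqP => [->|_]; rewrite ?mulr1n ?mulr0n ?rmorph0.
rewrite mulmx_diag -diag_const_mx; congr diag_mx; apply/rowP => l; rewrite !mxE.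
by rewrite mulrC c_unit.
Qed.

Lemma ph_det t : b -> 0 < t -> \det (ph t) = 1.
Proof.
move=> bT t0; rewrite det_diag (bigD1 i) //= (bigD1 j) 1?eq_sym //= big1 => [|l /andP[li lj]].
  by rewrite !mxE /c eqxx (eq_sym j) (negPf ij) eqxx bT mulr1 z_unit.
by rewrite mxE /c (negPf li) (negPf lj).
Qed.

Lemma ph_tangent T D : @uexpm R T D N N (fun t _ => ph t) (fun=> 1%:M)
  (fun=> (2 * 'i) *: (delta_mx i i - (if b then delta_mx j j else 0))).
Proof.
have uz : @uexp R T D (fun t _ => z t) (fun=> 1) (fun=> 2 * 'i).
  have u := uexp_lin 'i (@uexp_cst T D 1) (@uexp_id T D).
  by apply: uexp_ext (uexpM (uexpM u u) (@uexp_inv1t2 T D)) => *; rewrite /z; ring.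
have ji : (j == i) = false by rewrite eq_sym (negPf ij).
move=> x y; rewrite /ph.
have [->|xy] := eqVneq x y; last first.
  have dl l : (x == l) && (y == l) = false.
    by apply/negP => /andP[/eqP xl /eqP yl]; rewrite xl yl eqxx in xy.
  apply: uexp_ext (@uexp_cst T D 0) => *; rewrite !mxE ?(negPf xy) ?mulr0n ?dl //.
  by case: (b); rewrite !mxE ?dl subr0 mulr0.
have [yi|yi] := eqVneq y i.
  subst y; apply: uexp_ext uz => *; rewrite !mxE ?eqxx ?mulr1n /c ?eqxx //.
  by case: (b); rewrite !mxE ?(negPf ij) subr0 mulr1.
have [yj|yj] := eqVneq y j; last first.
  apply: uexp_ext (@uexp_cst T D 1) => *; rewrite !mxE ?eqxx ?mulr1n /c ?(negPf yi) ?(negPf yj) //.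
  by case: (b); rewrite !mxE /= ?(negPf yj) subr0 mulr0.
subst y; case bT : (b); last first.
  apply: uexp_ext (@uexp_cst T D 1) => *; rewrite !mxE ?eqxx ?mulr1n /c ?ji ?bT ?andbF //.
  by rewrite /= subr0 mulr0.
apply: uexp_ext (uexp_conj uz) => *; rewrite !mxE ?eqxx ?mulr1n /c ?ji ?bT ?eqxx ?rmorph1 //=.
by rewrite rmorphM /= conjCi rmorph_nat sub0r mulrN1 mulrN.
Qed.

Lemma ph_curve : curve (if b then SU else U) ph
  ((2 * 'i) *: (delta_mx i i - (if b then delta_mx j j else 0))).
Proof.
split; last exact: ph_tangent.
  move=> t t0 _; case bT: (b) => /=; last by rewrite ph_unitary.
  by rewrite ph_unitary // ph_det // !eqxx.
rewrite adjmxZ -scaleNr rmorphM /= conjCi rmorph_nat mulrN; congr (_ *: _).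
case: (b); last by rewrite subr0 delta_adj.
by rewrite -scaleN1r adjmxD adjmxZ !delta_adj rmorphN1.
Qed.

End Phases.

(** A spanning family indexed by all pairs rather than a basis: for SO(N) each nonzero element
    occurs twice up to sign, for SU(N) the diagonal elements add up to 0. One double sum thus serves
    all groups. *)
Definition casbas k (i j : 'I_N) : mat :=
  match k with
  | SO => delta_mx i j - delta_mx j i
  | U => delta_mx i j
  | SU => delta_mx i j - ((i == j)%:R / N%:R) *: 1%:M
  end.

(* Left translations along curves only see the real Lie algebra; complex linearity
   of the integrated derivative extends the conclusion to its complexification. *)
Lemma casbas_ind k (P : mat -> Prop) : (1 < N)%N -> P 0 ->
  (forall a X Y, P X -> P Y -> P (a *: X + Y)) ->
  (forall g X, curve k g X -> P X) -> forall i j, P (casbas k i j).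
Proof.
move=> N1 P0 Plin Pc.
have PZ a X : P X -> P (a *: X) by move=> h; rewrite -[_ *: _]addr0; apply: Plin.
have PD X Y : P X -> P Y -> P (X + Y) by move=> h h'; rewrite -[X]scale1r; apply: Plin.
have PZi a X : a != 0 -> P (a *: X) -> P X.
  by move=> a0 /(PZ a^-1); rewrite scalerA mulVf // scale1r.
have n4 : -4 != 0 :> C by rewrite oppr_eq0 pnatr_eq0.
have i2 : 2 * 'i != 0 :> C by rewrite mulf_neq0 ?pnatr_eq0 ?neq0Ci.
have ii : 'i * 'i = -1 :> C by rewrite -expr2 sqrCi.
have anti i j : k = SO \/ k = SU \/ k = U -> i != j -> P (delta_mx i j - delta_mx j i).
  have w1 : 1 * 1^* = 1 :> C by rewrite rmorph1 mulr1.
  move=> hk ij; apply: PZi n4 _.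
  have cu := rot_curve_SU ij w1; have co := rot_curve_SO ij w1 erefl.
  have -> : delta_mx i j - delta_mx j i = 1^* *: delta_mx i j - 1 *: delta_mx j i :> mat.
    by rewrite rmorph1 !scale1r.
  case: hk => [kE|[kE|kE]]; move: Pc; rewrite kE => Pc'.
  - exact: Pc' co.
  - exact: Pc' cu.
  - exact: Pc' (curve_SU_U cu).
have off i j : k = SU \/ k = U -> i != j -> P (delta_mx i j).
  (* The curve with w = i gives the direction -i (E_ij + E_ji); together with the antisymmetric
     direction it isolates E_ij over the complex numbers. *)
  move=> hk ij; have w1 : 'i * 'i^* = 1 :> C by rewrite conjCi mulrN ii opprK.
  have s : P ('i^* *: delta_mx i j - 'i *: delta_mx j i).
    apply: PZi n4 _; have cu := rot_curve_SU ij w1.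
    case: hk => kE; move: Pc; rewrite kE => Pc'; first exact: Pc' cu.
    exact: Pc' (curve_SU_U cu).
  have a := anti i j (or_intror hk) ij.
  have -> : delta_mx i j = 2^-1 *: ('i *: ('i^* *: delta_mx i j - 'i *: delta_mx j i)
      + (delta_mx i j - delta_mx j i)) :> mat.
    apply/matrixP => x y; rewrite !mxE conjCi.
    move: (_ && _)%:R (_ && _)%:R => q p.
    transitivity (2^-1 * ((1 - 'i * 'i) * p + (- ('i * 'i) - 1) * q)); last by ring.
    by rewrite ii; field.
  by apply: PZ; apply: Plin.
case kE: k => i j /=.
- have [->|ij] := eqVneq i j; first by rewrite subrr.
  by apply: anti => //; left.
- have [->|ij] := eqVneq i j; last by apply: off => //; right.
  (* [ph_curve] asks for a second index, which 1 < N provides. *)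
  case: (pickP (fun l => j != l)) => [l jl|h].
    apply: PZi i2 _; have := ph_curve false jl; rewrite subr0 => cu.
    by move: Pc; rewrite kE; apply; exact: cu.
  have := cardC1 j; rewrite card_ord (eq_card0 (A := predC1 j)) => [|l].
    move=> n0; suff : (1 < 1)%N by [].
    by apply: (leq_trans N1); rewrite -(prednK (ltnW N1)) -n0.
  by have := h l; rewrite !unfold_in /= eq_sym => ->.
- have [->|ij] := eqVneq i j; last first.
    by rewrite mul0r scale0r subr0; apply: off => //; left.
  (* The traceless diagonal element is the mean over l of E_jj - E_ll, each tangent to a pair of
     conjugate phases. *)
  have -> : delta_mx j j - (1%:R / N%:R) *: 1%:M =
     N%:R^-1 *: (\sum_l (delta_mx j j - delta_mx l l)) :> mat.
    have n0 : N%:R != 0 :> C by rewrite pnatr_eq0 -lt0n (leq_ltn_trans _ (ltn_ord j)).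
    have s1 : 1%:M = \sum_l delta_mx l l :> mat.
      apply/matrixP => x y; rewrite summxE (bigD1 x) //= big1 => [|l lx]; rewrite !mxE.
        by rewrite eqxx addr0 eq_sym.
      by rewrite eq_sym (negPf lx).
    rewrite sumrB sumr_const card_ord -s1 scalerBr -[delta_mx _ _ *+ N]scaler_nat scalerA mulVf // scale1r.
    by rewrite div1r.
  apply: PZ; elim/big_ind: _ => // l _.
  have [->|jl] := eqVneq j l; first by rewrite subrr.
  apply: PZi i2 _; have := ph_curve true jl => cu.
  by move: Pc; rewrite kE; apply; exact: cu.
Qed.

End Tangents.

(** * Completeness relations *)

Section Casimir.
Variables (R : realType) (N : nat).
Local Notation C := R[i].
Local Notation mat := 'M[C]_N.
Hypothesis N0 : (0 < N)%N.
Implicit Types (A B X Y : mat) (k : gkind) (F : mat -> mat -> C).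

Lemma tr_delta A (i j : 'I_N) : \tr (delta_mx j i *m A) = A i j.
Proof.
rewrite /mxtrace (bigD1 j) //= big1 => [|l lj].
  rewrite mxE (bigD1 i) //= big1 => [|l li]; rewrite !mxE ?eqxx ?mul1r ?addr0 //.
  by rewrite (negPf li) andbF mul0r.
by rewrite mxE big1 // => m _; rewrite mxE (negPf lj) mul0r.
Qed.

Lemma tr_delta2 A B (i j a b : 'I_N) :
  \tr (delta_mx j i *m A *m delta_mx a b *m B) = A i a * B b j.
Proof.
rewrite -!mulmxA tr_delta mxE (bigD1 a) //= big1 => [|l la].
  rewrite addr0 mxE (bigD1 b) //= big1 => [|m mb]; rewrite !mxE ?eqxx ?mul1r ?addr0 //.
  by rewrite (negPf mb) andbF mul0r.
rewrite mxE big1 ?mulr0 // => m _; by rewrite mxE (negPf la) mul0r.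
Qed.

Lemma mxtrace_sub A B : \tr (A - B) = \tr A - \tr B.
Proof. exact: raddfB. Qed.

Lemma mxtrace_sub2 X (X' : mat) Y (Y' : mat) A B :
  \tr ((X - X') *m A *m (Y - Y') *m B) = \tr (X *m A *m Y *m B) -
  \tr (X *m A *m Y' *m B) - \tr (X' *m A *m Y *m B) + \tr (X' *m A *m Y' *m B) :> C.
Proof.
have h (p q r s : mat) : \tr (p - q - (r - s)) = \tr p - \tr r - \tr q + \tr s.
  by rewrite 3!mxtrace_sub; ring.
by rewrite mulmxBl mulmxBr 5!mulmxBl h.
Qed.

Lemma mxtraceM A B : \tr (A *m B) = \sum_i \sum_j A i j * B j i.
Proof. by apply: eq_bigr => i _; rewrite mxE. Qed.

Lemma mxtrace_mul2 A B : \tr A * \tr B = \sum_i \sum_j A i i * B j j.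
Proof. by rewrite /mxtrace big_distrlr. Qed.

(* normalization of the basis, and the two correction coefficients of the
   completeness relation of the Lie algebra *)
Definition casnorm k : C := if k is SO then 2^-1 else 1.
Definition kap k : C := if k is SU then N%:R^-1 else 0.
Definition orth k : C := if k is SO then 1 else 0.
Definition cassum k F : C :=
  casnorm k * \sum_i \sum_j F (casbas R k j i) (casbas R k i j).

Lemma eq_cassum k F F' : (forall X Y, F X Y = F' X Y) -> cassum k F = cassum k F'.
Proof. by move=> h; congr (_ * _); apply: eq_bigr => i _; apply: eq_bigr => j _. Qed.

Lemma cassum_sym k F : cassum k F = cassum k (fun X Y => F Y X).
Proof. by rewrite /cassum exchange_big. Qed.

Lemma cassum_sum k (T : Type) (r : seq T) (P : pred T) (F : T -> mat -> mat -> C) :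
  cassum k (fun X Y => \sum_(a <- r | P a) F a X Y) = \sum_(a <- r | P a) cassum k (F a).
Proof.
rewrite /cassum -mulr_sumr; congr (_ * _).
under eq_bigr => i _ do rewrite exchange_big.
by rewrite exchange_big.
Qed.

Lemma cassumM k c F : cassum k (fun X Y => c * F X Y) = c * cassum k F.
Proof.
rewrite /cassum mulrCA; congr (_ * _); rewrite mulr_sumr; apply: eq_bigr => i _.
by rewrite mulr_sumr.
Qed.

Lemma cassumMr k c F : cassum k (fun X Y => F X Y * c) = cassum k F * c.
Proof. by rewrite mulrC -cassumM; apply: eq_cassum => *; rewrite mulrC. Qed.

Lemma cassumN k F : cassum k (fun X Y => - F X Y) = - cassum k F.
Proof. by rewrite -mulN1r -cassumM; apply: eq_cassum => *; rewrite mulN1r. Qed.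

Lemma cassumD k F F' : cassum k (fun X Y => F X Y + F' X Y) = cassum k F + cassum k F'.
Proof.
rewrite /cassum -mulrDr; congr (_ * _); rewrite -big_split; apply: eq_bigr => i _.
by rewrite big_split.
Qed.

Lemma natN_neq0 : N%:R != 0 :> C. Proof. by rewrite pnatr_eq0 -lt0n. Qed.

Lemma sum_diag (F : 'I_N -> 'I_N -> C) (c : C) :
  \sum_i \sum_j ((i == j)%:R * c) * F i j = c * \sum_i F i i.
Proof.
rewrite mulr_sumr; apply: eq_bigr => i _; rewrite (bigD1 i) //= big1 => [|j ji].
  by rewrite eqxx mul1r addr0.
by rewrite eq_sym (negPf ji) !mul0r.
Qed.

(** The relation that fuses two traces. For all matrices the sum of E_ji and E_ij over pairs acts as
    the flip; projecting to trace zero subtracts 1/N times the identity, projecting to antisymmetric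
    matrices subtracts a transposed term. *)
Lemma casimir1 k A B : cassum k (fun Y X => \tr (Y *m A) * \tr (X *m B)) =
  \tr (A *m B) - kap k * (\tr A * \tr B) - orth k * \tr (A *m B^T).
Proof.
have n0 := natN_neq0.
rewrite /cassum; case: k => /=.
- transitivity (2^-1 * (\sum_i \sum_j A i j * B j i + \sum_i \sum_j A j i * B i j
     - (\sum_i \sum_j A i j * B i j + \sum_i \sum_j A j i * B j i))).
    congr (_ * _); rewrite -!big_split -sumrB; apply: eq_bigr => i _ /=.
    rewrite -!big_split -sumrB; apply: eq_bigr => j _ /=.
    by rewrite !mulmxBl !mxtrace_sub !tr_delta; ring.
  rewrite [X in _ + X - _]exchange_big [X in _ - (_ + X)]exchange_big /=.
  rewrite !mxtraceM mul0r mul1r subr0.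
  under [X in _ = _ - X]eq_bigr => i _ do under eq_bigr => j _ do rewrite mxE.
  by field.
- rewrite mul1r !mul0r !subr0 mxtraceM; apply: eq_bigr => i _; apply: eq_bigr => j _.
  by rewrite !tr_delta.
(* The two mixed sums contribute -1/N each and the last one +1/N, so -1/N remains. *)
- transitivity (1 * (\sum_i \sum_j A i j * B j i
    - \sum_(i < N) \sum_(j < N) ((i == j)%:R * N%:R^-1) * (A i j * \tr B)
    - \sum_(i < N) \sum_(j < N) ((i == j)%:R * N%:R^-1) * (\tr A * B i j)
    + \sum_(i < N) \sum_(j < N) ((i == j)%:R * N%:R^-1) * (N%:R^-1 * (\tr A * \tr B)))).
    congr (_ * _); rewrite -!sumrB -big_split; apply: eq_bigr => i _ /=.
    rewrite -!sumrB -big_split; apply: eq_bigr => j _ /=.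
    rewrite !mulmxBl !mxtrace_sub !tr_delta -!scalemxAl !mul1mx !mxtraceZ eq_sym.
    by have [->|ij] := eqVneq i j; rewrite /= ?mulr1n ?mulr0n; ring.
  rewrite (sum_diag (fun i j => A i j * \tr B)) (sum_diag (fun i j => \tr A * B i j)).
  rewrite (sum_diag (fun i j => N%:R^-1 * (\tr A * \tr B))).
  rewrite -mulr_suml -mulr_sumr -!/(mxtrace _) sumr_const card_ord.
  by rewrite mxtraceM -[_ *+ N]mulr_natl; field.
Qed.

(** The same relation with both generators in one trace, which it splits into two. *)
Lemma casimir2 k A B : cassum k (fun Y X => \tr (Y *m A *m X *m B)) =
  \tr A * \tr B - kap k * \tr (A *m B) - orth k * \tr (A *m B^T).
Proof.
have n0 := natN_neq0.
rewrite /cassum; case: k => /=.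
- transitivity (2^-1 * (\sum_i \sum_j A i i * B j j + \sum_i \sum_j A j j * B i i
     - (\sum_i \sum_j A i j * B i j + \sum_i \sum_j A j i * B j i))).
    congr (_ * _); rewrite -!big_split -sumrB; apply: eq_bigr => i _ /=.
    rewrite -!big_split -sumrB; apply: eq_bigr => j _ /=.
    rewrite mxtrace_sub2 (tr_delta2 A B i j i j) (tr_delta2 A B i j j i).
    by rewrite (tr_delta2 A B j i i j) (tr_delta2 A B j i j i); ring.
  rewrite [X in _ + X - _]exchange_big [X in _ - (_ + X)]exchange_big /=.
  rewrite -mxtrace_mul2 !mxtraceM mul0r mul1r subr0.
  under [X in _ = _ - X]eq_bigr => i _ do under eq_bigr => j _ do rewrite mxE.
  by field.
- rewrite mul1r !mul0r !subr0 mxtrace_mul2; apply: eq_bigr => i _; apply: eq_bigr => j _.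
  by rewrite !tr_delta2.
- transitivity (1 * (\sum_i \sum_j A i i * B j j
    - \sum_(i < N) \sum_(j < N) ((i == j)%:R * N%:R^-1) * (A *m B) i j
    - \sum_(i < N) \sum_(j < N) ((i == j)%:R * N%:R^-1) * (B *m A) i j
    + \sum_(i < N) \sum_(j < N) ((i == j)%:R * N%:R^-1) * (N%:R^-1 * \tr (A *m B)))).
    congr (_ * _); rewrite -!sumrB -big_split; apply: eq_bigr => i _ /=.
    rewrite -!sumrB -big_split; apply: eq_bigr => j _ /=.
    set c := N%:R^-1; have t3 : \tr (A *m delta_mx i j *m B) = (B *m A) j i.
      by rewrite mxtrace_mulC mulmxA mxtrace_mulC tr_delta.
    case: (i =P j) => [ij|ij]; rewrite eq_sym; last first.
      have -> : (i == j) = false by apply/eqP.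
      by rewrite !mul0r !scale0r !subr0 tr_delta2 addr0.
    rewrite -ij eqxx !mul1r; rewrite -ij in t3.
    have t4 : \tr (delta_mx i i *m A *m B) = (A *m B) i i by rewrite -mulmxA tr_delta.
    rewrite mxtrace_sub2 scalemx1 !mul_scalar_mx !mul_mx_scalar -!scalemxAl !mxtraceZ.
    rewrite tr_delta2 t4 t3; ring.
  rewrite (sum_diag (fun i j => (A *m B) i j)) (sum_diag (fun i j => (B *m A) i j)).
  rewrite (sum_diag (fun i j => N%:R^-1 * \tr (A *m B))).
  rewrite -!/(mxtrace _) sumr_const card_ord -mxtrace_mul2 [\tr (B *m A)]mxtrace_mulC.
  by rewrite -[_ *+ N]mulr_natl; field.
Qed.

End Casimir.

(** * Words and their derivatives *)

Section Words.
Variables (R : realType) (N d : nat) (k : gkind).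
Local Notation C := R[i].
Local Notation mat := 'M[C]_N.
Local Notation edge := (edge d).
Local Notation config := (edge -> mat).
Implicit Types (Q : config) (l m c : seq edge) (e : edge).

(** For a pair with equal ends neither orientation is positive and [einv] does nothing, so [Qe] of
    the reversed pair would not be the inverse. *)
Definition nondeg e := e.1 != e.2.

Lemma pathmx_cat Q l m : pathmx Q (l ++ m) = pathmx Q l *m pathmx Q m.
Proof. by elim: l => [|e l ih] /=; rewrite ?mul1mx // ih mulmxA. Qed.

Lemma Qe_einvK Q e : gval k Q -> nondeg e -> Qe Q e *m Qe Q (einv e) = 1%:M.
Proof. by move=> gQ pe; rewrite (Qe_einv gQ pe) (Qe_adjK _ gQ). Qed.

Lemma nondeg_einv e : nondeg (einv e) = nondeg e.
Proof. by rewrite /nondeg eq_sym. Qed.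

Lemma all_nondeg_pinv l : all nondeg (pinv l) = all nondeg l.
Proof. by rewrite /pinv all_rev all_map; apply: eq_all => e; rewrite /= nondeg_einv. Qed.

Lemma pathmx_pinv Q l : gval k Q -> all nondeg l -> pathmx Q (pinv l) = adjmx (pathmx Q l).
Proof.
move=> gQ; elim: l => [_|e l ih /= /andP[pe pl]]; first by rewrite adjmx1.
rewrite /pinv /= rev_cons -cats1 -/(pinv l) pathmx_cat ih //= mulmx1.
by rewrite adjmxM (Qe_einv gQ pe).
Qed.

Lemma pathmx_freered Q c : gval k Q -> all nondeg c ->
  all nondeg (freered c) /\ pathmx Q (freered c) = pathmx Q c.
Proof.
move=> gQ; elim: c => [//|e c ih /= /andP[pe pc]]; have [pf pE] := ih pc.
rewrite /freered /= -/(freered c) -pE; move: pf; rewrite /push.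
case: (freered c) => [|e' acc] /=; first by rewrite pe.
move=> /andP[pe' pacc]; case: eqP => [->|_] /=; last by rewrite pe pe'.
by rewrite mulmxA Qe_einvK // mul1mx.
Qed.

(** An interior backtrack cancels in the matrix product itself; one across the base point cancels
    only in the trace, by cyclicity. *)
Lemma Wl_cycred Q fuel c : gval k Q -> all nondeg c -> Wl Q (cycred fuel c) = Wl Q c.
Proof.
move=> gQ; elim: fuel c => [//|fuel ih] [//|e c] /= /andP[pe pc].
case: ifP => // /andP[c0 /eqP le].
case/lastP: c c0 le pc => [//|c e'] _; rewrite last_rcons => ->.
rewrite belast_rcons /= all_rcons => /andP[_ pc]; rewrite ih // /Wl /= -cats1 pathmx_cat /=.
by rewrite mulmx1 mulmxA mxtrace_mulC mulmxA (mulmx1C (Qe_einvK gQ pe)) mul1mx.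
Qed.

Lemma Wl_red Q c : gval k Q -> all nondeg c -> Wl Q (red c) = Wl Q c.
Proof.
move=> gQ pc; have [pf pE] := pathmx_freered gQ pc.
by rewrite /red Wl_cycred // /Wl pE.
Qed.

Lemma Wl_cat Q l m : Wl Q (l ++ m) = Wl Q (m ++ l).
Proof. by rewrite /Wl !pathmx_cat mxtrace_mulC. Qed.

Definition rest l x := behead (rot x l).

Lemma rest_drop l x : (x < size l)%N -> rest l x = drop x.+1 l ++ take x l.
Proof. by move=> xl; rewrite /rest /rot (drop_nth (e0 d)) //. Qed.

Lemma rot_rest l x : (x < size l)%N -> rot x l = enth l x :: rest l x.
Proof. by move=> xl; rewrite rest_drop // /rot (drop_nth (e0 d)) //. Qed.

Lemma size_rest l x : size (rest l x) = (size l).-1.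
Proof. by rewrite /rest size_behead size_rot. Qed.

Lemma Wl_rot Q l x : Wl Q (rot x l) = Wl Q l.
Proof. by rewrite /rot Wl_cat cat_take_drop. Qed.

Section Derivative.
Variable f : edge.
Implicit Types X Y : mat.

Definition dpath X Q l : mat := \sum_(x <- iota 0 (size l))
  pathmx Q (take x l) *m dQe f X Q (enth l x) *m pathmx Q (drop x.+1 l).
Definition dWl X Q l : C := \sum_(x <- iota 0 (size l))
  \tr (dQe f X Q (enth l x) *m pathmx Q (rest l x)).
Definition ddWl Y X Q l : C := \sum_(x <- iota 0 (size l))
  (\tr (d2Qe f Y X Q (enth l x) *m pathmx Q (rest l x)) +
   \sum_(y <- iota 0 (size l) | x != y)
     \tr (dQe f Y Q (enth l x) *m pathmx Q (segb l x y) *m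
          dQe f X Q (enth l y) *m pathmx Q (segc l x y))).

Lemma dpath_cons X Q e l :
  dpath X Q (e :: l) = dQe f X Q e *m pathmx Q l + Qe Q e *m dpath X Q l.
Proof.
rewrite /dpath /= big_cons /= drop0 mul1mx; congr (_ + _).
rewrite (iotaDl 1 0) big_map mulmx_sumr; apply: eq_bigr => x _.
by rewrite add1n /= !mulmxA.
Qed.

Lemma tr_dpath X Q l : \tr (dpath X Q l) = dWl X Q l.
Proof.
rewrite /dpath /dWl raddf_sum /= big_seq [RHS]big_seq; apply: eq_bigr => x.
rewrite mem_iota add0n /= => xl; rewrite rest_drop // pathmx_cat.
by rewrite -mulmxA mxtrace_mulC mulmxA.
Qed.

(** Second locations y other than x correspond to the positions of [rest l x]; the words before and
    after such a position are [segb] and [segc]. *)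
Lemma dpath_rest X Y Q l x : (x < size l)%N ->
  \tr (dQe f Y Q (enth l x) *m dpath X Q (rest l x)) =
  \sum_(y <- iota 0 (size l) | x != y)
     \tr (dQe f Y Q (enth l x) *m pathmx Q (segb l x y) *m
          dQe f X Q (enth l y) *m pathmx Q (segc l x y)).
Proof.
move=> xl; set n := size l.
have n0 : (0 < n)%N by apply: leq_ltn_trans xl.
(* Position z of the remaining word is the location z + 1 steps after x, the letter at x itself
   having been removed. *)
pose g z := ((x + z.+1) %% n)%N.
have gin z : (z < n.-1)%N -> ((g z + n - x) %% n)%N = z.+1.
  move=> zn; rewrite /g; have [h|h] := ltnP (x + z.+1)%N n.
    rewrite (modn_small h) (_ : (x + z.+1 + n - x)%N = (z.+1 + n)%N); last by lia.
    by rewrite modnDr modn_small //; lia.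
  have -> : (x + z.+1)%N = (x + z.+1 - n + n)%N by lia.
  by rewrite modnDr (modn_small (m := (_ - _)%N)) ?modn_small; lia.
have pg : perm_eq [seq y <- iota 0 n | x != y] [seq g z | z <- iota 0 n.-1].
  apply: uniq_perm; first by rewrite filter_uniq ?iota_uniq.
    rewrite map_inj_in_uniq ?iota_uniq // => z z'; rewrite !mem_iota !add0n /= => h h' gg.
    by have := gin z h; rewrite gg gin // => -[].
  move=> y; rewrite mem_filter mem_iota add0n /=; apply/andP/mapP.
    move=> [xy yn]; exists ((y + n - x) %% n).-1%N.
      have := ltn_pmod (y + n - x) n0; rewrite mem_iota add0n /=; lia.
    rewrite /g; have [h|h] := ltnP x y.
      have -> : (y + n - x)%N = (y - x + n)%N by lia.
      rewrite modnDr (modn_small (m := (y - x)%N)); last by lia.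
      by rewrite (_ : (x + (y - x).-1.+1)%N = y) ?modn_small; lia.
    rewrite (modn_small (m := (y + n - x)%N)); last by lia.
    have -> : (x + (y + n - x).-1.+1)%N = (y + n)%N by lia.
    by rewrite modnDr modn_small.
  move=> [z]; rewrite mem_iota add0n /= => zn ->; rewrite /g ltn_mod n0; split=> //.
  have := gin z zn; rewrite /g => h; apply/eqP => xe; move: h; rewrite -xe addKn modnn.
  by [].
rewrite -big_filter (perm_big _ pg) big_map /dpath size_rest -/n mulmx_sumr raddf_sum /=.
rewrite big_seq [RHS]big_seq; apply: eq_bigr => z; rewrite mem_iota add0n /= => zn.
have eE : enth l (g z) = enth (rest l x) z.
  rewrite /enth rest_drop // nth_cat size_drop nth_drop -/n /g.
  case: ltnP => h; first by rewrite modn_small ?addnS //; lia.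
  rewrite nth_take; last by lia.
  have -> : (x + z.+1)%N = (x + z.+1 - n + n)%N by lia.
  by rewrite modnDr modn_small; [congr nth|]; lia.
have e1 : segb l x (g z) = take z (rest l x) by rewrite /segb -/n gin.
have e2 : segc l x (g z) = drop z.+1 (rest l x) by rewrite /segc -/n gin // rot_rest.
rewrite eE e1 e2; congr (\tr _).
by rewrite mulmxA (mulmxA (dQe f Y Q (enth l x))).
Qed.

Lemma Wl_dE X Y Q l : \sum_(x <- iota 0 (size l))
  (\tr (d2Qe f Y X Q (enth l x) *m pathmx Q (rest l x)) +
   \tr (dQe f Y Q (enth l x) *m dpath X Q (rest l x))) = ddWl Y X Q l.
Proof.
rewrite /ddWl big_seq [RHS]big_seq; apply: eq_bigr => x; rewrite mem_iota add0n /= => xl.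
by rewrite dpath_rest.
Qed.

Variables (g : C -> mat) (X : mat).
Hypothesis pf : positive f.
Hypothesis gX : curve k g X.

Lemma difm_pathmx l : difm k f g (fun Q => pathmx Q l) (fun Q => dpath X Q l).
Proof.
elim: l => [|e l ih].
  move=> i j; apply: (dif_ext gX) (difm_cst f gX (1%:M : mat) i j) => Q _ //.
  by rewrite /dpath big_nil.
move=> i j; apply: (dif_ext gX) (difmM gX (difm_Qe pf gX e) ih i j) => Q _ //.
by rewrite dpath_cons.
Qed.

Lemma dif_Wl l : dif k f g (fun Q => Wl Q l) (fun Q => dWl X Q l).
Proof.
by apply: (dif_ext gX) (dif_tr (difm_pathmx l)) => Q _ //; rewrite tr_dpath.
Qed.

Lemma dif_dWl Y l : dif k f g (fun Q => dWl Y Q l) (fun Q => ddWl Y X Q l).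
Proof.
have h x := dif_tr (difmM gX (difm_dQe pf gX Y (enth l x)) (difm_pathmx (rest l x))).
apply: (dif_ext gX) (dif_sum (iota 0 (size l)) xpredT h) => Q _ //.
by rewrite -Wl_dE; apply: eq_bigr => x _; rewrite mxtraceD.
Qed.

End Derivative.

End Words.

(** * Contractions *)

Section AbstractContraction.
Variables (R : realType) (N : nat) (k : gkind).
Local Notation C := R[i].
Local Notation mat := 'M[C]_N.
Hypothesis N0 : (0 < N)%N.
Variables A A' : mat.
Hypotheses (AA' : A *m A' = 1%:M) (A'A : A' *m A = 1%:M).
Hypotheses (AT : k = SO -> A^T = A') (A'T : k = SO -> A'^T = A).
Implicit Types B D X Y : mat.

(** Transposition inverts [A] only on SO(N); the factor o confines its use to that group. *)
Lemma orth_eq (x y : C) : (k = SO -> x = y) -> orth R k * x = orth R k * y.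
Proof. by case: k => [->|_|_] //=; rewrite !mul0r. Qed.

(** Suffix 2 means that both occurrences of the edge lie in one trace, suffix 1 that they lie in two
    traces; [same] and [opp] give their relative orientation. *)
Definition same2 B D : C := \tr (A *m B) * \tr (A *m D)
  - kap R N k * \tr (A *m B *m A *m D) - orth R k * \tr (B *m D^T).
Definition opp2 B D : C := \tr B * \tr D
  - kap R N k * \tr (A *m B *m A' *m D) - orth R k * \tr (A *m B *m A' *m D^T).
Definition same1 B D : C := \tr (A *m B *m A *m D)
  - kap R N k * (\tr (A *m B) * \tr (A *m D)) - orth R k * \tr (B *m D^T).
Definition opp1 B D : C := \tr (B *m D)
  - kap R N k * (\tr (A *m B) * \tr (A' *m D)) - orth R k * \tr (A *m B *m A *m D^T).

Lemma tr_conj B : \tr (A *m B *m A') = \tr B.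
Proof. by rewrite mxtrace_mulC mulmxA A'A mul1mx. Qed.

Let trC2 (x y z : mat) : \tr (x *m y *m z) = \tr (y *m (z *m x)).
Proof. by rewrite -mulmxA mxtrace_mulC mulmxA. Qed.

(** The letters p and n tell whether an occurrence is the integrated edge, with factor Y A, or its
    reverse, with factor -A Y. As pp agrees with nn, and pn with np, only the relative orientation
    matters. *)
Lemma contract2_pp B D :
  cassum k (fun Y X => \tr ((Y *m A) *m B *m (X *m A) *m D)) = same2 B D.
Proof.
transitivity (cassum k (fun Y X => \tr (Y *m (A *m B) *m X *m (A *m D)))).
  by apply: eq_cassum => Y X; rewrite -(mulmxA Y) !(mulmxA _ X) !(mulmxA _ A D).
rewrite casimir2 // /same2 mulmxA; congr (_ - _); apply: orth_eq => kSO.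
by rewrite trmx_mul (AT kSO) mulmxA -(mulmxA A) tr_conj.
Qed.

Lemma contract2_nn B D :
  cassum k (fun Y X => \tr (- (A *m Y) *m B *m (- (A *m X)) *m D)) = same2 B D.
Proof.
transitivity (cassum k (fun Y X => \tr (Y *m (B *m A) *m X *m (D *m A)))).
  apply: eq_cassum => Y X; rewrite !(mulNmx, mulmxN) opprK.
  by rewrite -!(mulmxA A) mxtrace_mulC !mulmxA.
rewrite casimir2 // /same2 [\tr (B *m A)]mxtrace_mulC [\tr (D *m A)]mxtrace_mulC.
congr (_ - _ - _).
  by congr (_ * _); rewrite (mulmxA (B *m A)) mxtrace_mulC !mulmxA.
apply: orth_eq => kSO.
by rewrite trmx_mul (AT kSO) !mulmxA -(mulmxA B) AA' mulmx1.
Qed.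

Lemma contract2_pn B D :
  cassum k (fun Y X => \tr ((Y *m A) *m B *m (- (A' *m X)) *m D)) = - opp2 B D.
Proof.
transitivity (- cassum k (fun Y X => \tr (Y *m (A *m B *m A') *m X *m D))).
  rewrite -cassumN; apply: eq_cassum => Y X; rewrite mulmxN mulNmx raddfN /=.
  by congr (- \tr _); rewrite !mulmxA.
by rewrite casimir2 // tr_conj.
Qed.

Lemma contract2_np B D :
  cassum k (fun Y X => \tr (- (A *m Y) *m B *m (X *m A') *m D)) = - opp2 B D.
Proof.
transitivity (- cassum k (fun Y X => \tr (Y *m B *m X *m (A' *m D *m A)))).
  rewrite -cassumN; apply: eq_cassum => Y X; rewrite !mulNmx raddfN /=.
  by congr (- _); rewrite -!(mulmxA A) mxtrace_mulC !mulmxA.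
rewrite casimir2 // /opp2; congr (- (_ * _ - _ - _)).
- by rewrite mxtrace_mulC mulmxA AA' mul1mx.
- by congr (_ * _); rewrite mulmxA mxtrace_mulC !mulmxA.
- apply: orth_eq => kSO.
  by rewrite !trmx_mul (AT kSO) (A'T kSO) !mulmxA mxtrace_mulC !mulmxA.
Qed.

Lemma contract1_pp B D :
  cassum k (fun Y X => \tr ((Y *m A) *m B) * \tr ((X *m A) *m D)) = same1 B D.
Proof.
transitivity (cassum k (fun Y X => \tr (Y *m (A *m B)) * \tr (X *m (A *m D)))).
  by apply: eq_cassum => Y X; rewrite -!mulmxA.
rewrite casimir1 // /same1 mulmxA; congr (_ - _); apply: orth_eq => kSO.
by rewrite trmx_mul (AT kSO) mulmxA -(mulmxA A) tr_conj.
Qed.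

Lemma contract1_nn B D :
  cassum k (fun Y X => \tr (- (A *m Y) *m B) * \tr (- (A *m X) *m D)) = same1 B D.
Proof.
have e Y E : \tr (- (A *m Y) *m E) = - \tr (Y *m (E *m A)).
  by rewrite mulNmx raddfN /= trC2.
transitivity (cassum k (fun Y X => \tr (Y *m (B *m A)) * \tr (X *m (D *m A)))).
  by apply: eq_cassum => Y X; rewrite !e mulrNN.
rewrite casimir1 // /same1 [\tr (B *m A)]mxtrace_mulC [\tr (D *m A)]mxtrace_mulC.
congr (_ - _ - _).
  by rewrite (mulmxA (B *m A)) mxtrace_mulC !mulmxA.
apply: orth_eq => kSO.
by rewrite trmx_mul (AT kSO) !mulmxA -(mulmxA B) AA' mulmx1.
Qed.

Lemma contract1_pn B D :
  cassum k (fun Y X => \tr ((Y *m A) *m B) * \tr (- (A' *m X) *m D)) = - opp1 B D.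
Proof.
transitivity (- cassum k (fun Y X => \tr (Y *m (A *m B)) * \tr (X *m (D *m A')))).
  rewrite -cassumN; apply: eq_cassum => Y X; rewrite mulNmx raddfN mulrN /=.
  by rewrite (trC2 A') -(mulmxA Y).
rewrite casimir1 // /opp1; congr (- (_ - _ * (_ * _) - _)).
- by rewrite !mulmxA mxtrace_mulC !mulmxA A'A mul1mx.
- by rewrite mxtrace_mulC.
- by apply: orth_eq => kSO; rewrite trmx_mul (A'T kSO) !mulmxA.
Qed.

Lemma contract1_np B D :
  cassum k (fun Y X => \tr (- (A *m Y) *m B) * \tr ((X *m A') *m D)) = - opp1 B D.
Proof.
transitivity (- cassum k (fun Y X => \tr (Y *m (B *m A)) * \tr (X *m (A' *m D)))).
  rewrite -cassumN; apply: eq_cassum => Y X; rewrite mulNmx raddfN mulNr /=.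
  by rewrite (trC2 A) -(mulmxA X).
rewrite casimir1 // /opp1; congr (- (_ - _ * (_ * _) - _)).
- by rewrite !mulmxA -(mulmxA B) AA' mulmx1.
- by rewrite mxtrace_mulC.
- apply: orth_eq => kSO.
  by rewrite trmx_mul (A'T kSO) !mulmxA mxtrace_mulC !mulmxA.
Qed.

(** Both derivatives on one occurrence produce the scalar by which the quadratic Casimir element
    acts: [casimir2] with the identity as first word, of trace N. *)
Lemma contract_own B : cassum k (fun Y X => \tr (Y *m (X *m A) *m B)) =
  (N%:R - kap R N k - orth R k) * \tr (A *m B).
Proof.
transitivity (cassum k (fun Y X => \tr (Y *m 1%:M *m X *m (A *m B)))).
  by apply: eq_cassum => Y X; rewrite mulmx1 !mulmxA.
by rewrite casimir2 // mxtrace1 !mul1mx mxtrace_tr; ring.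
Qed.

Lemma contract_own_n B : cassum k (fun Y X => \tr (A *m X *m Y *m B)) =
  (N%:R - kap R N k - orth R k) * \tr (A *m B).
Proof.
transitivity (cassum k (fun Y X => \tr (Y *m 1%:M *m X *m (B *m A)))).
  rewrite cassum_sym; apply: eq_cassum => Y X; rewrite mulmx1.
  by rewrite -!(mulmxA A) mxtrace_mulC !mulmxA.
rewrite casimir2 // mxtrace1 !mul1mx mxtrace_tr [\tr (B *m A)]mxtrace_mulC; ring.
Qed.

End AbstractContraction.

(** * Contractions summed over the edges of the box *)

Section EdgeContraction.
Variables (R : realType) (N d : nat) (k : gkind).
Local Notation C := R[i].
Local Notation mat := 'M[C]_N.
Local Notation edge := (edge d).
Hypothesis N0 : (0 < N)%N.
Variables (Q : edge -> mat) (es : seq edge).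
Hypotheses (gQ : gval k Q) (ues : uniq es) (pes : {in es, forall e, positive e}).
Implicit Types (e f : edge) (X Y B D : mat) (b c m : seq edge).

Definition absedge e := if positive e then e else einv e.

Lemma Qe_SO e : k = SO -> nondeg e -> (Qe Q e)^T = Qe Q (einv e).
Proof.
move=> kSO pe; rewrite (Qe_einv gQ pe) /adjmx; congr (_^T).
have re (M : mat) : inG k M -> Defs.conjmx M = M by rewrite kSO => /and3P[/eqP].
rewrite /Qe; case: ifP => _; first by rewrite re.
rewrite (inG_invmx (gQ _)) /adjmx re //.
by rewrite -[in LHS](re _ (gQ (einv e))) /Defs.conjmx map_trmx.
Qed.

Lemma nondeg_neq_einv e : nondeg e -> (e == einv e) = false.
Proof. by case: e => u v; rewrite /nondeg /einv /= => uv; rewrite xpair_eqE (negPf uv). Qed.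

Lemma nondeg_positive_einv e : nondeg e -> positive (einv e) = ~~ positive e.
Proof.
move=> pe; have := lexlt_total pe; rewrite -/(positive e) -/(positive (einv e)).
by case: (boolP (positive e)) => [/positive_einv/negPf|].
Qed.

Lemma dQe_abs X e : nondeg e ->
  dQe (absedge e) X Q e = if positive e then X *m Qe Q e else - (Qe Q e *m X).
Proof.
move=> pe; rewrite /dQe /absedge; case: (positive e); first by rewrite eqxx.
by rewrite einvK eqxx nondeg_neq_einv.
Qed.

Lemma dQe_abs_einv X e : nondeg e -> dQe (absedge e) X Q (einv e) =
  if positive e then - (Qe Q (einv e) *m X) else X *m Qe Q (einv e).
Proof.
move=> pe; rewrite /dQe /absedge; case: (positive e); last by rewrite eqxx.
by rewrite eq_sym nondeg_neq_einv // eqxx.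
Qed.

Lemma dQe_abs_other X e e' : e' != e -> e' != einv e -> dQe (absedge e) X Q e' = 0.
Proof.
move=> ne ni; rewrite /dQe /absedge; case: (positive e).
  by rewrite (negPf ne) (negPf ni).
by rewrite einvK (negPf ne) (negPf ni).
Qed.

Lemma d2Qe_abs Y X e : nondeg e -> d2Qe (absedge e) Y X Q e =
  if positive e then Y *m (X *m Qe Q e) else Qe Q e *m X *m Y.
Proof.
move=> pe; rewrite /d2Qe /absedge; case: (positive e); first by rewrite eqxx.
by rewrite einvK eqxx nondeg_neq_einv.
Qed.

Lemma dQe_neq0 f e : f \in es -> f != absedge e ->
  (e == f) = false /\ (e == einv f) = false.
Proof.
move=> /pes pf; rewrite /absedge => h; split; apply/negP => /eqP ef; move: h; rewrite ef.
  by rewrite pf eqxx.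
by rewrite (negPf (positive_einv pf)) einvK eqxx.
Qed.

(** Among the integrated edges only the positive representative of e moves [Qe Q e], so sums over
    the box collapse to one term. *)
Lemma sum_abs (F : edge -> C) e : absedge e \in es ->
  (forall f, f \in es -> f != absedge e -> F f = 0) -> \sum_(f <- es) F f = F (absedge e).
Proof.
move=> ae h; rewrite (bigD1_seq _ ae ues) /= big_seq_cond big1 ?addr0 //.
by move=> f /andP[fes ne]; apply: h.
Qed.

Lemma cassum0 (F : mat -> mat -> C) : (forall X Y, F X Y = 0) -> cassum k F = 0.
Proof.
move=> h; rewrite /cassum big1 ?mulr0 // => i _; rewrite big1 // => j _; exact: h.
Qed.

Definition con2 e e' B D : C := \sum_(f <- es) cassum k (fun Y X =>
  \tr (dQe f Y Q e *m B *m dQe f X Q e' *m D)).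
Definition con1 e e' B D : C := \sum_(f <- es) cassum k (fun Y X =>
  \tr (dQe f Y Q e *m B) * \tr (dQe f X Q e' *m D)).
Definition con0 e B : C := \sum_(f <- es) cassum k (fun Y X =>
  \tr (d2Qe f Y X Q e *m B)).

Lemma con2_abs e e' B D : absedge e \in es -> con2 e e' B D = cassum k (fun Y X =>
  \tr (dQe (absedge e) Y Q e *m B *m dQe (absedge e) X Q e' *m D)).
Proof.
move=> ae; apply: sum_abs ae _ => f fes ne; apply: cassum0 => Y X.
have [h1 h2] := dQe_neq0 fes ne.
by rewrite [dQe f Y Q e]/dQe h1 h2 !mul0mx mxtrace0.
Qed.

Lemma con1_abs e e' B D : absedge e \in es -> con1 e e' B D = cassum k (fun Y X =>
  \tr (dQe (absedge e) Y Q e *m B) * \tr (dQe (absedge e) X Q e' *m D)).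
Proof.
move=> ae; apply: sum_abs ae _ => f fes ne; apply: cassum0 => Y X.
have [h1 h2] := dQe_neq0 fes ne.
by rewrite [dQe f Y Q e]/dQe h1 h2 !mul0mx mxtrace0 mul0r.
Qed.

Section AtEdge.
Variable e : edge.
Hypotheses (pe : nondeg e) (ae : absedge e \in es).

Let A := Qe Q e.
Let A' := Qe Q (einv e).
Let AA' : A *m A' = 1%:M. Proof. exact: Qe_einvK. Qed.
Let A'A : A' *m A = 1%:M. Proof. exact: mulmx1C AA'. Qed.
Let AT : k = SO -> A^T = A'. Proof. by move=> h; apply: Qe_SO. Qed.
Let A'T : k = SO -> A'^T = A.
Proof. by move=> h; rewrite /A -[e in RHS]einvK; apply: Qe_SO => //; rewrite nondeg_einv. Qed.

Lemma con2_same B D : con2 e e B D = same2 k A B D.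
Proof.
rewrite con2_abs //; case pp: (positive e).
  rewrite -(contract2_pp N0 A'A AT); apply: eq_cassum => Y X.
  by rewrite !dQe_abs // pp.
rewrite -(contract2_nn N0 AA' AT); apply: eq_cassum => Y X.
by rewrite !dQe_abs // pp.
Qed.

Lemma con2_opp B D : con2 e (einv e) B D = - opp2 k A A' B D.
Proof.
rewrite con2_abs //; case pp: (positive e).
  rewrite -(contract2_pn k N0 A'A); apply: eq_cassum => Y X.
  by rewrite dQe_abs // dQe_abs_einv // pp.
rewrite -(contract2_np N0 AA' AT A'T); apply: eq_cassum => Y X.
by rewrite dQe_abs // dQe_abs_einv // pp.
Qed.

Lemma con2_other e' B D : e' != e -> e' != einv e -> con2 e e' B D = 0.
Proof.
move=> h h'; rewrite con2_abs //; apply: cassum0 => Y X.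
by rewrite (dQe_abs_other _ h h') mulmx0 mul0mx mxtrace0.
Qed.

Lemma con1_same B D : con1 e e B D = same1 k A B D.
Proof.
rewrite con1_abs //; case pp: (positive e).
  rewrite -(contract1_pp N0 A'A AT); apply: eq_cassum => Y X.
  by rewrite !dQe_abs // pp.
rewrite -(contract1_nn N0 AA' AT); apply: eq_cassum => Y X.
by rewrite !dQe_abs // pp.
Qed.

Lemma con1_opp B D : con1 e (einv e) B D = - opp1 k A A' B D.
Proof.
rewrite con1_abs //; case pp: (positive e).
  rewrite -(contract1_pn N0 A'A A'T); apply: eq_cassum => Y X.
  by rewrite dQe_abs // dQe_abs_einv // pp.
rewrite -(contract1_np N0 AA' A'T); apply: eq_cassum => Y X.
by rewrite dQe_abs // dQe_abs_einv // pp.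
Qed.

Lemma con1_other e' B D : e' != e -> e' != einv e -> con1 e e' B D = 0.
Proof.
move=> h h'; rewrite con1_abs //; apply: cassum0 => Y X.
by rewrite (dQe_abs_other _ h h') mul0mx mxtrace0 mulr0.
Qed.

Lemma con0E B : con0 e B = (N%:R - kap R N k - orth R k) * \tr (A *m B).
Proof.
rewrite /con0 (sum_abs ae); last first.
  move=> f fes ne; apply: cassum0 => Y X; have [h1 h2] := dQe_neq0 fes ne.
  by rewrite /d2Qe h1 h2 mul0mx mxtrace0.
case pp: (positive e).
  rewrite -(contract_own k N0); apply: eq_cassum => Y X.
  by rewrite d2Qe_abs // pp.
rewrite -(contract_own_n k N0); apply: eq_cassum => Y X.
by rewrite d2Qe_abs // pp.
Qed.

End AtEdge.

(* on SO(N)-valued configurations a transpose is the word traversed backwards *)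
Lemma orth_tr B m : all (@nondeg d) m ->
  orth R k * \tr (B *m (pathmx Q m)^T) = orth R k * \tr (B *m pathmx Q (pinv m)).
Proof.
move=> pm; apply: orth_eq => kSO; congr (\tr (_ *m _)).
elim: m pm => [_|e m ih /= /andP[pe pm]]; first by rewrite trmx1.
by rewrite /pinv /= rev_cons -cats1 pathmx_cat trmx_mul ih //= mulmx1 Qe_SO.
Qed.

Lemma same2_words e b c : all (@nondeg d) c ->
  same2 k (Qe Q e) (pathmx Q b) (pathmx Q c) =
  Wl Q (e :: b) * Wl Q (e :: c) - kap R N k * Wl Q (e :: b ++ e :: c)
  - orth R k * Wl Q (b ++ pinv c).
Proof. by move=> pc; rewrite /same2 orth_tr // /Wl /= !pathmx_cat /= !mulmxA. Qed.

Lemma opp2_words e b c : all (@nondeg d) c ->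
  opp2 k (Qe Q e) (Qe Q (einv e)) (pathmx Q b) (pathmx Q c) =
  Wl Q b * Wl Q c - kap R N k * Wl Q (e :: b ++ einv e :: c)
  - orth R k * Wl Q (e :: b ++ einv e :: pinv c).
Proof. by move=> pc; rewrite /opp2 orth_tr // /Wl /= !pathmx_cat /= !mulmxA. Qed.

Lemma same1_words e b c : all (@nondeg d) c ->
  same1 k (Qe Q e) (pathmx Q b) (pathmx Q c) =
  Wl Q (e :: b ++ e :: c) - kap R N k * (Wl Q (e :: b) * Wl Q (e :: c))
  - orth R k * Wl Q (b ++ pinv c).
Proof. by move=> pc; rewrite /same1 orth_tr // /Wl /= !pathmx_cat /= !mulmxA. Qed.

Lemma opp1_words e b c : all (@nondeg d) c ->
  opp1 k (Qe Q e) (Qe Q (einv e)) (pathmx Q b) (pathmx Q c) =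
  Wl Q (b ++ c) - kap R N k * (Wl Q (e :: b) * Wl Q (einv e :: c))
  - orth R k * Wl Q (e :: b ++ e :: pinv c).
Proof. by move=> pc; rewrite /opp1 orth_tr // /Wl /= !pathmx_cat /= !mulmxA. Qed.

End EdgeContraction.

(** * Plaquettes of a unit square *)

Section Plaquettes.
Variables (d : nat) (L : seq (vtx d)).
Local Notation vtx := (vtx d).
Local Notation edge := (edge d).
Implicit Types (x a b u v w : vtx).
Local Notation vec := {ffun 'I_d -> int}.

(** Vertex arithmetic is translated into the additive group of finite functions, whose lemmas then
    apply. *)
Lemma vaddE u v : vadd u v = (u : vec) + (v : vec).
Proof. by apply/ffunP => j; rewrite !ffunE. Qed.

Lemma vnegE u : vneg u = - (u : vec).
Proof. by apply/ffunP => j; rewrite !ffunE. Qed.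

Lemma vsubE u v : vsub u v = (u : vec) - (v : vec).
Proof. by apply/ffunP => j; rewrite !ffunE. Qed.

Lemma v0E : v0 d = 0 :> vec.
Proof. by apply/ffunP => j; rewrite !ffunE. Qed.

Lemma unitvecsP a : reflect (exists i s, a = unitvec i s) (a \in unitvecs d).
Proof.
apply: (iffP mapP) => [[[i s] _ ->]|[i [s ->]]]; first by exists i, s.
by exists (i, s) => //; rewrite mem_enum.
Qed.

Lemma unitvec_neg i s : vneg (unitvec i s) = unitvec (d := d) i (~~ s).
Proof. by apply/ffunP => j; rewrite !ffunE; case: eqP => // _; case: s; rewrite ?opprK ?oppr0. Qed.

Lemma unitvecs_neg a : (vneg a \in unitvecs d) = (a \in unitvecs d).
Proof.
apply/unitvecsP/unitvecsP => -[i [s e]]; exists i, (~~ s).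
  by rewrite -unitvec_neg -e !vnegE opprK.
by rewrite e unitvec_neg.
Qed.

Lemma unitvec_neq0 i s : unitvec i s != 0 :> vec.
Proof. by apply/eqP => /ffunP/(_ i); rewrite !ffunE eqxx; case: s. Qed.

Lemma unitvec_inj : injective (fun p : 'I_d * bool => unitvec p.1 p.2).
Proof.
move=> [i s] [j r] /= /ffunP e; have := e i; rewrite !ffunE eqxx.
by case: eqP => [->|_]; case: (s); case: (r).
Qed.

Lemma unitvecs_uniq : uniq (unitvecs d).
Proof. by rewrite map_inj_uniq ?enum_uniq //; apply: unitvec_inj. Qed.

Lemma lexlt_add x u v : lexlt ((x : vec) + u) ((x : vec) + v) = lexlt u v.
Proof.
apply: eq_existsb => i; congr (_ && _); last by rewrite !ffunE ltrD2l.
by apply: eq_forallb => j; rewrite !ffunE (inj_eq (addrI _)).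
Qed.

Lemma lexlt_trans u v w : lexlt u v -> lexlt v w -> lexlt u w.
Proof.
move=> /existsP[i /andP[/forallP ei li]] /existsP[j /andP[/forallP ej lj]].
have ei' (h : 'I_d) : (h < i)%N -> u h = v h by move=> hi; have := ei h; rewrite hi => /eqP.
have ej' (h : 'I_d) : (h < j)%N -> v h = w h by move=> hj; have := ej h; rewrite hj => /eqP.
case: (ltngtP i j) => [ij|ji|/val_inj ij].
- apply/existsP; exists i; rewrite -(ej' _ ij) li andbT; apply/forallP => h.
  by apply/implyP => hi; rewrite ei' // ej' // (ltn_trans hi).
- apply/existsP; exists j; rewrite (ei' _ ji) lj andbT; apply/forallP => h.
  by apply/implyP => hj; rewrite ei' ?ej' // (ltn_trans hj).
- subst j; apply/existsP; exists i; rewrite (lt_trans li lj) andbT; apply/forallP => h.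
  by apply/implyP => hi; rewrite ei' // ej'.
Qed.

Lemma lexlt_neg u v : u != v -> lexlt v u = ~~ lexlt u v.
Proof.
move=> uv; have := lexlt_total uv; case: (boolP (lexlt u v)) => //.
by move=> /lexlt_asym/negPf.
Qed.

Definition pos a := lexlt (0 : vec) a.

Lemma pos_neg a : a != (0 : vec) -> pos (- (a : vec)) = ~~ pos a.
Proof.
move=> a0; rewrite -(lexlt_neg (u := 0)) 1?eq_sym // /pos.
by rewrite -(lexlt_add a) addr0 subrr.
Qed.

(** (x, a, b) encodes the plaquette rooted at x with first step a and second step b. [trot] moves
    the root along one edge and [tswap] reverses the orientation at the same root; they generate the
    eight rooted orientations of a square. *)
Definition triple := (vtx * vtx * vtx)%type.
Implicit Types t : triple.
Definition mk t : seq edge := mkplaq t.1.1 t.1.2 t.2.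
Definition trot t : triple := (vadd t.1.1 t.1.2, t.2, vneg t.1.2).
Definition tswap t : triple := (t.1.1, t.2, t.1.2).
Definition triples : seq triple :=
  [seq t <- [seq (xa, b) | xa <- [seq (x, a) | x <- undup L, a <- unitvecs d],
                           b <- unitvecs d]
  | Defs.ortho t.1.2 t.2 && plaq_in L t.1.1 t.1.2 t.2].

Lemma plaquettesE : plaquettes L = map mk triples.
Proof. by []. Qed.

Lemma mem_triples t : (t \in triples) =
  [&& Defs.ortho t.1.2 t.2, plaq_in L t.1.1 t.1.2 t.2, t.1.2 \in unitvecs d & t.2 \in unitvecs d].
Proof.
case: t => [[x a] b]; rewrite mem_filter /=.
have -> : ((x, a, b) \in [seq (xa, b) | xa <- [seq (x, a) | x <- undup L, a <- unitvecs d],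
    b <- unitvecs d]) = [&& x \in L, a \in unitvecs d & b \in unitvecs d].
  apply/allpairsP/and3P => [[[xa b'] /= [/allpairsP[[x' a'] /= [h1 h2 ->]] h3 [-> -> ->]]]|[hx ha hb]].
    by rewrite -mem_undup.
  by exists ((x, a), b); split=> //; apply/allpairsP; exists (x, a); rewrite mem_undup.
by rewrite /plaq_in /=; case: (x \in L); rewrite ?andbF //= ?andbT -!andbA.
Qed.

Lemma triples_uniq : uniq triples.
Proof.
apply: filter_uniq; apply: allpairs_uniq; [|exact: unitvecs_uniq|by move=> [? ?] [? ?]].
by apply: allpairs_uniq; [exact: undup_uniq|exact: unitvecs_uniq|move=> [? ?] [? ?]].
Qed.

Lemma trot_triples t : t \in triples -> trot t \in triples.
Proof.
case: t => [[x a] b]; rewrite !mem_triples /= unitvecs_neg.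
move=> /and4P[/andP[ba bna] p -> ->]; rewrite !andbT; apply/andP; split.
  apply/andP; split; first by rewrite eq_sym.
  by rewrite !vnegE (inj_eq oppr_inj) eq_sym.
move: p; rewrite /plaq_in /= !andbT => /and4P[h1 h2 h3 h4].
rewrite h2 h3 !vaddE !vnegE -!vaddE.
have -> : vadd (vadd (vadd x a) b) (- (a : vec)) = vadd x b.
  by rewrite !vaddE addrAC addrK.
have -> : vadd (vadd x a) (- (a : vec)) = x by rewrite !vaddE addrK.
by rewrite h4 h1.
Qed.

Lemma tswap_triples t : t \in triples -> tswap t \in triples.
Proof.
case: t => [[x a] b]; rewrite !mem_triples /=.
move=> /and4P[/andP[ba bna] p -> ->]; rewrite !andbT; apply/andP; split.
  apply/andP; split; first by rewrite eq_sym.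
  by rewrite -(inj_eq oppr_inj) -!vnegE !vnegE opprK eq_sym -vnegE.
move: p; rewrite /plaq_in /= !andbT => /and4P[-> h2 h3 h4].
by rewrite h2 h4 !vaddE addrAC -!vaddE h3.
Qed.

Lemma trot4 t : trot (trot (trot (trot t))) = t.
Proof.
by case: t => [[x a] b]; rewrite /trot /= !vnegE !vaddE !opprK [_ + b - a]addrAC !addrK.
Qed.

Lemma tswapK t : tswap (tswap t) = t.
Proof. by case: t => [[x a] b]. Qed.

Lemma mk_trot t : mk (trot t) = rot 1 (mk t).
Proof.
case: t => [[x a] b]; rewrite /mk /trot /mkplaq /= /rot /= !vaddE !vnegE.
by rewrite [_ + b - a]addrAC addrK.
Qed.

Lemma mk_tswap t : mk (tswap t) = pinv (mk t).
Proof.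
case: t => [[x a] b]; rewrite /mk /tswap /mkplaq /pinv /= /rev /= /einv /= !vaddE.
by rewrite [_ + b + a]addrAC.
Qed.

(** A map of a finite set into itself with a left inverse permutes it. *)
Lemma perm_triples (h g : triple -> triple) : cancel h g ->
  (forall t, t \in triples -> h t \in triples) -> perm_eq (map h triples) triples.
Proof.
move=> hK hin; have uh : uniq (map h triples).
  by rewrite map_inj_uniq ?triples_uniq //; apply: can_inj hK.
apply: uniq_perm => //; first exact: triples_uniq.
apply: (uniq_min_size uh _ _).2; last by rewrite size_map.
by move=> t /mapP[t' t'T ->]; apply: hin.
Qed.

Lemma sum_triples (V : nmodType) (h g : triple -> triple) (P : pred triple) (F : triple -> V) :
  cancel h g -> (forall t, t \in triples -> h t \in triples) ->
  \sum_(t <- triples | P t) F (h t) = \sum_(t <- triples | P (g t)) F t.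
Proof.
move=> hK hin; rewrite -[RHS](perm_big _ (perm_triples hK hin)) big_map.
by apply: eq_bigl => t; rewrite hK.
Qed.

(** Smallest base vertex means that both steps are positive, and x + a second smallest means a < b;
    then x + a + b lies above x + a. *)
Lemma Pcond_mk t : t \in triples ->
  Pcond (mk t) = [&& pos t.1.2, pos t.2 & lexlt t.1.2 t.2].
Proof.
case: t => [[x a] b]; rewrite mem_triples /= => /and4P[/andP[ba bna] _ au bu].
have a0 : a != (0 : vec) by have /unitvecsP[i [s ->]] := au; apply: unitvec_neq0.
have b0 : b != (0 : vec) by have /unitvecsP[i [s ->]] := bu; apply: unitvec_neq0.
rewrite /Pcond /pverts /mk /mkplaq /= !vaddE !eqxx !andbT /= ?orbT /=.
have xE : x = (x : vec) + 0 by rewrite addr0.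
have e1 u : (((x : vec) + u) == x) = (u == (0 : vec)).
  by rewrite {2}xE (inj_eq (addrI _)).
have e2 u : lexlt x ((x : vec) + u) = pos u by rewrite {1}xE lexlt_add.
have e3 u v : ((x : vec) + u == (x : vec) + v) = (u == v) by rewrite (inj_eq (addrI _)).
have e4 : ((x : vec) + a + b == (x : vec) + a) = (b == (0 : vec)).
  by rewrite -{2}[(x : vec) + a]addr0 (inj_eq (addrI _)).
have e5 : lexlt ((x : vec) + a) ((x : vec) + a + b) = pos b.
  by rewrite -{1}[(x : vec) + a]addr0 lexlt_add.
have ab0 : ((a : vec) + b == 0) = false.
  by rewrite addrC addr_eq0 -vnegE (negPf bna).
rewrite e4 e5 -!addrA !e1 !e2 ?e3 !lexlt_add (negPf a0) (negPf b0) (negPf ba) ab0 /=.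
case pa: (pos a) => //=; case pb: (pos b) => //=; rewrite ?andbF //.
suff -> : pos ((a : vec) + b) by [].
by apply: lexlt_trans pa _; rewrite -{1}[a]addr0 lexlt_add.
Qed.

(** The signs of a and b single out one of the rotations (a, b), (b, -a), (-a, -b), (-b, a) with
    both steps positive; the order of its steps then chooses between it and its swap. *)
Lemma Pcond_orbit t : t \in triples -> (\sum_(i < 4) (Pcond (mk (iter i trot t)) : nat) +
  \sum_(i < 4) (Pcond (mk (tswap (iter i trot t))) : nat) = 1)%N.
Proof.
move=> tT; have i1 i : iter i trot t \in triples by elim: i => //= i; apply: trot_triples.
rewrite !big_ord_recr !big_ord0 /=.
have h := Pcond_mk; rewrite !h ?tswap_triples ?(i1 0) ?(i1 1) ?(i1 2) ?(i1 3) //=.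
move: tT; case: (t) => [[x a] b]; rewrite mem_triples /= => /and4P[/andP[ba bna] _ au bu].
have a0 : a != (0 : vec) by have /unitvecsP[i [s ->]] := au; apply: unitvec_neq0.
have b0 : b != (0 : vec) by have /unitvecsP[i [s ->]] := bu; apply: unitvec_neq0.
rewrite !vnegE !opprK !pos_neg //.
have n1 : a != b by rewrite eq_sym.
have n2 : b != - (a : vec) by rewrite -vnegE.
have n3 : - (a : vec) != - (b : vec) by rewrite (inj_eq oppr_inj).
have n4 : - (b : vec) != a by rewrite -(inj_eq oppr_inj) opprK.
rewrite (lexlt_neg n1) (lexlt_neg n2) (lexlt_neg n3) (lexlt_neg n4).
by case: (pos a); case: (pos b); case: (lexlt a b); case: (lexlt b _);
  case: (lexlt (- _) (- _)); case: (lexlt (- _) a).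
Qed.

(* each unit square has one representative in Pplus, and its eight rooted
   orientations are exactly the plaquettes of the square *)
Lemma sum_Pplus (V : nmodType) (F : seq edge -> V) :
  \sum_(p <- Pplus L) (\sum_(i < 4) F (rot i p) + \sum_(i < 4) F (rot i (pinv p))) =
  \sum_(p <- plaquettes L) F p.
Proof.
have Tr i t : t \in triples -> iter i trot t \in triples.
  by move=> tT; elim: i => //= i; apply: trot_triples.
have mkr i t : (i < 4)%N -> rot i (mk t) = mk (iter i trot t).
  elim: i => [_|i ih i4]; first by rewrite rot0.
  by rewrite rotS ?ih ?(ltnW i4) //= mk_trot.
have it4 i t : (i <= 4)%N -> iter (4 - i) trot (iter i trot t) = t.
  by move=> i4; rewrite -iterD subnK //= trot4.
have it4' i t : (i <= 4)%N -> iter i trot (iter (4 - i) trot t) = t.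
  by move=> i4; rewrite -iterD subnKC //= trot4.
rewrite /Pplus big_filter plaquettesE !big_map.
(* Reindexing by the inverse rotation turns a sum over [Pplus] into a sum over all triples weighted
   by an indicator; by [Pcond_orbit] the eight weights of a triple add up to 1. *)
have S1 (i : 'I_4) : \sum_(t <- triples | Pcond (mk t)) F (rot i (mk t)) =
    \sum_(t <- triples) F (mk t) *+ Pcond (mk (iter (4 - i) trot t)).
  under eq_bigr => t _ do rewrite mkr //.
  rewrite (sum_triples (h := iter i trot) (g := iter (4 - i) trot) (fun t => Pcond (mk t)) (fun t => F (mk t))).
  - by rewrite big_mkcond; apply: eq_bigr => t _; rewrite mulrb.
  - by move=> t; rewrite it4 // ltnW.
  - by move=> t; apply: Tr.
have S2 (i : 'I_4) : \sum_(t <- triples | Pcond (mk t)) F (rot i (pinv (mk t))) =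
    \sum_(t <- triples) F (mk t) *+ Pcond (mk (tswap (iter (4 - i) trot t))).
  under eq_bigr => t _ do rewrite -mk_tswap mkr //.
  rewrite (sum_triples (h := fun t => iter i trot (tswap t))
    (g := fun t => tswap (iter (4 - i) trot t)) (fun t => Pcond (mk t)) (fun t => F (mk t))).
  - by rewrite big_mkcond; apply: eq_bigr => t _; rewrite mulrb.
  - by move=> t; rewrite it4 ?tswapK // ltnW.
  - by move=> t tT; apply/Tr/tswap_triples.
rewrite big_split /= exchange_big [X in _ + X]exchange_big /=.
under eq_bigr => i _ do rewrite S1.
under [X in _ + X]eq_bigr => i _ do rewrite S2.
rewrite exchange_big [X in _ + X]exchange_big /= -big_split /=.
rewrite big_seq [RHS]big_seq; apply: eq_bigr => t tT.
rewrite !sumrMnr -mulrnDr -[RHS]mulr1n; congr (_ *+ _); rewrite -[RHS](Pcond_orbit tT).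
by rewrite !big_ord_recr !big_ord0 /= trot4 !add0n; lia.
Qed.

(** The square traversed backwards from the same edge: the plaquette e q becomes e^{-1} q^{-1}. *)
Definition trev t : triple := (vadd t.1.1 t.1.2, vneg t.1.2, t.2).

Lemma trevE t : trev t = iter 3 trot (tswap t).
Proof.
by case: t => [[x a] b]; rewrite /trev /trot /= !vnegE !vaddE opprK [_ + a - b]addrAC addrK.
Qed.

Lemma trevK : involutive trev.
Proof. by case=> [[x a] b]; rewrite /trev /= !vaddE !vnegE opprK addrK. Qed.

Lemma trev_triples t : t \in triples -> trev t \in triples.
Proof. by move=> tT; rewrite trevE /=; do 3!apply: trot_triples; apply: tswap_triples. Qed.

Lemma mk_trev t : head (e0 d) (mk (trev t)) = einv (head (e0 d) (mk t)) /\
  behead (mk (trev t)) = pinv (behead (mk t)).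
Proof.
by case: t => [[x a] b]; rewrite /trev /mk /mkplaq /pinv /rev /einv /= !vaddE !vnegE addrK.
Qed.

(** Plaquettes through the reversed edge enter the derivative of the action, while deformations are
    indexed by plaquettes starting with e itself. *)
Lemma sum_plaqs_from_einv (V : nmodType) e (F : seq edge -> V) :
  \sum_(p <- plaqs_from L (einv e)) F (behead p) =
  \sum_(p <- plaqs_from L e) F (pinv (behead p)).
Proof.
rewrite /plaqs_from !big_filter plaquettesE !big_map.
have e2 t : (head (e0 d) (mk t) == e) = (head (e0 d) (mk (trev t)) == einv e).
  by have [-> _] := mk_trev t; rewrite (inj_eq (can_inj (@einvK d))).
under [RHS]eq_bigl => t do rewrite e2.
under [RHS]eq_bigr => t _ do rewrite -(mk_trev t).2.
rewrite (sum_triples (h := trev) (g := trev) (fun t => head (e0 d) (mk (trev t)) == einv e)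
  (fun t => F (behead (mk t))) trevK trev_triples).
by apply: eq_bigl => t; rewrite trevK.
Qed.

Lemma plaquettes_nondeg p : p \in plaquettes L -> all (@nondeg d) p.
Proof.
rewrite plaquettesE => /mapP[[[x a] b]]; rewrite mem_triples /= => /and4P[_ _ au bu] ->.
have a0 : a != (0 : vec) by have /unitvecsP[i [s ->]] := au; apply: unitvec_neq0.
have b0 : b != (0 : vec) by have /unitvecsP[i [s ->]] := bu; apply: unitvec_neq0.
have h u v : v != (0 : vec) -> (u : vec) != u + v.
  by move=> v0; rewrite -{1}[u]addr0 (inj_eq (addrI _)) eq_sym.
rewrite /mk /mkplaq /= /nondeg /= !vaddE !andbT; apply/and4P; split; rewrite ?h //.
  by rewrite addrAC eq_sym h.
by rewrite eq_sym h.
Qed.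

Lemma plaquettes_size p : p \in plaquettes L -> size p = 4.
Proof. by rewrite plaquettesE => /mapP[t _ ->]. Qed.

Lemma is_edge_nondeg (e : edge) : is_edge e -> @nondeg d e.
Proof.
case: e => u v; rewrite /is_edge /nn /nondeg /= => /unitvecsP[i [s e]].
apply/eqP => uv; have /eqP := unitvec_neq0 i s; apply; rewrite -e uv vsubE subrr.
by [].
Qed.

End Plaquettes.

(** * Integration by parts *)

Section SchwingerDyson.
Variables (R : realType) (N d : nat) (k : gkind) (L : seq (vtx d)) (beta : R).
Local Notation C := R[i].
Local Notation mat := 'M[C]_N.
Local Notation edge := (edge d).
Local Notation config := (edge -> mat).
Variables (I : (mat -> C) -> C) (s : seq (seq edge)).
Hypotheses (N1 : (1 < N)%N) (hI : is_haar (inG k) I).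
Implicit Types (Q : config) (f e : edge) (X Y : mat) (F : config -> C).

(** The half comes from Re Tr Q_p = (W_p + W_{p^{-1}}) / 2. In this form the action is a sum of
    traces of words and is differentiated by the same rules as the loops. *)
Definition hbeta : C := N%:R * (beta%:C)%C / 2.
Definition action Q : C := hbeta * \sum_(p <- Pplus L) (Wl Q p + Wl Q (pinv p)).

Lemma Pplus_nondeg p : p \in Pplus L -> all (@nondeg d) p.
Proof. by rewrite mem_filter => /andP[_]; apply: plaquettes_nondeg. Qed.

Lemma Wl_pinv Q l : gval k Q -> all (@nondeg d) l -> Wl Q (pinv l) = (Wl Q l)^*.
Proof.
move=> gQ nl; rewrite /Wl (pathmx_pinv gQ nl) /adjmx mxtrace_tr /Defs.conjmx.
by rewrite -trace_map_mx.
Qed.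

Lemma actionE Q : gval k Q -> action Q =
  ((N%:R * beta * \sum_(p <- Pplus L) complex.Re (\tr (pathmx Q p)))%:C)%C.
Proof.
move=> gQ; rewrite /action.
have -> : \sum_(p <- Pplus L) (Wl Q p + Wl Q (pinv p)) =
    2 * ((\sum_(p <- Pplus L) complex.Re (\tr (pathmx Q p)))%:C)%C.
  rewrite rmorph_sum /= mulr_sumr big_seq [RHS]big_seq; apply: eq_bigr => p pP.
  by rewrite (Wl_pinv gQ (Pplus_nondeg pP)); exact: addcJ.
by rewrite /hbeta !rmorphM /= rmorph_nat; field.
Qed.

Lemma action_real Q : gval k Q -> action Q \is Num.real.
Proof. by move=> gQ; rewrite actionE //; apply/complex_realP; eexists. Qed.

Lemma weightE Q : gval k Q -> expRe (action Q) = weight L beta Q.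
Proof. by move=> gQ; rewrite actionE. Qed.

Definition others Q (P : pred nat) : C :=
  \prod_(j <- iota 0 (size s) | P j) Wl Q (lnth s j).
Definition dWs f X Q : C := \sum_(i <- iota 0 (size s))
  dWl f X Q (lnth s i) * others Q (fun j => j != i).
Definition ddWs f Y X Q : C := \sum_(i <- iota 0 (size s))
  (ddWl f Y X Q (lnth s i) * others Q (fun j => j != i) +
   dWl f Y Q (lnth s i) * \sum_(j <- iota 0 (size s) | j != i)
     dWl f X Q (lnth s j) * others Q (fun h => (h != i) && (h != j))).
Definition dS f X Q : C :=
  hbeta * \sum_(p <- Pplus L) (dWl f X Q p + dWl f X Q (pinv p)).
(** This is D_X (D_Y W_s exp S) divided by exp S. *)
Definition theta f Y X Q : C := ddWs f Y X Q + dWs f Y Q * dS f X Q.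

Section OneCurve.
Variables (f : edge) (g : C -> mat) (X : mat).
Hypotheses (pf : positive f) (gX : curve k g X).

Lemma difZ c F F' : dif k f g F F' -> dif k f g (fun Q => c * F Q) (fun Q => c * F' Q).
Proof.
move=> D; apply: (dif_ext gX) (difM (dif_cst k f g c) D) => Q _ //.
by rewrite mul0r add0r.
Qed.

Lemma dif_others (P : pred nat) : dif k f g (fun Q => others Q P)
  (fun Q => \sum_(j <- iota 0 (size s) | P j)
     dWl f X Q (lnth s j) * others Q (fun h => P h && (h != j))).
Proof.
exact: (dif_prod gX (F := fun j Q => Wl Q (lnth s j)) P (iota_uniq 0 (size s))
  (fun j => dif_Wl pf gX (lnth s j))).
Qed.

Lemma dif_action : dif k f g action (fun Q => dS f X Q).
Proof.
apply: difZ; apply: dif_sum => p; apply: difD; exact: dif_Wl.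
Qed.

Lemma dif_dWs Y : dif k f g (fun Q => dWs f Y Q) (fun Q => ddWs f Y X Q).
Proof.
apply: dif_sum => i; apply: difM; first exact: dif_dWl.
exact: dif_others.
Qed.

Lemma dif_test Y : dif k f g (fun Q => dWs f Y Q * weight L beta Q)
  (fun Q => theta f Y X Q * weight L beta Q).
Proof.
apply: (dif_ext gX) (difM (dif_dWs Y) (dif_expRe gX dif_action action_real)) => Q gQ.
  by rewrite weightE.
by rewrite weightE // /theta; ring.
Qed.

End OneCurve.

Lemma dQe_lin f a X Y Q e : dQe f (a *: X + Y) Q e = a *: dQe f X Q e + dQe f Y Q e.
Proof.
rewrite /dQe; case: (e == f); first by rewrite mulmxDl -scalemxAl.
case: (e == einv f); last by rewrite scaler0 addr0.
by rewrite mulmxDr -scalemxAr opprD scalerN.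
Qed.

Lemma d2Qe_lin f Z a X Y Q e :
  d2Qe f Z (a *: X + Y) Q e = a *: d2Qe f Z X Q e + d2Qe f Z Y Q e.
Proof.
rewrite /d2Qe; case: (e == f); first by rewrite mulmxDl mulmxDr -scalemxAl -scalemxAr.
case: (e == einv f); last by rewrite scaler0 addr0.
by rewrite mulmxDr mulmxDl -scalemxAr -scalemxAl.
Qed.

Lemma sum_lin (T : Type) (r : seq T) (P : pred T) (F G H : T -> C) (a : C) :
  (forall x, F x = a * G x + H x) ->
  \sum_(x <- r | P x) F x = a * (\sum_(x <- r | P x) G x) + \sum_(x <- r | P x) H x.
Proof. by move=> h; rewrite mulr_sumr -big_split; apply: eq_bigr. Qed.

Lemma dWl_lin f a X Y Q l : dWl f (a *: X + Y) Q l = a * dWl f X Q l + dWl f Y Q l.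
Proof.
by apply: sum_lin => x; rewrite dQe_lin mulmxDl -scalemxAl mxtraceD mxtraceZ.
Qed.

Lemma ddWl_lin f Z a X Y Q l :
  ddWl f Z (a *: X + Y) Q l = a * ddWl f Z X Q l + ddWl f Z Y Q l.
Proof.
apply: sum_lin => x; rewrite d2Qe_lin mulmxDl -scalemxAl mxtraceD mxtraceZ.
pose S W := \sum_(y <- iota 0 (size l) | x != y) \tr (dQe f Z Q (enth l x) *m
  pathmx Q (segb l x y) *m dQe f W Q (enth l y) *m pathmx Q (segc l x y)).
have h : S (a *: X + Y) = a * S X + S Y.
  apply: sum_lin => y.
  by rewrite dQe_lin mulmxDr mulmxDl -scalemxAr -scalemxAl mxtraceD mxtraceZ.
by rewrite -!/(S _) h mulrDr addrACA.
Qed.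

(** The formula makes sense for every complex matrix X, although only anti-Hermitian ones come from
    curves; this linearity is what [casbas_ind] exploits. *)
Lemma theta_lin f Z a X Y Q :
  theta f Z (a *: X + Y) Q = a * theta f Z X Q + theta f Z Y Q.
Proof.
have dl : dS f (a *: X + Y) Q = a * dS f X Q + dS f Y Q.
  pose S W := \sum_(p <- Pplus L) (dWl f W Q p + dWl f W Q (pinv p)).
  have h : S (a *: X + Y) = a * S X + S Y.
    by apply: sum_lin => p; rewrite !dWl_lin mulrDr addrACA.
  by rewrite /dS -!/(S _) h mulrDr mulrCA.
have ddl : ddWs f Z (a *: X + Y) Q = a * ddWs f Z X Q + ddWs f Z Y Q.
  apply: sum_lin => i; rewrite ddWl_lin.
  pose S W := \sum_(j <- iota 0 (size s) | j != i)
    dWl f W Q (lnth s j) * others Q (fun h => (h != i) && (h != j)).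
  have h : S (a *: X + Y) = a * S X + S Y.
    by apply: sum_lin => j; rewrite dWl_lin mulrDl mulrA.
  by rewrite -!/(S _) h; move: (ddWl _ _ _ _ _) (ddWl _ _ _ _ _) (dWl _ _ _ _) (S X) (S Y)
    => p q r u v; ring.
rewrite /theta dl ddl; move: (ddWs f Z X Q) (ddWs f Z Y Q) (dWs f Z Q) (dS f X Q) (dS f Y Q).
by move=> p q r u v; ring.
Qed.

Local Notation Q0 := (Q0 R N (d := d)).
Local Notation J F := (intg I (EplusL L) F Q0).

(** Regularity is bundled with the vanishing because the integral is known to be linear only on
    Lipschitz functions. *)
Definition null F := lip k F /\ J F = 0.

Lemma null_ext F F' : (forall Q, gval k Q -> F Q = F' Q) -> null F -> null F'.
Proof.
move=> h [l z]; split; first exact: lip_ext l.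
by rewrite -(intg_eq hI (EplusL L) (@gval_Q0 _ _ _ _) l h).
Qed.

Lemma null_lin c F F' : null F -> null F' -> null (fun Q => F Q + c * F' Q).
Proof.
move=> [l z] [l' z']; split; first exact: lip_lin.
by rewrite (intg_lin hI _ _ (@gval_Q0 _ _ _ _) l l') z z' mulr0 addr0.
Qed.

Lemma null0 : null (fun=> 0).
Proof.
have l0 := lip_cst N d k (0 : C).
have z0 := intg_lin hI (EplusL L) (-1) (@gval_Q0 _ _ _ _) l0 l0.
have e : (fun _ : config => 0 + -1 * 0 : C) = fun=> 0.
  by apply/funext => Q; rewrite mulr0 addr0.
by split=> //; rewrite e in z0; rewrite z0 mulN1r subrr.
Qed.

Lemma null_sum (T : eqType) (r : seq T) (F : T -> config -> C) :
  (forall a, a \in r -> null (F a)) -> null (fun Q => \sum_(a <- r) F a Q).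
Proof.
elim: r => [_|a r ih h]; first by apply: null_ext null0 => Q _; rewrite big_nil.
have n1 := h a (mem_head _ _).
have n2 := ih (fun b br => h b (mem_behead (s := a :: r) br)).
by apply: null_ext (null_lin 1 n1 n2) => Q _; rewrite big_cons mul1r.
Qed.

Lemma null_theta f Y i j : f \in EplusL L ->
  null (fun Q => theta f Y (casbas R k i j) Q * weight L beta Q).
Proof.
move=> fL; have pf : positive f by move: fL; rewrite mem_filter => /andP[/andP[]].
apply: (@casbas_ind R N k (fun X => null (fun Q => theta f Y X Q * weight L beta Q))).
- exact: N1.
(* Linearity with coefficient -1 at X = Y = 0 shows that [theta] vanishes there. *)
- apply: null_ext null0 => Q _; have := theta_lin f Y (-1) 0 0 Q.
  by rewrite scaler0 addr0 mulN1r addNr => ->; rewrite mul0r.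
- move=> a X Z nX nZ; apply: null_ext (null_lin a nZ nX) => Q _.
  rewrite (theta_lin f Y a X Z Q).
  move: (theta f Y X Q) (theta f Y Z Q) (weight L beta Q) => x z w; ring.
- move=> g X gX; have D := dif_test pf gX Y; have [_ l' _] := D; split; first exact: l'.
  by apply: (intg_dif gX hI D fL); apply: gval_Q0.
Qed.

(* Integrated over the Lie algebra basis and over the edges of the box, the
   integration by parts formula becomes one scalar identity. *)
Lemma schwinger_dyson : null (fun Q =>
  (\sum_(f <- EplusL L) cassum k (fun Y X => theta f Y X Q)) * weight L beta Q).
Proof.
have n : null (fun Q => \sum_(f <- EplusL L) \sum_i \sum_j
    theta f (casbas R k j i) (casbas R k i j) Q * weight L beta Q).
  apply: null_sum => f fL; apply: null_sum => i _; apply: null_sum => j _.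
  exact: null_theta.
apply: null_ext (null_lin (casnorm R k) null0 n) => Q _.
rewrite add0r mulr_suml mulr_sumr; apply: eq_bigr => f _.
rewrite /cassum -mulrA; congr (_ * _); rewrite mulr_suml; apply: eq_bigr => i _.
by rewrite mulr_suml.
Qed.

End SchwingerDyson.

(** * Loop operations *)

Local Notation same := Defs.same.
Local Notation opp := Defs.opp.

Section LoopOperations.
Variables (R : realType) (N d : nat) (k : gkind) (L : seq (vtx d)).
Local Notation C := R[i].
Local Notation mat := 'M[C]_N.
Local Notation edge := (edge d).
Hypothesis N0 : (0 < N)%N.
Variable Q : edge -> mat.
Hypothesis gQ : gval k Q.
Implicit Types (e : edge) (l b c q : seq edge) (X Y : mat) (x y : nat).
Local Notation es := (EplusL L).
Local Notation W := (Wl Q).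
Local Notation o := (orth R k).
Local Notation kp := (kap R N k).

(** The edge, in one of its orientations, is an integrated variable. *)
Definition inbox e := nondeg e && (absedge e \in es).
Definition good l := all inbox l.

Lemma EplusL_uniq : uniq es.
Proof.
by apply: filter_uniq; apply: allpairs_uniq; rewrite ?undup_uniq // => -[? ?] [? ?].
Qed.

Lemma EplusL_pos : {in es, forall e, positive e}.
Proof. by move=> e; rewrite mem_filter => /andP[/andP[]]. Qed.

Lemma good_nondeg l : good l -> all (@nondeg d) l.
Proof. by apply: sub_all => e /andP[]. Qed.

Lemma pinvK : involutive (@Defs.pinv d).
Proof.
move=> l; rewrite /Defs.pinv map_rev revK -map_comp -[RHS]map_id.
by apply: eq_map => e; rewrite /= einvK.
Qed.

Lemma pinv_cat b c : pinv (b ++ c) = pinv c ++ pinv b.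
Proof. by rewrite /Defs.pinv map_cat rev_cat. Qed.

Lemma pinv_cons e c : pinv (e :: c) = pinv c ++ [:: einv e].
Proof. by rewrite -cat1s pinv_cat. Qed.

Lemma all_rot (P : pred edge) x l : all P (rot x l) = all P l.
Proof. by apply: eq_all_r => e; rewrite mem_rot. Qed.

Lemma rot_seg l x y : (x < size l)%N -> (y < size l)%N -> x != y ->
  rot x l = enth l x :: segb l x y ++ enth l y :: segc l x y.
Proof.
move=> xl yl xy; rewrite rot_rest //; congr (_ :: _); rewrite /segb /segc.
(* The cyclic distance from x to y, strictly between 0 and the length because x and y differ. *)
set h := ((_ + _ - _) %% _)%N.
have [h0 hn hE] : [/\ (0 < h)%N, (h < size l)%N & enth l y = enth (rest l x) h.-1].
  have hE : h = if (x < y)%N then (y - x)%N else (y + size l - x)%N.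
    rewrite /h; case: (ltnP x y) => hxy; last by rewrite modn_small //; lia.
    have -> : (y + size l - x)%N = (y - x + size l)%N by lia.
    by rewrite modnDr modn_small //; lia.
  split; [by rewrite hE; case: (ltnP x y) => ?; lia | by rewrite hE; case: (ltnP x y) => ?; lia |].
  rewrite /enth rest_drop // nth_cat size_drop hE; case: (ltnP x y) => hxy.
    by rewrite ifT ?nth_drop; [congr nth|]; lia.
  by rewrite ifF ?nth_take; [congr nth|..]; lia.
rewrite -/(rest l x) -{1}(cat_take_drop h.-1 (rest l x)); congr (_ ++ _).
rewrite (drop_nth (e0 d)) ?size_rest; last by lia.
rewrite prednK // -/(enth _ _) -hE; congr (_ :: _).
by rewrite rot_rest.
Qed.

Lemma W_red c : all (@nondeg d) c -> W (red c) = W c.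
Proof. exact: Wl_red. Qed.

(** A trace is invariant under transposition, which reverses words on SO(N). *)
Lemma orth_rev c : all (@nondeg d) c -> o * W (pinv c) = o * W c.
Proof.
move=> nc; have := orth_tr gQ 1%:M nc.
by rewrite !mul1mx mxtrace_tr /Wl => ->.
Qed.

Lemma W_catC b c : W (b ++ c) = W (c ++ b).
Proof. exact: Wl_cat. Qed.

Definition sg e e' : C := (same e e')%:R - (opp e e')%:R.

Lemma same_opp e : nondeg e -> (opp e e = false) * (same e (einv e) = false).
Proof.
move=> ne; split; first exact: nondeg_neq_einv.
by rewrite /Defs.same eq_sym nondeg_neq_einv.
Qed.

(** Contracting two locations of one trace splits it; the o term is the twisting, and the kappa term
    is the loop itself with the sign of the relative orientation. *)
Lemma con2_ops l x y : good l -> (x < size l)%N -> (y < size l)%N -> x != y ->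
  con2 k Q es (enth l x) (enth l y) (pathmx Q (segb l x y)) (pathmx Q (segc l x y)) =
  (same (enth l x) (enth l y))%:R * (Ws Q (pos_split l x y) - o * W (neg_twist l x y))
  - (opp (enth l x) (enth l y))%:R * (Ws Q (neg_split l x y) - o * W (pos_twist l x y))
  - kp * sg (enth l x) (enth l y) * W l.
Proof.
move=> gl xl yl xy; have rE := rot_seg xl yl xy.
rewrite -(Wl_rot Q l x) rE /pos_split /neg_twist /neg_split /pos_twist.
have : good (rot x l) by rewrite /good all_rot.
rewrite rE /good /= all_cat /= => /and4P[/andP[ne ae] gb _ gc].
have nb := good_nondeg gb; have nc := good_nondeg gc.
move: {rE} (enth l x) (enth l y) (segb l x y) (segc l x y) ne ae nb nc {gb gc}.
move=> e e' b c ne ae nb nc.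
rewrite /Ws !big_cons !big_nil !mulr1 /sg.
have [->|he] := eqVneq e' e.
  rewrite (con2_same N0 gQ EplusL_uniq EplusL_pos ne ae) same2_words //.
  rewrite (same_opp ne).1 /Defs.same eqxx !W_red /= ?all_cat /= ?all_nondeg_pinv ?nondeg_einv ?ne ?nb ?nc //.
  (* The contraction produces b c^{-1} and the twisting is b^{-1} c: cyclically these are inverse
     words, of equal trace on SO(N). *)
  have -> : o * W (b ++ pinv c) = o * W (pinv b ++ c).
    rewrite -orth_rev ?all_cat ?all_nondeg_pinv ?nb ?nc //.
    by rewrite pinv_cat pinvK W_catC.
  rewrite (W_catC b [:: e]) /=.
  move: (W _) (W _) (W _) (W _) => p1 p2 p3 p4; rewrite /=; ring.
have [->|hi] := eqVneq e' (einv e).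
  rewrite (con2_opp N0 gQ EplusL_uniq EplusL_pos ne ae) opp2_words //.
  rewrite (same_opp ne).2 /Defs.opp eqxx !W_red /= ?all_cat /= ?all_nondeg_pinv ?nondeg_einv ?ne ?nb ?nc //.
  have -> : o * W (e :: b ++ einv e :: pinv c) = o * W (e :: pinv b ++ einv e :: c).
    rewrite -orth_rev /= ?all_cat /= ?all_nondeg_pinv ?nb ?nc ?nondeg_einv ?ne //.
    by rewrite pinv_cons pinv_cat pinv_cons pinvK einvK -!catA (W_catC c) /= -!catA.
  move: (W b) (W c) (W (_ :: _)) (W (_ :: _)) => p1 p2 p3 p4; rewrite /=; ring.
have -> : con2 k Q es e e' (pathmx Q b) (pathmx Q c) = 0.
  by apply: con2_other => //; [exact: EplusL_uniq|exact: EplusL_pos].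
rewrite /Defs.same /Defs.opp (negPf he) (negPf hi) /=.
by rewrite !mul0r subrr mulr0 mul0r !subr0.
Qed.

(** Locations in different traces fuse them, which is a merger; the o term is the merger of the
    other sign, and the kappa term leaves both loops unchanged. *)
Lemma con1_ops l l' x y : good l -> good l' -> (x < size l)%N -> (y < size l')%N ->
  con1 k Q es (enth l x) (enth l' y) (pathmx Q (rest l x)) (pathmx Q (rest l' y)) =
  (same (enth l x) (enth l' y))%:R * (W (merge_pos l l' x y) - o * W (merge_neg l l' x y))
  - (opp (enth l x) (enth l' y))%:R * (W (merge_neg l l' x y) - o * W (merge_pos l l' x y))
  - kp * sg (enth l x) (enth l' y) * (W l * W l').
Proof.
move=> gl gl' xl yl'.
rewrite -(Wl_rot Q l x) -(Wl_rot Q l' y) (rot_rest xl) (rot_rest yl').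
rewrite /merge_pos /merge_neg -!/(rest _ _).
have := gl; rewrite /good -(all_rot inbox x) rot_rest //= => /andP[/andP[ne ae] gb].
have := gl'; rewrite /good -(all_rot inbox y) rot_rest //= => /andP[_ gc].
have nb := good_nondeg gb; have nc := good_nondeg gc.
move: (enth l x) (enth l' y) (rest l x) (rest l' y) ne ae nb nc {gb gc}.
move=> e e' b c ne ae nb nc; rewrite /sg.
have [->|he] := eqVneq e' e.
  rewrite (con1_same N0 gQ EplusL_uniq EplusL_pos ne ae) same1_words //.
  rewrite (same_opp ne).1 /Defs.same eqxx !W_red /= ?all_cat /= ?all_nondeg_pinv ?nondeg_einv ?ne ?nb ?nc //.
  rewrite (W_catC (pinv c)) -(W_catC (e :: b) (e :: c)) /=.
  move: (W _) (W _) (W _) (W _) => p1 p2 p3 p4; rewrite /=; ring.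
have [->|hi] := eqVneq e' (einv e).
  rewrite (con1_opp N0 gQ EplusL_uniq EplusL_pos ne ae) opp1_words //.
  rewrite (same_opp ne).2 /Defs.opp eqxx.
  rewrite !W_red /= ?all_cat /= ?all_nondeg_pinv ?nondeg_einv ?ne ?nb ?nc //.
  rewrite (W_catC c) -(W_catC (e :: b) (e :: pinv c)) /=.
  move: (W _) (W _) (W _) (W _) => p1 p2 p3 p4; rewrite /=; ring.
have -> : con1 k Q es e e' (pathmx Q b) (pathmx Q c) = 0.
  by apply: con1_other => //; [exact: EplusL_uniq|exact: EplusL_pos].
rewrite /Defs.same /Defs.opp (negPf he) (negPf hi) /=.
by rewrite !mul0r subrr mulr0 mul0r !subr0.
Qed.

(** Plaquettes starting with e or e^{-1} contribute, and the latter are re-indexed by plaquettes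
    starting with e. Each kind yields one deformation directly and the other through its o term,
    whence the factor 1 + o. The kappa term detaches the plaquette, which is an expansion. *)
Lemma con1_plaq l x : good l -> (x < size l)%N ->
  \sum_(p <- plaquettes L) con1 k Q es (enth l x) (head (e0 d) p)
     (pathmx Q (rest l x)) (pathmx Q (behead p)) =
  (1 + o) * (\sum_(p <- plaqs_from L (enth l x)) W (def_pos l x p)
             - \sum_(p <- plaqs_from L (enth l x)) W (def_neg l x p))
  - kp * W l * (\sum_(p <- plaqs_from L (enth l x)) W p
                - \sum_(p <- plaqs_from L (einv (enth l x))) W p).
Proof.
move=> gl xl; rewrite -(Wl_rot Q l x) (rot_rest xl) /def_pos /def_neg -!/(rest _ _).
have := gl; rewrite /good -(all_rot inbox x) rot_rest //= => /andP[/andP[ne ae] gb].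
have nb := good_nondeg gb.
move: (enth l x) (rest l x) ne ae nb {gb} => e b ne ae nb.
have step p : p \in plaquettes L ->
  con1 k Q es e (head (e0 d) p) (pathmx Q b) (pathmx Q (behead p)) =
  (if head (e0 d) p == e then W (e :: b ++ e :: behead p) - kp * (W (e :: b) * W p)
     - o * W (b ++ pinv (behead p)) else 0)
  - (if head (e0 d) p == einv e then (W (b ++ behead p)
     - o * W (e :: b ++ e :: pinv (behead p))) - kp * (W (e :: b) * W p) else 0).
  move=> pL; have := plaquettes_nondeg pL; have := plaquettes_size pL.
  case: p pL => [//|e' q] _ _ /= /andP[_ nq].
  have [->|he] := eqVneq e' e.
    rewrite nondeg_neq_einv // subr0.
    by rewrite (con1_same N0 gQ EplusL_uniq EplusL_pos ne ae) same1_words.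
  have [->|hi] := eqVneq e' (einv e).
    rewrite (con1_opp N0 gQ EplusL_uniq EplusL_pos ne ae) opp1_words // sub0r.
    by congr (- _); rewrite addrAC.
  by rewrite subr0; apply: con1_other => //; [exact: EplusL_uniq|exact: EplusL_pos].
rewrite big_seq (eq_bigr _ step) -big_seq sumrB -!big_mkcond -!(big_filter (plaquettes L)).
rewrite -/(plaqs_from L e) -/(plaqs_from L (einv e)) [X in _ - X]sumrB.
rewrite (sum_plaqs_from_einv L e (fun q => W (b ++ q) - o * W (e :: b ++ e :: pinv q))).
have nqs p : p \in plaqs_from L e -> all (@nondeg d) (behead p).
  rewrite mem_filter => /andP[_] /plaquettes_nondeg.
  by case: p => //= e' q /andP[].
have eD : \sum_(p <- plaqs_from L e) W (red (e :: behead p ++ e :: b)) =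
   \sum_(p <- plaqs_from L e) W (e :: b ++ e :: behead p).
  rewrite big_seq [RHS]big_seq; apply: eq_bigr => p /nqs nq.
  by rewrite W_red /= ?all_cat /= ?ne ?nq ?nb // -cat_cons W_catC.
have eD' : \sum_(p <- plaqs_from L e) W (red (pinv (behead p) ++ b)) =
   \sum_(p <- plaqs_from L e) W (b ++ pinv (behead p)).
  rewrite big_seq [RHS]big_seq; apply: eq_bigr => p /nqs nq.
  by rewrite W_red ?all_cat ?all_nondeg_pinv ?nq ?nb // W_catC.
rewrite eD eD' !sumrB -!mulr_sumr.
under [X in _ - (_ - o * X - _)]eq_bigr => p _ do rewrite pinvK.
move: (\sum_(p <- _) _) (\sum_(p <- _) _) (\sum_(p <- _) _) (\sum_(p <- _) _) => p1 p2 p3 p4.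
by move: (W _) => p5; ring.
Qed.

End LoopOperations.

Section LoopSums.
Variables (d : nat).
Local Notation edge := (edge d).
Variable V : nzRingType.

Lemma sum_locpairs (P : edge -> edge -> bool) (l : seq edge) (F : nat -> nat -> V) :
  \sum_(x <- iota 0 (size l)) \sum_(y <- iota 0 (size l) | x != y)
    (P (enth l x) (enth l y))%:R * F x y = \sum_(xy <- locpairs P l) F xy.1 xy.2.
Proof.
rewrite /locpairs big_filter [RHS]big_mkcond [RHS]big_allpairs_dep /=; apply: eq_bigr => x _.
rewrite [LHS]big_mkcond; apply: eq_bigr => y _.
by case: (x != y); case: (P _ _); rewrite /= ?mul1r ?mul0r.
Qed.

Lemma sum_locpairs2 (P : edge -> edge -> bool) (l l' : seq edge) (F : nat -> nat -> V) :
  \sum_(x <- iota 0 (size l)) \sum_(y <- iota 0 (size l'))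
    (P (enth l x) (enth l' y))%:R * F x y = \sum_(xy <- locpairs2 P l l') F xy.1 xy.2.
Proof.
rewrite /locpairs2 big_filter [RHS]big_mkcond [RHS]big_allpairs_dep /=; apply: eq_bigr => x _.
apply: eq_bigr => y _.
by case: (P _ _); rewrite /= ?mul1r ?mul0r.
Qed.

Lemma sum_ijpairs (s : seq (seq edge)) (F : nat -> nat -> V) :
  \sum_(i <- iota 0 (size s)) \sum_(j <- iota 0 (size s) | j != i) F i j =
  \sum_(ij <- ijpairs s) F ij.1 ij.2.
Proof.
rewrite /ijpairs big_filter [RHS]big_mkcond [RHS]big_allpairs_dep /=; apply: eq_bigr => x _.
by rewrite [LHS]big_mkcond; apply: eq_bigr => y _; rewrite eq_sym.
Qed.

End LoopSums.

(** * The loop equation before integration, at a fixed configuration *)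

Section PointwiseIdentity.
Variables (R : realType) (N d : nat) (k : gkind) (L : seq (vtx d)) (beta : R).
Local Notation C := R[i].
Local Notation mat := 'M[C]_N.
Local Notation edge := (edge d).
Hypothesis N0 : (0 < N)%N.
Variable Q : edge -> mat.
Hypothesis gQ : gval k Q.
Implicit Types (e : edge) (l b c q : seq edge) (X Y : mat) (x y : nat).
Local Notation es := (EplusL L).
Local Notation W := (Wl Q).
Local Notation o := (orth R k).
Local Notation kp := (kap R N k).
Local Notation hb := (hbeta N beta).
Local Notation sg := (@sg R d).

Definition csum (F : edge -> mat -> mat -> C) : C := \sum_(f <- es) cassum k (F f).

Lemma eq_csum F F' : (forall f Y X, F f Y X = F' f Y X) -> csum F = csum F'.
Proof. by move=> h; apply: eq_bigr => f _; apply: eq_cassum. Qed.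

Lemma csumD F F' : csum (fun f Y X => F f Y X + F' f Y X) = csum F + csum F'.
Proof. by rewrite /csum -big_split; apply: eq_bigr => f _; rewrite cassumD. Qed.

Lemma csum_sum (T : Type) (r : seq T) (P : pred T) (F : T -> edge -> mat -> mat -> C) :
  csum (fun f Y X => \sum_(a <- r | P a) F a f Y X) = \sum_(a <- r | P a) csum (F a).
Proof.
rewrite /csum exchange_big; apply: eq_bigr => f _.
exact: (cassum_sum k r P (fun a => F a f)).
Qed.

Lemma csumM (c : C) F : csum (fun f Y X => c * F f Y X) = c * csum F.
Proof. by rewrite /csum mulr_sumr; apply: eq_bigr => f _; rewrite cassumM. Qed.

Lemma csumMr (c : C) F : csum (fun f Y X => F f Y X * c) = csum F * c.
Proof. by rewrite /csum mulr_suml; apply: eq_bigr => f _; rewrite cassumMr. Qed.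

(** Differentiating p at each of its four locations amounts to rotating p and differentiating the
    first edge. By [sum_Pplus] the rotations of p and p^{-1} run through all rooted plaquettes, the
    index set of deformations and expansions. *)
Lemma dSE f X : dS L beta f X Q = hb * \sum_(p <- plaquettes L)
  \tr (dQe f X Q (head (e0 d) p) *m pathmx Q (behead p)).
Proof.
pose T p := \tr (dQe f X Q (head (e0 d) p) *m pathmx Q (behead p)).
rewrite /dS -!/(T _) -(sum_Pplus L T).
congr (_ * _); rewrite big_seq [RHS]big_seq; apply: eq_bigr => p pP.
have rotE q : size q = 4%N -> dWl f X Q q = \sum_(i < 4) T (rot i q).
  move=> sq; pose t i := \tr (dQe f X Q (enth q i) *m pathmx Q (rest q i)).
  have Tt i : (i < 4)%N -> T (rot i q) = t i by move=> i4; rewrite /T rot_rest ?sq.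
  rewrite !big_ord_recr big_ord0 /= !Tt // /dWl sq -/(t _) 4!big_cons big_nil.
  by rewrite add0r addr0 !addrA.
have sp : size p = 4%N by move: pP; rewrite mem_filter => /andP[_]; apply: plaquettes_size.
by rewrite !rotE // /Defs.pinv size_rev size_map.
Qed.

Lemma csum_ddWl l : csum (fun f Y X => ddWl f Y X Q l) =
  \sum_(x <- iota 0 (size l)) (con0 k Q es (enth l x) (pathmx Q (rest l x)) +
    \sum_(y <- iota 0 (size l) | x != y)
      con2 k Q es (enth l x) (enth l y) (pathmx Q (segb l x y)) (pathmx Q (segc l x y))).
Proof.
rewrite /ddWl csum_sum; apply: eq_bigr => x _; rewrite csumD; congr (_ + _).
exact: csum_sum.
Qed.

Lemma csum_dWl2 l l' : csum (fun f Y X => dWl f Y Q l * dWl f X Q l') =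
  \sum_(x <- iota 0 (size l)) \sum_(y <- iota 0 (size l'))
    con1 k Q es (enth l x) (enth l' y) (pathmx Q (rest l x)) (pathmx Q (rest l' y)).
Proof.
transitivity (csum (fun f Y X => \sum_(x <- iota 0 (size l)) \sum_(y <- iota 0 (size l'))
   \tr (dQe f Y Q (enth l x) *m pathmx Q (rest l x)) *
   \tr (dQe f X Q (enth l' y) *m pathmx Q (rest l' y)))).
  by apply: eq_csum => f Y X; rewrite /dWl big_distrlr.
rewrite csum_sum; apply: eq_bigr => x _; exact: csum_sum.
Qed.

Lemma csum_dWl_dS l : csum (fun f Y X => dWl f Y Q l * dS L beta f X Q) =
  hb * \sum_(x <- iota 0 (size l)) \sum_(p <- plaquettes L)
    con1 k Q es (enth l x) (head (e0 d) p) (pathmx Q (rest l x)) (pathmx Q (behead p)).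
Proof.
transitivity (csum (fun f Y X => hb *
  (\sum_(x <- iota 0 (size l)) \sum_(p <- plaquettes L)
   \tr (dQe f Y Q (enth l x) *m pathmx Q (rest l x)) *
   \tr (dQe f X Q (head (e0 d) p) *m pathmx Q (behead p))))).
  by apply: eq_csum => f Y X; rewrite dSE mulrCA /dWl big_distrlr.
rewrite csumM; congr (_ * _).
rewrite csum_sum; apply: eq_bigr => x _; exact: csum_sum.
Qed.

Definition sgself l : C := \sum_(x <- iota 0 (size l))
  \sum_(y <- iota 0 (size l) | x != y) sg (enth l x) (enth l y).
Definition sgpair l l' : C := \sum_(x <- iota 0 (size l))
  \sum_(y <- iota 0 (size l')) sg (enth l x) (enth l' y).

(** The diagonal terms carry the Casimir scalar of [con0E]; ordered pairs of distinct locations give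
    the operations on a single loop. *)
Lemma loop_laplacian l : good L l -> csum (fun f Y X => ddWl f Y X Q l) =
  (N%:R - kp - o) * (size l)%:R * W l
  + \sum_(xy <- locpairs (@Defs.same d) l) (Ws Q (pos_split l xy.1 xy.2) - o * W (neg_twist l xy.1 xy.2))
  - \sum_(xy <- locpairs (@Defs.opp d) l) (Ws Q (neg_split l xy.1 xy.2) - o * W (pos_twist l xy.1 xy.2))
  - kp * sgself l * W l.
Proof.
move=> gl; rewrite csum_ddWl.
rewrite -(sum_locpairs _ _ (fun x y => Ws Q (pos_split l x y) - o * W (neg_twist l x y))).
rewrite -(sum_locpairs _ _ (fun x y => Ws Q (neg_split l x y) - o * W (pos_twist l x y))).
have -> : kp * sgself l * W l = \sum_(x <- iota 0 (size l))
    \sum_(y <- iota 0 (size l) | x != y) kp * sg (enth l x) (enth l y) * W l.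
  rewrite -mulrA /sgself [_ * W l]mulr_suml mulr_sumr; apply: eq_bigr => x _.
  by rewrite [_ * W l]mulr_suml mulr_sumr; apply: eq_bigr => y _; rewrite mulrA.
rewrite -mulrA; have -> : (size l)%:R * W l = \sum_(x <- iota 0 (size l)) W l.
  by rewrite big_const_seq count_predT size_iota iter_addr_0 mulr_natl.
rewrite [(_ - _ - _) * _]mulr_sumr -big_split -!sumrB big_seq [RHS]big_seq.
apply: eq_bigr => x; rewrite mem_iota add0n /= => xl.
have := gl; rewrite /good -(all_rot _ x) rot_rest //= => /andP[/andP[ne ae] _].
have -> : con0 k Q es (enth l x) (pathmx Q (rest l x)) = (N%:R - kp - o) * W l.
  rewrite con0E //; try exact: EplusL_uniq; try exact: EplusL_pos.
  by rewrite -(Wl_rot Q l x) rot_rest.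
rewrite -!addrA; congr (_ + _); rewrite !addrA -!sumrB big_seq_cond [RHS]big_seq_cond.
apply: eq_bigr => y; rewrite mem_iota add0n /= => /andP[yl xy].
exact: con2_ops.
Qed.

Lemma loop_gradient l l' : good L l -> good L l' ->
  csum (fun f Y X => dWl f Y Q l * dWl f X Q l') =
  \sum_(xy <- locpairs2 (@Defs.same d) l l')
    (W (merge_pos l l' xy.1 xy.2) - o * W (merge_neg l l' xy.1 xy.2))
  - \sum_(xy <- locpairs2 (@Defs.opp d) l l')
    (W (merge_neg l l' xy.1 xy.2) - o * W (merge_pos l l' xy.1 xy.2))
  - kp * sgpair l l' * (W l * W l').
Proof.
move=> gl gl'; rewrite csum_dWl2.
rewrite -(sum_locpairs2 _ _ _ (fun x y => W (merge_pos l l' x y) - o * W (merge_neg l l' x y))).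
rewrite -(sum_locpairs2 _ _ _ (fun x y => W (merge_neg l l' x y) - o * W (merge_pos l l' x y))).
have -> : kp * sgpair l l' * (W l * W l') = \sum_(x <- iota 0 (size l))
    \sum_(y <- iota 0 (size l')) kp * sg (enth l x) (enth l' y) * (W l * W l').
  rewrite -mulrA /sgpair [_ * (W l * W l')]mulr_suml mulr_sumr; apply: eq_bigr => x _.
  by rewrite [_ * (W l * W l')]mulr_suml mulr_sumr; apply: eq_bigr => y _; rewrite mulrA.
rewrite -!sumrB big_seq [RHS]big_seq.
apply: eq_bigr => x; rewrite mem_iota add0n /= => xl.
rewrite -!sumrB big_seq [RHS]big_seq.
apply: eq_bigr => y; rewrite mem_iota add0n /= => yl.
exact: con1_ops.
Qed.

Lemma loop_action l : good L l -> csum (fun f Y X => dWl f Y Q l * dS L beta f X Q) =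
  hb * \sum_(x <- iota 0 (size l))
  ((1 + o) * (\sum_(p <- plaqs_from L (enth l x)) W (def_pos l x p)
             - \sum_(p <- plaqs_from L (enth l x)) W (def_neg l x p))
  - kp * W l * (\sum_(p <- plaqs_from L (enth l x)) W p
                - \sum_(p <- plaqs_from L (einv (enth l x))) W p)).
Proof.
move=> gl; rewrite csum_dWl_dS; congr (_ * _); rewrite big_seq [RHS]big_seq.
by apply: eq_bigr => x; rewrite mem_iota add0n /= => xl; apply: con1_plaq.
Qed.

Variable s : seq (seq edge).
Hypothesis gs : forall l, l \in s -> good L l.
Local Notation oth := (others s Q).
Local Notation SW set := (\sum_(s' <- set) Ws Q s').
Local Notation n := (size s).

Lemma Ws_nth : Ws Q s = \prod_(j <- iota 0 n) W (lnth s j).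
Proof. by rewrite /Ws -{1}(mkseq_nth [::] s) big_map. Qed.

Lemma Ws_others i : (i < n)%N -> Ws Q s = W (lnth s i) * oth (fun j => j != i).
Proof.
move=> i_n; rewrite Ws_nth /others -(bigD1_seq i) ?iota_uniq //.
by rewrite mem_iota add0n.
Qed.

Lemma Ws_cat (r r' : seq (seq edge)) : Ws Q (r ++ r') = Ws Q r * Ws Q r'.
Proof. exact: big_cat. Qed.

Lemma Ws_replace1 i ls : (i < n)%N -> Ws Q (replace1 s i ls) = Ws Q ls * oth (fun j => j != i).
Proof.
move=> i_n; rewrite /replace1 !Ws_cat mulrCA; congr (_ * _); rewrite -Ws_cat.
rewrite /others -big_filter -(big_map (lnth s) xpredT W) /Ws; congr (\prod_(l <- _) _).
have -> : iota 0 n = iota 0 i ++ i :: iota i.+1 (n - i.+1).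
  by rewrite -{1}(subnKC i_n) addSnnS iotaD.
have f1 : [seq j <- iota 0 i | j != i] = iota 0 i.
  apply/all_filterP/allP => j; rewrite mem_iota; lia.
have f2 : [seq j <- iota i.+1 (n - i.+1) | j != i] = iota i.+1 (n - i.+1).
  apply/all_filterP/allP => j; rewrite mem_iota; lia.
rewrite filter_cat /= eqxx f1 f2 map_cat map_nth_iota0 ?(ltnW i_n) //.
by rewrite map_nth_iota // -(size_drop i.+1 s) take_size.
Qed.

Lemma Ws_merge i j l : Ws Q (l :: remove2 s i j) =
  W l * oth (fun h => (h != i) && (h != j)).
Proof. by rewrite /Ws big_cons /remove2 big_map big_filter. Qed.

Lemma Ws_rcons l : Ws Q (rcons s l) = Ws Q s * W l.
Proof. by rewrite -cats1 Ws_cat /Ws big_cons big_nil mulr1. Qed.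

Lemma SW_split P op : SW (split_set P op s) = \sum_(i <- iota 0 n)
  (\sum_(xy <- locpairs P (lnth s i)) Ws Q (op (lnth s i) xy.1 xy.2)) * oth (fun j => j != i).
Proof.
rewrite /split_set big_flatten big_map big_seq [RHS]big_seq; apply: eq_bigr => i.
rewrite mem_iota add0n /= => i_n; rewrite big_map mulr_suml.
by apply: eq_bigr => xy _; rewrite Ws_replace1.
Qed.

Lemma SW_twist P op : SW (twist_set P op s) = \sum_(i <- iota 0 n)
  (\sum_(xy <- locpairs P (lnth s i)) W (op (lnth s i) xy.1 xy.2)) * oth (fun j => j != i).
Proof.
rewrite /twist_set big_flatten big_map big_seq [RHS]big_seq; apply: eq_bigr => i.
rewrite mem_iota add0n /= => i_n; rewrite big_map mulr_suml.
by apply: eq_bigr => xy _; rewrite Ws_replace1 // /Ws big_cons big_nil mulr1.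
Qed.

Lemma SW_merge P op : SW (merge_set P op s) = \sum_(i <- iota 0 n)
  \sum_(j <- iota 0 n | j != i)
  (\sum_(xy <- locpairs2 P (lnth s i) (lnth s j)) W (op (lnth s i) (lnth s j) xy.1 xy.2))
  * oth (fun h => (h != i) && (h != j)).
Proof.
rewrite sum_ijpairs /merge_set big_flatten big_map; apply: eq_bigr => ij _.
by rewrite big_map mulr_suml; apply: eq_bigr => xy _; rewrite Ws_merge.
Qed.

Lemma SW_def op : SW (flatten [seq flatten [seq [seq replace1 s i [:: op (lnth s i) x p]
     | p <- plaqs_from L (enth (lnth s i) x)] | x <- iota 0 (size (lnth s i))] | i <- iota 0 n]) =
  \sum_(i <- iota 0 n) (\sum_(x <- iota 0 (size (lnth s i)))
    \sum_(p <- plaqs_from L (enth (lnth s i) x)) W (op (lnth s i) x p)) * oth (fun j => j != i).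
Proof.
rewrite big_flatten big_map big_seq [RHS]big_seq; apply: eq_bigr => i.
rewrite mem_iota add0n /= => i_n; rewrite big_flatten big_map mulr_suml.
apply: eq_bigr => x _; rewrite big_map mulr_suml.
by apply: eq_bigr => p _; rewrite Ws_replace1 // /Ws big_cons big_nil mulr1.
Qed.

(** [h] is the identity for negative expansions and edge reversal for positive ones. *)
Lemma SW_exp (h : edge -> edge) : SW (flatten [seq flatten [seq [seq rcons s p
     | p <- plaqs_from L (h (enth (lnth s i) x))] | x <- iota 0 (size (lnth s i))] | i <- iota 0 n]) =
  \sum_(i <- iota 0 n) (W (lnth s i) * \sum_(x <- iota 0 (size (lnth s i)))
    \sum_(p <- plaqs_from L (h (enth (lnth s i) x))) W p) * oth (fun j => j != i).
Proof.
rewrite big_flatten big_map big_seq [RHS]big_seq; apply: eq_bigr => i.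
rewrite mem_iota add0n /= => i_n; rewrite big_flatten big_map mulrAC -Ws_others // mulr_sumr.
apply: eq_bigr => x _; rewrite big_map mulr_sumr.
by apply: eq_bigr => p _; rewrite Ws_rcons.
Qed.

Definition sgtotal : C := \sum_(i <- iota 0 n) sgself (lnth s i) +
  \sum_(i <- iota 0 n) \sum_(j <- iota 0 n | j != i) sgpair (lnth s i) (lnth s j).

End PointwiseIdentity.

Section Combinations.
Variables (V : comNzRingType) (T : eqType).
Implicit Types (r : seq T) (sz p q u t g : T -> V).

(** Common bookkeeping for single loops and for pairs of loops, with w standing for the product of
    all Wilson loops. *)
Lemma sum_comb r (F : T -> V) (c w o kp : V) sz p q u t g :
  (forall i, i \in r ->
     F i = c * sz i * w + p i - o * q i - u i + o * t i - kp * g i * w) ->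
  \sum_(i <- r) F i =
  (c * (\sum_(i <- r) sz i) - kp * (\sum_(i <- r) g i)) * w + \sum_(i <- r) p i
  - o * (\sum_(i <- r) q i) - \sum_(i <- r) u i + o * (\sum_(i <- r) t i).
Proof.
elim: r => [_|a r ih h]; first by rewrite !big_nil; ring.
rewrite !big_cons ih; first by rewrite (h a (mem_head _ _)); ring.
by move=> i ir; apply: h; rewrite inE ir orbT.
Qed.

End Combinations.

Section PointwiseIdentity.
Variables (R : realType) (N d : nat) (k : gkind) (L : seq (vtx d)) (beta : R).
Local Notation C := R[i].
Local Notation mat := 'M[C]_N.
Local Notation edge := (edge d).
Hypothesis N0 : (0 < N)%N.
Variable Q : edge -> mat.
Hypothesis gQ : gval k Q.
Variable s : seq (seq edge).
Hypothesis gs : forall l, l \in s -> good L l.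
Local Notation same := (@Defs.same d).
Local Notation opp := (@Defs.opp d).
Local Notation es := (EplusL L).
Local Notation W := (Wl Q).
Local Notation o := (orth R k).
Local Notation kp := (kap R N k).
Local Notation hb := (hbeta N beta).
Local Notation oth := (others s Q).
Local Notation SW set := (\sum_(s' <- set) Ws Q s').
Local Notation n := (size s).
Local Notation csum := (csum k L).

Lemma csum_theta : csum (fun f Y X => theta L beta s f Y X Q) =
  \sum_(i <- iota 0 n) csum (fun f Y X => ddWl f Y X Q (lnth s i)) * oth (fun j => j != i)
  + \sum_(i <- iota 0 n) \sum_(j <- iota 0 n | j != i)
      csum (fun f Y X => dWl f Y Q (lnth s i) * dWl f X Q (lnth s j))
      * oth (fun h => (h != i) && (h != j))
  + \sum_(i <- iota 0 n)
      csum (fun f Y X => dWl f Y Q (lnth s i) * dS L beta f X Q) * oth (fun j => j != i).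
Proof.
rewrite /theta csumD; congr (_ + _).
  rewrite /ddWs csum_sum -big_split; apply: eq_bigr => i _; rewrite csumD csumMr.
  congr (_ + _).
  transitivity (csum (fun f Y X => \sum_(j <- iota 0 n | j != i)
     dWl f Y Q (lnth s i) * dWl f X Q (lnth s j) * oth (fun h => (h != i) && (h != j)))).
    apply: eq_csum => f Y X; rewrite mulr_sumr; apply: eq_bigr => j _; exact: mulrA.
  by rewrite csum_sum; apply: eq_bigr => j _; rewrite csumMr.
transitivity (csum (fun f Y X => \sum_(i <- iota 0 n)
    dWl f Y Q (lnth s i) * dS L beta f X Q * oth (fun j => j != i))).
  by apply: eq_csum => f Y X; rewrite /dWs mulr_suml; apply: eq_bigr => i _; rewrite mulrAC.
by rewrite csum_sum; apply: eq_bigr => i _; rewrite csumMr.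
Qed.

Lemma lnth_good i : (i < n)%N -> good L (lnth s i).
Proof. by move=> i_n; apply: gs; apply: mem_nth. Qed.

Lemma slenE : (slen s)%:R = \sum_(i <- iota 0 n) (size (lnth s i))%:R :> C.
Proof.
rewrite /slen size_flatten /shape sumnE -natr_sum big_map; congr (_%:R).
by rewrite -{1}(mkseq_nth [::] s) big_map.
Qed.

Lemma sum_sub (T : Type) (r : seq T) (F G : T -> C) :
  \sum_(a <- r) (F a - o * G a) = \sum_(a <- r) F a - o * \sum_(a <- r) G a.
Proof. by rewrite sumrB mulr_sumr. Qed.

Lemma laplacian_part :
  \sum_(i <- iota 0 n) csum (fun f Y X => ddWl f Y X Q (lnth s i)) * oth (fun j => j != i) =
  ((N%:R - kp - o) * (slen s)%:R
     - kp * \sum_(i <- iota 0 n) sgself R (lnth s i)) * Ws Q s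
  + SW (Splus s) - o * SW (Tminus s) - SW (Sminus s) + o * SW (Tplus s).
Proof.
rewrite /Splus /Tminus /Sminus /Tplus slenE.
rewrite (SW_twist N0 Q s same (@neg_twist d)) (SW_twist N0 Q s opp (@pos_twist d)).
rewrite (SW_split N0 Q s same (@pos_split d)) (SW_split N0 Q s opp (@neg_split d)).
apply: sum_comb => i; rewrite mem_iota add0n /= => i_n.
rewrite (loop_laplacian N0 gQ (lnth_good i_n)) !sum_sub (Ws_others Q i_n).
move: (\sum_(xy <- _) _) (\sum_(xy <- _) _) (\sum_(xy <- _) _) (\sum_(xy <- _) _) => p1 p2 p3 p4.
move: (W _) (oth _) (sgself _ _) => p5 p6 p7; ring.
Qed.

Lemma Ws_others2 i j : (i < n)%N -> (j < n)%N -> j != i ->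
  Ws Q s = W (lnth s i) * W (lnth s j) * oth (fun h => (h != i) && (h != j)).
Proof.
move=> i_n j_n ji; rewrite (Ws_others Q i_n) -mulrA; congr (_ * _).
rewrite /others -big_filter (bigD1_seq j) ?filter_uniq ?iota_uniq //=; last first.
  by rewrite mem_filter ji mem_iota.
by rewrite big_filter_cond.
Qed.

(** Two distinct loops have no diagonal term; [0 * 0] is the vacant size coefficient of
    [sum_comb]. *)
Lemma gradient_part :
  \sum_(i <- iota 0 n) \sum_(j <- iota 0 n | j != i)
      csum (fun f Y X => dWl f Y Q (lnth s i) * dWl f X Q (lnth s j))
      * oth (fun h => (h != i) && (h != j)) =
  (0 * 0 - kp * \sum_(i <- iota 0 n) \sum_(j <- iota 0 n | j != i)
     sgpair R (lnth s i) (lnth s j)) * Ws Q s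
  + SW (merge_set same (@merge_pos d) s) - o * SW (merge_set same (@merge_neg d) s)
  - SW (merge_set opp (@merge_neg d) s) + o * SW (merge_set opp (@merge_pos d) s).
Proof.
rewrite !SW_merge !sum_ijpairs.
have -> : 0 * 0 = 0 * (\sum_(ij <- ijpairs s) 0) :> C by rewrite !mul0r.
apply: sum_comb => -[i j]; rewrite mem_filter /=.
case/andP=> ij /allpairsP[[i' j'] /= [hi hj [ei ej]]]; move: hi hj; rewrite -ei -ej.
rewrite !mem_iota !add0n /= => i_n j_n; have ji : j != i by rewrite eq_sym.
rewrite (loop_gradient N0 gQ (lnth_good i_n) (lnth_good j_n)) !sum_sub.
rewrite (Ws_others2 i_n j_n ji).
move: (\sum_(xy <- _) _) (\sum_(xy <- _) _) (\sum_(xy <- _) _) (\sum_(xy <- _) _) => p1 p2 p3 p4.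
move: (W (lnth s i)) (W (lnth s j)) (oth _) (sgpair _ _ _) => p5 p6 p7 p8; ring.
Qed.

Lemma action_part :
  \sum_(i <- iota 0 n)
    csum (fun f Y X => dWl f Y Q (lnth s i) * dS L beta f X Q) * oth (fun j => j != i) =
  hb * ((1 + o) * (SW (Dplus L s) - SW (Dminus L s))
        - kp * (SW (Eminus L s) - SW (Eplus L s))).
Proof.
rewrite /Dplus /Dminus (SW_def L N0 Q s (@def_pos d)) (SW_def L N0 Q s (@def_neg d)).
rewrite /Eminus /Eplus (SW_exp L Q s id) (SW_exp L Q s (@einv d)).
rewrite -!sumrB !mulr_sumr -sumrB mulr_sumr big_seq [RHS]big_seq.
apply: eq_bigr => i; rewrite mem_iota add0n /= => i_n.
rewrite (loop_action beta N0 gQ (lnth_good i_n)) -mulrA; congr (_ * _).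
set l := lnth s i; set w := oth _.
rewrite sumrB -!mulr_sumr !sumrB; rewrite -!/(W l).
move: (\sum_(x <- _) _) (\sum_(x <- _) _) (\sum_(x <- _) _) (\sum_(x <- _) _) => p1 p2 p3 p4.
move: (W l) => p5; ring.
Qed.

Lemma pointwise_identity : csum (fun f Y X => theta L beta s f Y X Q) =
  ((N%:R - kp - o) * (slen s)%:R - kp * sgtotal R s) * Ws Q s
  + SW (Splus s) - o * SW (Tminus s) - SW (Sminus s) + o * SW (Tplus s)
  + SW (MUplus s) - o * SW (merge_set same (@merge_neg d) s)
  - SW (MUminus s) + o * SW (merge_set opp (@merge_pos d) s)
  + hb * ((1 + o) * (SW (Dplus L s) - SW (Dminus L s))
        - kp * (SW (Eminus L s) - SW (Eplus L s))).
Proof.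
rewrite csum_theta laplacian_part gradient_part action_part /sgtotal /MUplus /MUminus.
move: (SW _) (SW _) (SW _) (SW _) (SW _) (SW _) (SW _) (SW _) (SW _) (SW _) (SW _) (SW _).
move=> p1 p2 p3 p4 p5 p6 p7 p8 p9 p10 p11 p12.
move: (\sum_(i <- _) _) (\sum_(i <- _) _) (Ws Q s) => p13 p14 p15; ring.
Qed.

End PointwiseIdentity.

(** * Signed counting of edge occurrences *)

Section SignCount.
Variables (R : realType) (d : nat).
Local Notation C := R[i].
Local Notation edge := (edge d).
Variable s : seq (seq edge).
Hypothesis ns : all (@nondeg d) (flatten s).
Implicit Types (e f : edge) (F l : seq edge).

Definition turn F e : int := (count_mem e F)%:Z - (count_mem (einv e) F)%:Z.

Lemma turnE F f : turn F f = \sum_(e <- F) ((e == f)%:R - (e == einv f)%:R).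
Proof.
elim: F => [|e F ih]; first by rewrite big_nil.
by rewrite big_cons -ih /turn /= !PoszD -!natz; ring.
Qed.

Lemma sum_sg F e : \sum_(e' <- F) sg R e e' = (turn F e)%:~R.
Proof.
rewrite turnE rmorph_sum /=; apply: eq_bigr => e' _.
by rewrite rmorphB /= !rmorph_nat.
Qed.

(** Occurrences are grouped by their positive edge f: each f contributes t(f), each f^{-1}
    contributes -t(f), and the group adds up to t(f)^2. *)
Lemma sum_turn F : all (@nondeg d) F -> \sum_(e <- F) turn F e =
  \sum_(f <- undup [seq (if positive e then e else einv e) | e <- F]) turn F f ^+ 2.
Proof.
move=> nF; set A := undup _.
have -> : \sum_(e <- F) turn F e = \sum_(e <- F) \sum_(f <- A | absedge e == f) turn F e.
  rewrite big_seq [RHS]big_seq; apply: eq_bigr => e eF.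
  rewrite -big_filter (_ : [seq f <- A | absedge e == f] = [:: absedge e]) ?big_seq1 //.
  have uA : uniq A by apply: undup_uniq.
  rewrite (eq_filter (a2 := pred1 (absedge e))) => [|f]; last by rewrite /= eq_sym.
  by rewrite filter_pred1_uniq // mem_undup; apply: map_f.
rewrite (exchange_big_dep xpredT) //= big_seq [RHS]big_seq; apply: eq_bigr => f.
rewrite mem_undup => /mapP[e0 e0F fE].
have ne0 := allP nF _ e0F.
have pf : positive f by rewrite fE; case: ifP => // p; rewrite nondeg_positive_einv // p.
have nf : nondeg f by rewrite fE; case: ifP => _ //; rewrite nondeg_einv.
transitivity (\sum_(e <- F) (((e == f)%:R - (e == einv f)%:R) * turn F f)).
  rewrite big_mkcond big_seq [RHS]big_seq; apply: eq_bigr => e eF.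
  have ne := allP nF _ eF; rewrite /absedge.
  case: (boolP (positive e)) => pe.
    have -> : (e == einv f) = false.
      by apply/negP => /eqP h; move: pe; rewrite h (negPf (positive_einv pf)).
    by case: eqP => [->|_]; rewrite ?subr0 ?mul1r ?mul0r.
  have -> : (e == f) = false by apply/negP => /eqP h; move: pe; rewrite h pf.
  rewrite -(inj_eq (can_inj (@einvK d))) einvK; case: eqP => [->|_]; last by rewrite subrr mul0r.
  by rewrite sub0r mulN1r /turn einvK opprB.
by rewrite -mulr_suml -turnE expr2.
Qed.

Lemma sum_iota_nth (T : Type) (x0 : T) (r : seq T) (F : T -> C) :
  \sum_(a <- r) F a = \sum_(i <- iota 0 (size r)) F (nth x0 r i).
Proof. by rewrite -{1}(mkseq_nth x0 r) big_map. Qed.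

Lemma sgpair_flat l l' : sgpair R l l' = \sum_(e <- l) \sum_(e' <- l') sg R e e'.
Proof.
rewrite /sgpair (sum_iota_nth (e0 d) l); apply: eq_bigr => x _.
by rewrite (sum_iota_nth (e0 d) l').
Qed.

Lemma sgself_flat l : all (@nondeg d) l ->
  (size l)%:R + sgself R l = sgpair R l l.
Proof.
move=> nl; rewrite /sgself /sgpair.
have -> : (size l)%:R = \sum_(x <- iota 0 (size l)) 1 :> C.
  by rewrite big_const_seq count_predT size_iota iter_addr_0.
rewrite -big_split big_seq [RHS]big_seq; apply: eq_bigr => x xl /=.
rewrite [RHS](bigD1_seq x) ?iota_uniq //=; congr (_ + _); last first.
  by apply: eq_bigl => y; rewrite eq_sym.
rewrite /sg (same_opp (allP nl _ _)).1 /Defs.same ?eqxx ?subr0 //.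
by apply: mem_nth; move: xl; rewrite mem_iota.
Qed.

(** ell(s) is the signed number of ordered pairs of locations in the whole sequence, +1 for equal
    and -1 for opposite edges; pairing each location with itself accounts for |s|. *)
Lemma ell_count : (slen s)%:R + sgtotal R s = (ell s)%:~R.
Proof.
have -> : ell s = \sum_(e <- flatten s) turn (flatten s) e by rewrite sum_turn.
rewrite rmorph_sum /=; under [RHS]eq_bigr => e _ do rewrite -sum_sg.
rewrite slenE /sgtotal addrA -big_split -big_split /=.
have -> : \sum_(e <- flatten s) \sum_(e' <- flatten s) sg R e e' =
    \sum_(i <- iota 0 (size s)) \sum_(j <- iota 0 (size s)) sgpair R (lnth s i) (lnth s j).
  rewrite big_flatten (sum_iota_nth [::] s); apply: eq_bigr => i _.
  under [RHS]eq_bigr => j _ do rewrite sgpair_flat.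
  rewrite [RHS]exchange_big; apply: eq_bigr => e _.
  by rewrite big_flatten (sum_iota_nth [::] s).
rewrite big_seq [RHS]big_seq; apply: eq_bigr => i; rewrite mem_iota add0n /= => i_n.
rewrite [RHS](bigD1_seq i) ?iota_uniq ?mem_iota //=; congr (_ + _).
apply: sgself_flat; apply/allP => e el; apply: (allP ns); apply/flattenP.
by exists (lnth s i) => //; apply: mem_nth.
Qed.

End SignCount.

(** * Master loop equations *)

Section SetSizes.
Variables (d : nat) (s : seq (seq (edge d))).
Local Notation edge := (edge d).
Local Notation n := (size s).

Lemma size_replace1 i (ls : seq (seq edge)) : (i < n)%N ->
  size (replace1 s i ls) = (size ls + n.-1)%N.
Proof. by move=> i_n; rewrite /replace1 !size_cat size_take i_n size_drop; lia. Qed.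

Lemma size_remove2 i j : (i < n)%N -> (j < n)%N -> i != j -> (size (remove2 s i j)).+2 = n.
Proof.
move=> i_n j_n ij; rewrite /remove2 size_map.
suff /perm_size : perm_eq (i :: j :: [seq h <- iota 0 n | (h != i) && (h != j)]) (iota 0 n).
  by rewrite /= size_iota.
apply: uniq_perm; rewrite ?iota_uniq //=.
  by rewrite !inE !mem_filter !eqxx !andbF (negPf ij) filter_uniq ?iota_uniq.
move=> h; rewrite !inE mem_filter mem_iota add0n /=.
case: (h =P i) => [->|_]; first by rewrite i_n.
by case: (h =P j) => [->|_]; rewrite ?j_n.
Qed.

Lemma size_split_set P op s' : (forall l x y, size (op l x y) = 2%N) ->
  s' \in split_set P op s -> size s' = n.+1.
Proof.
move=> h; case/flatten_mapP=> i; rewrite mem_iota add0n /= => i_n; case/mapP=> xy _ ->.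
by rewrite size_replace1 // h; lia.
Qed.

Lemma size_twist_set P op s' : s' \in twist_set P op s -> size s' = n.
Proof.
case/flatten_mapP=> i; rewrite mem_iota add0n /= => i_n; case/mapP=> xy _ ->.
by rewrite size_replace1 //=; lia.
Qed.

Lemma size_merge_set P op s' : s' \in merge_set P op s -> (size s').+1 = n.
Proof.
case/flatten_mapP=> -[i j]; rewrite mem_filter /= => /andP[ij].
case/allpairsP=> -[i' j'] /= [hi hj [ei ej]]; move: hi hj; rewrite -ei -ej.
rewrite !mem_iota !add0n /= => i_n j_n; case/mapP=> xy _ -> /=; exact: size_remove2.
Qed.

Lemma size_Dplus L s' : s' \in Dplus L s -> size s' = n.
Proof.
case/flatten_mapP=> i; rewrite mem_iota add0n /= => i_n; case/flatten_mapP=> x _.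
by case/mapP=> p _ ->; rewrite size_replace1 //=; lia.
Qed.

Lemma size_Dminus L s' : s' \in Dminus L s -> size s' = n.
Proof.
case/flatten_mapP=> i; rewrite mem_iota add0n /= => i_n; case/flatten_mapP=> x _.
by case/mapP=> p _ ->; rewrite size_replace1 //=; lia.
Qed.

Lemma size_Eminus L s' : s' \in Eminus L s -> size s' = n.+1.
Proof.
by case/flatten_mapP=> i _; case/flatten_mapP=> x _; case/mapP=> p _ ->; rewrite size_rcons.
Qed.

Lemma size_Eplus L s' : s' \in Eplus L s -> size s' = n.+1.
Proof.
by case/flatten_mapP=> i _; case/flatten_mapP=> x _; case/mapP=> p _ ->; rewrite size_rcons.
Qed.

(** An edge differs from its reverse, so the two kinds of mergers are disjoint. The contractions
    produce them separately, while the equation for SO(N) joins them. *)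
Lemma sum_sameopp (V : nzRingType) op (F : seq (seq edge) -> V) :
  (forall l, l \in s -> all (@nondeg d) l) ->
  \sum_(s' <- merge_set (@sameopp d) op s) F s' =
  \sum_(s' <- merge_set (@Defs.same d) op s) F s' + \sum_(s' <- merge_set (@Defs.opp d) op s) F s'.
Proof.
move=> ns; rewrite /merge_set !big_flatten !big_map -big_split big_seq [RHS]big_seq.
apply: eq_bigr => -[i j]; rewrite mem_filter /= => /andP[_].
case/allpairsP=> -[i' j'] /= [hi hj [ei ej]]; move: hi hj; rewrite -ei -ej.
rewrite !mem_iota !add0n /= => i_n j_n; rewrite !big_map.
pose G x y := F (op (lnth s i) (lnth s j) x y :: remove2 s i j).
rewrite -!(sum_locpairs2 _ _ _ G) -big_split big_seq [RHS]big_seq.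
apply: eq_bigr => x; rewrite mem_iota add0n /= => xl; rewrite -big_split.
apply: eq_bigr => y _ /=; rewrite -mulrDl; congr (_ * _).
have ne : nondeg (enth (lnth s i) x).
  by apply: (allP (ns _ _)); [apply: mem_nth | apply: mem_nth].
rewrite /sameopp /Defs.same /Defs.opp; case: eqP => [->|_] /=; rewrite ?add0r //.
by rewrite nondeg_neq_einv // addr0.
Qed.

End SetSizes.

(** * Expectations and powers of N *)

Section Conclusion.
Variables (R : realType) (d N : nat) (k : gkind) (L : seq (vtx d)) (beta : R).
Local Notation C := R[i].
Local Notation mat := 'M[C]_N.
Local Notation edge := (edge d).
Variables (I : (mat -> C) -> C) (s : seq (seq edge)).
Hypotheses (d2 : (1 < d)%N) (N1 : (1 < N)%N) (hI : is_haar (inG k) I).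
Hypotheses (hs : all (@is_loop d) s) (hL : nbhd_in L s).
Local Notation config := (edge -> mat).
Local Notation Ex F := (YMexp L beta I F).
Local Notation n := (size s).
Local Notation ph := (phi L beta I).
Local Notation S := (sumphi L beta I).

(** The neighbourhood hypothesis at a starting vertex supplies the end vertex too, so every edge of
    a loop is integrated over. *)
Lemma loops_good l : l \in s -> good L l.
Proof.
move=> ls; apply/allP => e el.
have ee : is_edge e by have /and4P[_ /allP h _ _] := allP hs _ ls; apply: h.
have [u1 u2] := hL ls el; rewrite /inbox is_edge_nondeg //=.
have v2 : e.2 \in L.
  have -> : e.2 = vadd e.1 (vsub e.2 e.1) by rewrite vaddE vsubE addrC subrK.
  exact: u2.
have ee' : is_edge (einv e).
  by rewrite /is_edge /nn /= -unitvecs_neg vnegE !vsubE opprB -vsubE.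
have mem (u v : vtx d) : u \in L -> v \in L -> is_edge (u, v) -> positive (u, v) -> (u, v) \in EplusL L.
  move=> uL vL ie pe; rewrite mem_filter ie pe /=; apply/allpairsP; exists (u, v).
  by rewrite !mem_undup.
rewrite /absedge; case: ifP => p; first by case: (e) u1 v2 ee p => u v; apply: mem.
by apply: mem => //; have := nondeg_positive_einv (is_edge_nondeg ee); rewrite p.
Qed.

(** Lipschitz bounds are components of [dif]; they are read off along the constant curve with X = 0
    at some positive edge, which a unit vector provides. *)
Lemma lips : (forall l, lip k (fun Q : config => Wl Q l)) /\ lip k (@weight R N d L beta).
Proof.
pose u := unitvec (Ordinal (ltnW d2)) true.
have [f pf] : exists f : edge, positive f.
  have : v0 d != u by rewrite eq_sym v0E; apply: unitvec_neq0.
  by move=> /lexlt_total/orP[h|h]; [exists (v0 d, u)|exists (u, v0 d)].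
have gX : curve k (fun=> 1%:M) (0 : mat).
  split; first by move=> *; apply: inG1.
    by apply/matrixP => i j; rewrite !mxE conjC0 oppr0.
  move=> T D i j; apply: uexp_ext (uexp_cst (T := T) D (1%:M i j : C)) => // x _.
  by rewrite mxE.
split=> [l|]; first by have [] := dif_Wl pf gX l.
have [l _ _] := dif_expRe gX (dif_action L beta pf gX) (@action_real _ _ _ _ L beta).
by apply: lip_ext l => Q gQ; exact: weightE gQ.
Qed.

Lemma lip_Ws s' : lip k (fun Q : config => Ws Q s').
Proof. by apply: lip_prod => l; have [] := lips. Qed.

Lemma Ex_lin c (F G : config -> C) : lip k F -> lip k G ->
  Ex (fun Q => F Q + c * G Q) = Ex F + c * Ex G.
Proof.
move=> lF lG; have [_ lw] := lips; rewrite /YMexp mulrA -mulrDl; congr (_ / _).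
rewrite -(intg_lin hI _ _ (@gval_Q0 _ _ _ _) (lipM lF lw) (lipM lG lw)).
by congr (intg _ _ _ _); apply/funext => Q; rewrite mulrDl mulrA.
Qed.

Lemma Ex0 : Ex (fun=> 0) = 0.
Proof.
rewrite /YMexp; have [_ z] := null0 (d := d) L hI.
have -> : (fun Q : config => 0 * weight L beta Q) = fun=> 0.
  by apply/funext => Q; rewrite mul0r.
by rewrite z mul0r.
Qed.

Lemma Ex_sum (r : seq (seq (seq edge))) :
  Ex (fun Q => \sum_(s' <- r) Ws Q s') = \sum_(s' <- r) Ex (fun Q => Ws Q s').
Proof.
elim: r => [|a r ih].
  by rewrite big_nil -[RHS]Ex0; congr (Ex _); apply/funext => Q; rewrite big_nil.
rewrite big_cons -ih -[X in _ + X]mul1r -Ex_lin; last 2 first.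
- exact: lip_Ws.
- by apply: lip_sum => s'; apply: lip_Ws.
by congr (Ex _); apply/funext => Q; rewrite big_cons mul1r.
Qed.

Lemma Ex_terms (ts : seq (C * seq (seq (seq edge)))) :
  Ex (fun Q => \sum_(t <- ts) t.1 * \sum_(s' <- t.2) Ws Q s') =
  \sum_(t <- ts) t.1 * \sum_(s' <- t.2) Ex (fun Q => Ws Q s').
Proof.
elim: ts => [|t ts ih].
  by rewrite big_nil -[RHS]Ex0; congr (Ex _); apply/funext => Q; rewrite big_nil.
rewrite big_cons -ih -Ex_sum addrC -Ex_lin; last 2 first.
- apply: lip_sum => t'; apply: lipM; first exact: lip_cst.
  by apply: lip_sum => s'; apply: lip_Ws.
- by apply: lip_sum => s'; apply: lip_Ws.
by congr (Ex _); apply/funext => Q; rewrite big_cons addrC.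
Qed.

Let natN : N%:R != 0 :> C. Proof. by rewrite pnatr_eq0 -lt0n ltnW. Qed.

Lemma Ex_Ws s' : Ex (fun Q => Ws Q s') = N%:R ^+ size s' * ph s'.
Proof. by rewrite /phi mulrCA divff ?mulr1 // expf_neq0. Qed.

(** One operation always yields the same number of loops: n + 1 for splittings and expansions, n for
    twistings and deformations, n - 1 for mergers. Relative to N^n this gives the factors N, 1 and
    1/N. *)
Lemma Ex_set c (r : seq (seq (seq edge))) :
  (forall s', s' \in r -> N%:R ^+ size s' = c :> C) ->
  \sum_(s' <- r) Ex (fun Q => Ws Q s') = c * S r.
Proof.
move=> h; rewrite /sumphi mulr_sumr big_seq [RHS]big_seq; apply: eq_bigr => s' sr.
by rewrite Ex_Ws h.
Qed.

Local Notation kp := (kap R N k).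
Local Notation o := (orth R k).
Local Notation hb := (hbeta N beta).
Local Notation Ms := (merge_set (@Defs.same d) (@merge_neg d) s).
Local Notation Mo := (merge_set (@Defs.opp d) (@merge_pos d) s).

Lemma master : ((N%:R - kp - o) * (slen s)%:R - kp * sgtotal R s) * ph s =
  N%:R * S (Sminus s) - N%:R * S (Splus s) + o * S (Tminus s) - o * S (Tplus s)
  + N%:R^-1 * (S (MUminus s) - S (MUplus s) + o * S Ms - o * S Mo)
  + hb * (1 + o) * (S (Dminus L s) - S (Dplus L s))
  + hb * kp * N%:R * (S (Eminus L s) - S (Eplus L s)).
Proof.
pose c := (N%:R - kp - o) * (slen s)%:R - kp * sgtotal R s.
(* The coefficients of [pointwise_identity]; the sequence itself enters as a singleton. *)
pose ts := [:: (c, [:: s]); (1, Splus s); (- o, Tminus s); (-1, Sminus s); (o, Tplus s);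
  (1, MUplus s); (- o, Ms); (-1, MUminus s); (o, Mo);
  (hb * (1 + o), Dplus L s); (- (hb * (1 + o)), Dminus L s);
  (- (hb * kp), Eminus L s); (hb * kp, Eplus L s)].
have z : Ex (fun Q => \sum_(t <- ts) t.1 * \sum_(s' <- t.2) Ws Q s') = 0.
  have [_ zero] : null k L I (fun Q => (\sum_(t <- ts) t.1 * \sum_(s' <- t.2) Ws Q s')
      * weight L beta Q).
    have sd := schwinger_dyson L beta s N1 hI.
    apply: null_ext sd => // Q gQ.
    rewrite -/(csum k L (fun f Y X => theta L beta s f Y X Q)).
    rewrite (pointwise_identity beta (ltnW N1) gQ loops_good); congr (_ * _).
    rewrite /ts !big_cons !big_nil /= addr0 -/c; ring.
  by rewrite /YMexp zero mul0r.
rewrite Ex_terms /ts !big_cons !big_nil /= in z.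
have Nn0 : N%:R ^+ n != 0 :> C by rewrite expf_neq0.
have sp P op : (forall l x y, size (op l x y) = 2%N) ->
  \sum_(s' <- split_set P op s) Ex (fun Q => Ws Q s') = N%:R * N%:R ^+ n * S (split_set P op s).
  by move=> h; apply: Ex_set => s' /(size_split_set h) ->; rewrite exprS.
have tw P op : \sum_(s' <- twist_set P op s) Ex (fun Q => Ws Q s') =
    N%:R ^+ n * S (twist_set P op s).
  by apply: Ex_set => s' /size_twist_set ->.
have me P op : \sum_(s' <- merge_set P op s) Ex (fun Q => Ws Q s') =
    N%:R^-1 * N%:R ^+ n * S (merge_set P op s).
  by apply: Ex_set => s' /size_merge_set <-; rewrite exprS mulKf.
rewrite /Splus /Sminus /Tplus /Tminus /MUplus /MUminus in z *.
rewrite !sp // !tw !me addr0 Ex_Ws in z.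
rewrite (Ex_set (c := N%:R ^+ n) (r := Dplus L s)) in z; last by move=> s' /size_Dplus ->.
rewrite (Ex_set (c := N%:R ^+ n) (r := Dminus L s)) in z; last by move=> s' /size_Dminus ->.
rewrite (Ex_set (c := N%:R * N%:R ^+ n) (r := Eminus L s)) in z; last first.
  by move=> s' /size_Eminus ->; rewrite exprS.
rewrite (Ex_set (c := N%:R * N%:R ^+ n) (r := Eplus L s)) in z; last first.
  by move=> s' /size_Eplus ->; rewrite exprS.
move: z; rewrite -/c.
move: (S _) (S _) (S _) (S _) (S _) (S _) (S _) (S _) (S _) (S _) (S _) (S _).
move=> p1 p2 p3 p4 p5 p6 p7 p8 p9 p10 p11 p12.
move: (ph s) (N%:R ^+ n) Nn0 => p0 w w0 z.
(* After cancelling N^n the claim is a rearrangement of z. *)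
apply: (mulfI w0); apply/eqP; rewrite -subr_eq0; apply/eqP; rewrite -[RHS]z; ring.
Qed.

End Conclusion.

Theorem theorem1p1 (R : realType) (d N : nat) (L : seq (vtx d)) (beta : R)
    (G : gkind) (I : ('M[R[i]]_N -> R[i]) -> R[i]) (s : seq (seq (edge d))) :
  (2 <= d)%N -> (2 <= N)%N ->
  is_haar (inG G) I ->
  all (@is_loop d) s ->
  nbhd_in L s ->
  let ph := phi L beta I in
  let S := sumphi L beta I in
  let Nr : R[i] := N%:R in
  let b : R[i] := (beta%:C)%C in
  match G with
  | SO =>
      (Nr - 1) * (slen s)%:R * ph s =
        Nr * b * S (Dminus L s) - Nr * b * S (Dplus L s)
        + Nr * S (Sminus s) - Nr * S (Splus s)
        + S (Tminus s) - S (Tplus s)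
        + Nr^-1 * S (Mminus s) - Nr^-1 * S (Mplus s)
  | SU =>
      (Nr * (slen s)%:R - (ell s)%:~R / Nr) * ph s =
        Nr * b / 2 * S (Dminus L s) - Nr * b / 2 * S (Dplus L s)
        + Nr * S (Sminus s) - Nr * S (Splus s)
        + Nr * b / 2 * S (Eminus L s) - Nr * b / 2 * S (Eplus L s)
        + Nr^-1 * S (MUminus s) - Nr^-1 * S (MUplus s)
  | U =>
      Nr * (slen s)%:R * ph s =
        Nr * b / 2 * S (Dminus L s) - Nr * b / 2 * S (Dplus L s)
        + Nr * S (Sminus s) - Nr * S (Splus s)
        + Nr^-1 * S (MUminus s) - Nr^-1 * S (MUplus s)
  end.
Proof.
move=> d2 N1 hI hs hL ph S Nr b.
have natN : Nr != 0 by rewrite pnatr_eq0 -lt0n ltnW.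
have ns l : l \in s -> all (@nondeg d) l by move=> /(loops_good hs hL)/good_nondeg.
have := master beta d2 N1 hI hs hL; rewrite /hbeta -/ph -/S -/Nr -/b.
case: G hI => hI /=.
(* SO(N): kappa = 0 and o = 1, so the twistings survive and the action coefficient doubles to N
   beta. The o terms supply the mergers that [MUplus] and [MUminus] omit. *)
- have -> : S (Mminus s) = S (merge_set (@Defs.same d) (@merge_neg d) s) + S (MUminus s).
    exact: sum_sameopp ns.
  have -> : S (Mplus s) = S (MUplus s) + S (merge_set (@Defs.opp d) (@merge_pos d) s).
    exact: sum_sameopp ns.
  move: (S _) (S _) (S _) (S _) (S _) (S _) (S _) (S _) (S _) (S _) (S _) (S _).
  move=> p1 p2 p3 p4 p5 p6 p7 p8 p9 p10 p11 p12; move: (ph s) => p0 z.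
  transitivity (((Nr - 0 - 1) * (slen s)%:R - 0 * sgtotal R s) * p0); first by ring.
  by rewrite z; field.
- move: (S _) (S _) (S _) (S _) (S _) (S _) (S _) (S _) (S _) (S _) (S _) (S _).
  move=> p1 p2 p3 p4 p5 p6 p7 p8 p9 p10 p11 p12; move: (ph s) => p0 z.
  transitivity (((Nr - 0 - 0) * (slen s)%:R - 0 * sgtotal R s) * p0); first by ring.
  by rewrite z; field.
(* SU(N): kappa = 1/N multiplies |s| plus [sgtotal], which is ell(s), and the expansions receive (N
   beta / 2) * kappa * N = N beta / 2. *)
- rewrite -/Nr -ell_count; last first.
    by apply/allP => e /flattenP[l ls el]; apply: (allP (ns l ls)).
  move: (S _) (S _) (S _) (S _) (S _) (S _) (S _) (S _) (S _) (S _) (S _) (S _).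
  move=> p1 p2 p3 p4 p5 p6 p7 p8 p9 p10 p11 p12; move: (ph s) => p0 z.
  transitivity (((Nr - Nr^-1 - 0) * (slen s)%:R - Nr^-1 * sgtotal R s) * p0); first by ring.
  by rewrite z; field.
Qed.
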